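(* Let $R\ge2$, let $V^R$ be the rank $2R$ free fermion vertex operator superalgebra, and let $$\Psi^R=\frac{(-1)^R}{R!}\left((R-1)\beta^R_{1^R}+\sum_{k=2}^R(-1)^{k+1}(k-1)!\,\beta^R_{1^{R-k}k^1}\right).$$ Then $J[1]\Psi^R=0$, and the $\sigma$-twisted Jacobi $1$-point function of $\Psi^R$ is $$Z^J_{V^R_\sigma}(\Psi^R;z,\tau)=K_R(z,\tau)\left(\frac{\theta_1(z,\tau)}{\eta(\tau)}\right)^R,\qquad K_R(z,\tau)=\sum_{m=0}^R\frac1{m!}\widetilde G_{R-m}(z,\tau)\,\widetilde G_1(z,\tau)^m.$$
   Context: Notation: $q=e^{2\pi i\tau}$, $\zeta=e^{2\pi iz}$, $q_w=e^{2\pi iw}$. Free fermions: $V^R$ is the vertex operator superalgebra generated by odd vectors $\psi_r^\pm$ ($1\le r\le R$) of weight $\frac12$, with $Y(\psi_r^\pm,z)=\sum_{n\in\mathbb{Z}}\psi_r^\pm(n)z^{-n-1}$ and anticommutators $[\psi_r^+(m),\psi_s^-(n)]=\delta_{rs}\delta_{m,-n-1}$, $[\psi_r^\pm(m),\psi_s^\pm(n)]=0$. The Virasoro vector is $\omega=\frac12\sum_r(\psi_r^+(-2)\psi_r^-+\psi_r^-(-2)\psi_r^+)$, of central charge $R$, with grading operator $L(0)$. Put $J=\sum_{r=1}^R\psi_r^+(-1)\psi_r^-$; then $J(0)\psi_r^\pm=\pm\psi_r^\pm$ and $J(1)J=R\mathbf{1}$. The parity automorphism is $\sigma=e^{\pi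 iJ(0)}$, and $\mathrm{str}_VX=\mathrm{tr}_V\,\sigma X$. Square bracket modes: $Y[v,x]=Y(e^{xL(0)}v,e^x-1)=\sum_nv[n]x^{-n-1}$. Twisted $1$-point function: $Y_\sigma(v,z)=Y(\Delta(\sigma,z)v,z)$ with $\Delta(\sigma,z)=z^{\frac12J(0)}\exp\left(-\frac12\sum_{n\ge1}\frac{J(n)}{n}(-z)^{-n}\right)$, and $$Z^J_{V^R_\sigma}(v;z,\tau)=i^R\,\mathrm{str}_V\,Y_\sigma(e^{xL(0)}v,e^x)\,\zeta^{J(0)+\frac R2}q^{L(0)+\frac12J(0)+\frac R{12}},$$ which is independent of $x$ (here $z^{1/2}$ in $\Delta$ at $z=e^x$ is $e^{x/2}$). In particular $Z^J_{V^R_\sigma}(\mathbf{1};z,\tau)=(\theta_1(z,\tau)/\eta(\tau))^R$. Fock vectors: for $1\le r\le R$ let $b_r^0=1$ and $b_r^k=\psi_r^+[-k]\psi_r^-[-1]$ for $k\ge1$ (for different labels $r$ these commute). For a partition $\pi=1^{j_1}\cdots n^{j_n}$ of $n\le R$ (part $k$ occurring $j_k$ times) with $m=\sum_kj_k\le R$ parts and $j_0=R-m$, let $$\beta^n_\pi=\sum_fb_1^{f(1)}b_2^{f(2)}\cdots b_R^{f(R)}\mathbf{1},$$ the sum over all $\frac{R!}{j_0!j_1!\cdots j_n!}$ functions $f:\{1,\dots,R\}\to\mathbb{N}_0$ taking each value $k\in\{0,\dots,n\}$ exactly $j_k$ times. Thus $1^R$ is the partition of $R$ into $R$ ones and $1^{R-k}k^1$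 has $R-k$ ones and one part $k$. Functions: $\theta_1(w,\tau)=i\sum_{n\in\mathbb{Z}}(-1)^nq^{\frac12(n+\frac12)^2}q_w^{n+\frac12}$; $\eta(\tau)=q^{1/24}\prod_{n\ge1}(1-q^n)$; $\widetilde P_1(w,z,\tau)=-\sum_{n\in\mathbb{Z}}\frac{q_w^n}{1-q_zq^n}$ for $|q|<|q_w|<1$ (meromorphically continued in $w,z$); $\widetilde G_0=-1$ and $\widetilde G_k(z,\tau)$, $k\ge1$, is defined by $\widetilde P_1(w,z,\tau)=\frac1{2\pi iw}-\sum_{k\ge1}\widetilde G_k(z,\tau)(2\pi iw)^{k-1}$ near $w=0$. *)

(* Defs.v *)
From HB Require Import structures.
From mathcomp Require Import all_boot all_order all_algebra.
From mathcomp Require Import all_classical all_reals all_analysis.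
From mathcomp Require Import complex.
Set Implicit Arguments.
Unset Strict Implicit.
Unset Printing Implicit Defensive.
Import Order.TTheory GRing.Theory Num.Theory.
Import numFieldNormedType.Exports.
Local Open Scope classical_set_scope.
Local Open Scope ring_scope.
Local Open Scope complex_scope.

Section ComplexFunctions.
Context {K : realType}.
Local Notation C := K[i].

Definition cexp (z : C) : C :=
  (expR (complex.Re z))%:C * (cos (complex.Im z) +i* sin (complex.Im z)).

Definition twopii : C := 2%:R * (pi : K)%:C * 'i%C.

(* e^{2 pi i a}; real powers of q, zeta, q_w are always taken in this sense,
   q^s = e2pii (tau * s), and so on. *)
Definition e2pii (a : C) : C := cexp (twopii * a).

(* The topology of C is carried by the alias C^o. *)
Definition csums_to (f : nat -> C) (l : C) : Prop :=
  series (f : nat -> C^o) @ \oo --> (l : C^o).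

Definition csum (f : nat -> C) : C := limn (series (f : nat -> C^o)).

Definition csummable (f : nat -> C) : Prop := cvgn (series (f : nat -> C^o)).

(* Bilateral series: both one-sided series are summed separately. *)
Definition zsum (f : int -> C) : C :=
  csum (fun n => f n%:Z) + csum (fun n => f (- n.+1%:Z)).

Definition zsummable (f : int -> C) : Prop :=
  csummable (fun n => f n%:Z) /\ csummable (fun n => f (- n.+1%:Z)).

Definition theta1 (w tau : C) : C :=
  'i%C * zsum (fun n : int => (-1) ^ n
    * e2pii (tau * (2%:R^-1 * (n%:~R + 2%:R^-1) ^+ 2))
    * e2pii (w * (n%:~R + 2%:R^-1))).

Definition eta (tau : C) : C :=
  e2pii (tau / 24%:R)
  * limn ((fun N => \prod_(1 <= n < N.+1) (1 - e2pii (tau * n%:R)))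
          : nat -> C^o).

(* The series for |q| < |q_w| < 1, that is for 0 < Im w < Im tau. *)
Definition P1tilde (w z tau : C) : C :=
  - zsum (fun n : int => e2pii (w * n%:~R) / (1 - e2pii z * e2pii (tau * n%:~R))).

(* The point w = 0 lies on the boundary of the strip 0 < Im w < Im tau on which
   the series P1tilde converges.  A Laurent series at 0 converging on the upper
   half of a small disc to P1tilde is the expansion at 0 of its meromorphic
   continuation; its coefficients are unique. *)
Definition is_Gtilde (z tau : C) (G : nat -> C) : Prop :=
  G 0%N = -1 /\
  exists r : K, 0 < r /\
    forall w : C, `|w| < r%:C -> 0 < complex.Im w ->
      csums_to (fun k => G k.+1 * (twopii * w) ^+ k)
               ((twopii * w)^-1 - P1tilde w z tau).

Definition Gtilde (z tau : C) : nat -> C := xget (fun=> 0) (is_Gtilde z tau).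

Definition KR (R : nat) (z tau : C) : C :=
  \sum_(m < R.+1) (m`!%:R)^-1 * Gtilde z tau (R - m) * Gtilde z tau 1 ^+ m.

End ComplexFunctions.

Section Operators.
Context {K : realType}.
Local Notation C := K[i].
Variable V : lmodType C.

Definition lspan n (b : 'I_n -> V) : set V :=
  [set v | exists c : 'I_n -> C, v = \sum_i c i *: b i].

Definition lfree n (b : 'I_n -> V) : Prop :=
  forall c : 'I_n -> C, \sum_i c i *: b i = 0 -> forall i, c i = 0.

Definition espace (A : V -> V) (a : C) : set V := [set v | A v = a *: v].

Definition eigdecomp (A : V -> V) (v : V) (d : C -> V) : Prop :=
  [/\ finite_set (d @^-1` [set~ 0]),
      forall a, espace A a (d a)
    & v = \sum_(a \in [set: C]) d a].

(* Components of v in the eigenspaces of a diagonalizable operator. *)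
Definition eigcomp (A : V -> V) (v : V) : C -> V :=
  xget (fun=> 0) (eigdecomp A v).

(* f(A) v for A diagonalizable. *)
Definition opfun (f : C -> C) (A : V -> V) (v : V) : V :=
  \sum_(a \in [set: C]) f a *: eigcomp A v a.

(* exp(A) v for A locally nilpotent. *)
Definition expnil (A : V -> V) (v : V) : V :=
  \sum_(k \in [set: nat]) (k`!%:R)^-1 *: iter k A v.

(* Trace of T on a finite-dimensional T-stable subspace W. *)
Definition ftrace (W : set V) (T : V -> V) : C :=
  xget 0 [set t | exists n (b : 'I_n -> V) (M : 'M[C]_n),
    [/\ lfree b, W = lspan b,
        forall j, T (b j) = \sum_i M i j *: b i
      & t = \tr M]].

End Operators.

Section Vosa.
Variable K : realType.
Local Notation C := K[i].

Definition binz (m : int) (j : nat) : C :=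
  (\prod_(i < j) (m%:~R - i%:R)) / (j`!)%:R.

(* u(n)v is written Y u n v, so that Y(u,z)v = \sum_n (Y u n v) z^(-n-1). *)
Record is_vosa (V : lmodType C) (Y : V -> int -> V -> V) (par : bool -> set V)
    (vac om : V) (c : C) : Prop := IsVosa {
  vosa_linl : forall n w (a : C) u v, Y (a *: u + v) n w = a *: Y u n w + Y v n w;
  vosa_linr : forall u n (a : C) v w, Y u n (a *: v + w) = a *: Y u n v + Y u n w;
  vosa_par_lin : forall p (a : C) u v, par p u -> par p v -> par p (a *: u + v);
  vosa_par_dec : forall v, exists v0 v1, [/\ par false v0, par true v1 & v = v0 + v1];
  vosa_par_cap : forall v, par false v -> par true v -> v = 0;
  vosa_par_mode : forall p p' u v n, par p u -> par p' v -> par (p (+) p') (Y u n v);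
  vosa_par_vac : par false vac;
  vosa_par_om : par false om;
  vosa_trunc : forall u v, exists N : int, forall n, N <= n -> Y u n v = 0;
  vosa_vac_neq0 : vac <> 0;
  vosa_vac : forall n v, Y vac n v = if n == -1 then v else 0;
  vosa_creation : forall u, Y u (-1) vac = u /\ forall n : int, 0 <= n -> Y u n vac = 0;
  (* Jacobi identity, in components *)
  vosa_borcherds : forall p p' u v (l m n : int) w, par p u -> par p' v ->
    \sum_(j \in [set: nat])
        binz m j *: Y (Y u (l + j%:Z) v) (m + n - j%:Z) w
    = \sum_(j \in [set: nat])
        ((-1) ^+ j * binz l j) *:
          (Y u (m + l - j%:Z) (Y v (n + j%:Z) w)
           - ((-1) ^ l * (-1) ^+ (p && p')) *:
               Y v (n + l - j%:Z) (Y u (m + j%:Z) w));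
  (* L(n) = om(n+1) *)
  vosa_virasoro : forall (m n : int) w,
    Y om (m + 1) (Y om (n + 1) w) - Y om (n + 1) (Y om (m + 1) w)
    = (m - n)%:~R *: Y om (m + n + 1) w
      + (if m + n == 0 then c / 12%:R * (m ^+ 3 - m)%:~R else 0) *: w;
  vosa_translation : forall u n w, Y (Y om 0 u) n w = (- n)%:~R *: Y u (n - 1) w;
  vosa_grading : forall v, exists d : C -> V,
    eigdecomp (Y om 1) v d /\
    forall a, d a != 0 -> exists k : int, a = k%:~R / 2%:R;
  vosa_findim : forall a, exists n (b : 'I_n -> V), espace (Y om 1) a `<=` lspan b;
  vosa_bounded : exists N : int, forall (k : int) v, k < N ->
    espace (Y om 1) (k%:~R / 2%:R) v -> v = 0
}.

Record vosa := Vosa {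
  vcar :> lmodType C;
  vmode : vcar -> int -> vcar -> vcar;
  vpar : bool -> set vcar;
  vac : vcar;
  omega : vcar;
  ccharge : C;
  vosaP : is_vosa vmode vpar vac omega ccharge
}.

End Vosa.

Arguments vmode {K V} u n v : rename.
Arguments vpar {K V} p : rename.
Arguments vac {K V} : rename.
Arguments omega {K V} : rename.
Arguments ccharge {K V} : rename.

Section SquareBrackets.
Context {K : realType} {V : vosa K}.
Local Notation C := K[i].

Definition L0 : V -> V := vmode omega 1.

(* Power series in x truncated after x^N: e^{hx}, (e^x - 1)/x, the inverse of
   the latter, and its p-th power. *)
Definition texp (N : nat) (h : C) : {poly C} := \poly_(i < N.+1) (h ^+ i / i`!%:R).
Definition tB (N : nat) : {poly C} := \poly_(i < N.+1) ((i.+1)`!%:R)^-1.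
Definition tBinv (N : nat) : {poly C} := \sum_(k < N.+1) (1 - tB N) ^+ k.
Definition tBpow (N : nat) (p : int) : {poly C} :=
  match p with Posz k => tB N ^+ k | Negz k => tBinv N ^+ k.+1 end.

(* Coefficient of x^(-n-1) in e^{hx} (e^x - 1)^(-m-1), i.e. the coefficient of
   x^(m-n) in e^{hx} ((e^x - 1)/x)^(-m-1). *)
Definition sqcoef (h : C) (m n : int) : C :=
  if n <= m then let N := `|m - n|%N in (texp N h * tBpow N (- m - 1))`_N else 0.

(* v[n]w, where Y[v,x] = Y(e^{x L(0)} v, e^x - 1) = \sum_n v[n] x^(-n-1). *)
Definition sqmode (v : V) (n : int) (w : V) : V :=
  \sum_(h \in [set: C]) \sum_(m \in [set m : int | n <= m])
     sqcoef h m n *: vmode (eigcomp L0 v h) m w.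

(* Trace over V = \bigoplus_k V_(k/2) of the operator \sum_n X n, where only
   finitely many X n contribute to the diagonal block of a given weight. *)
Definition gtrace_term (X : int -> V -> V) (k : int) : C :=
  ftrace (espace L0 (k%:~R / 2%:R))
         (fun w => \sum_(n \in [set: int]) eigcomp L0 (X n w) (k%:~R / 2%:R)).
Definition gtrace (X : int -> V -> V) : C := zsum (gtrace_term X).
Definition gtrace_cvg (X : int -> V -> V) : Prop := zsummable (gtrace_term X).

End SquareBrackets.

Section FreeFermions.
Context {K : realType} {V : vosa K}.
Local Notation C := K[i].
Variable R : nat.
(* psi true r = psi_r^+, psi false r = psi_r^- *)
Variable psi : bool -> 'I_R -> V.

Definition generates (S : set V) : Prop :=
  forall U : set V,
    U vac -> S `<=` U ->
    (forall (a : C) u v, U u -> U v -> U (a *: u + v)) ->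
    (forall u n v, U u -> U v -> U (vmode u n v)) ->
    forall v, U v.

Record free_fermions : Prop := FreeFermions {
  ff_gen : generates [set v | exists s r, v = psi s r];
  ff_odd : forall s r, vpar true (psi s r);
  ff_weight : forall s r, L0 (psi s r) = 2%:R^-1 *: psi s r;
  ff_pm : forall r s (m n : int) w,
    vmode (psi true r) m (vmode (psi false s) n w)
    + vmode (psi false s) n (vmode (psi true r) m w)
    = if (r == s) && (m == - n - 1) then w else 0;
  ff_same : forall e r s (m n : int) w,
    vmode (psi e r) m (vmode (psi e s) n w)
    + vmode (psi e s) n (vmode (psi e r) m w) = 0;
  ff_omega : omega = 2%:R^-1 *: \sum_r
    (vmode (psi true r) (-2) (psi false r) + vmode (psi false r) (-2) (psi true r));
  ff_ccharge : @ccharge K V = R%:R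
}.

Definition J : V := \sum_r vmode (psi true r) (-1) (psi false r).

Definition J0 : V -> V := vmode J 0.

Definition sigma : V -> V := opfun (fun a => cexp (pi%:C * 'i%C * a)) J0.

(* Delta(sigma,z) at z = e^x, with z^(1/2) = e^(x/2). *)
Definition Delta (x : C) (v : V) : V :=
  opfun (fun a => cexp (x * (2%:R^-1 * a))) J0
    (expnil (fun u => - 2%:R^-1 *: \sum_(n \in [set n : nat | (0 < n)%N])
                        (n%:R^-1 * (- cexp x) ^- n) *: vmode J n%:Z u) v).

(* n-th term of Y_sigma(e^{x L(0)} v, e^x), with z^(-n-1) = e^(-x(n+1)). *)
Definition Ysigma_term (v : V) (x : C) (n : int) (w : V) : V :=
  cexp (- (x * (n + 1)%:~R)) *:
    vmode (Delta x (opfun (fun h => cexp (x * h)) L0 v)) n w.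

(* zeta^(J(0)+R/2) q^(L(0)+J(0)/2+R/12) *)
Definition weightop (z tau : C) (w : V) : V :=
  opfun (fun a => e2pii (z * (a + R%:R / 2%:R))) J0
    (opfun (fun a => e2pii (tau * (a + R%:R / 12%:R)))
       (fun u => L0 u + 2%:R^-1 *: J0 u) w).

Definition ZJ_op (v : V) (z tau x : C) (n : int) (w : V) : V :=
  sigma (Ysigma_term v x n (weightop z tau w)).

Definition ZJ (v : V) (z tau x : C) : C := 'i%C ^+ R * gtrace (ZJ_op v z tau x).

Definition ZJ_cvg (v : V) (z tau x : C) : Prop := gtrace_cvg (ZJ_op v z tau x).

Definition bop (r : 'I_R) (k : nat) (v : V) : V :=
  if k == 0%N then v
  else sqmode (psi true r) (- k%:Z) (sqmode (psi false r) (-1) v).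

(* b_1^{f(1)} ... b_R^{f(R)} 1 *)
Definition bprod (f : 'I_R -> nat) : V :=
  foldr (fun r v => bop r (f r) v) vac (enum 'I_R).

(* The partition is given by the list of its (positive) parts. *)
Definition has_type (pi : seq nat) (f : {ffun 'I_R -> 'I_(sumn pi).+1}) : bool :=
  [forall k : 'I_(sumn pi).+1,
     #|[pred r | f r == k]|
     == if (k : nat) == 0%N then (R - size pi)%N else count_mem (k : nat) pi].

Definition beta (pi : seq nat) : V :=
  \sum_(f : {ffun 'I_R -> 'I_(sumn pi).+1} | has_type f) bprod (fun r => f r).

Definition Psi : V :=
  ((-1) ^+ R / (R`!)%:R) *:
    ((R%:R - 1) *: beta (nseq R 1%N)
     + \sum_(2 <= k < R.+1)
         ((-1) ^+ k.+1 * (k.-1)`!%:R) *: beta (k :: nseq (R - k) 1%N)).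

End FreeFermions.

(* Main.v *)
From mathcomp Require Import all_boot all_order all_algebra.
From mathcomp Require Import all_classical all_reals all_analysis.
From mathcomp Require Import complex.
From mathcomp Require Import ring lra zify.
Require Import Defs.
Set Implicit Arguments.
Unset Strict Implicit.
Unset Printing Implicit Defensive.
Import Order.TTheory GRing.Theory Num.Theory.
Import numFieldNormedType.Exports.
Local Open Scope classical_set_scope.
Local Open Scope ring_scope.
Local Open Scope complex_scope.

(** The space V is a fermionic Fock space: the monomials in the creation
operators psi_r^e(-j-1), j >= 0, applied to the vacuum form a basis, with L(0)
and J(0) diagonal ([span_mono], [L0_mono], [J0_mono]).  The trace is computed in
this basis.

Everything that happens to a Fock vector stays within products over r of
operators that are constant plus bilinear in psi_r^+(-i-1) psi_r^-(-1), so a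
vector of this kind is a family of polynomials ([phi]).  For n >= 1 the mode J(n)
shifts the coefficients of one polynomial down by n ([J_Bop]).  Hence J[1], which
is the series log(1 + D) in the shift D, lowers a label by one ([sqJ_bprod]), and
Delta(sigma, z), which is (1 + D/z)^(1/2), replaces the coefficients of
psi_r^+[-k] psi_r^-[-1] by those of [deltacoef] ([DeltaQ_bprod]).

In a Fock state S the diagonal matrix entry of such a product is a product of
sums over the occupied modes ([diag_phi]).  A label k >= 1 contributes
B_k + sum_(+, j) (j+1)^(k-1)/(k-1)! - sum_(-, j) (-j)^(k-1)/(k-1)!, where (+, j)
and (-, j) run over the occupied modes and B_k are the coefficients of
u e^u / (e^u - 1) ([labelevE]).  The weight zeta^J(0) q^(L(0) + J(0)/2) with its
sign is a product over the occupied modes as well, so the sum over the states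
built from modes j < N is a product over r, and for each r it is
  prod_(j < N) (1 - zeta q^(j+1)) (1 - zeta^-1 q^j)
    (B_k - sum_j (j+1)^(k-1)/(k-1)! p_(j+1) + sum_j (-j)^(k-1)/(k-1)! n_j),
with Lambert coefficients p_n = zeta q^n / (1 - zeta q^n) and
n_j = zeta^-1 q^j / (1 - zeta^-1 q^j) ([onesumE]).  By the Jacobi triple product
the first factor tends to theta_1/eta up to the constant that is supplied by i^R and
the shifts R/2 and R/12 ([theta_eta_cvg]); the second tends to - G_k
([onesum_cvg]), as the expansion of the Lambert series of P_1 at w = 0 shows
([GtildeE]).  The states left out by a truncation at weight K have total weight
O(rho^-K) with rho > 1 ([label_tail]), so b_1^f(1) .. b_R^f(R) 1 has the one-point
function (theta_1/eta)^R prod_r (- G_f(r)) ([ZJ_value]).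

For Psi this is a sum over the hooks, that is the labels with one value k and
R - k values 1.  There are R binom(R-1, R-k) = R! / ((R-k)! (k-1)!) of them, which
gives K_R; the two terms of K_R with m >= R - 1 come together from beta_(1^R)
([Psi_value]).  Finally J[1] sends the k-th hook sum to gamma_(k-1) + k gamma_k,
where gamma_k is the sum of the hooks with one unit label missing, and with the
coefficients of Psi these terms telescope ([J1_Psi]). *)

(** * Complex sequences and series *)

Section ComplexSequences.
Context {K : realType}.
Local Notation C := K[i].
Implicit Types (z w l : C) (f g : nat -> C) (a b : nat -> C) (M : nat -> K).

(** The norm of K[i] takes values in K[i]; estimates are made in K. *)
Definition cn z : K := Normc.normc z.

Lemma normcE' z : `|z| = (cn z)%:C. Proof. by []. Qed.

Lemma cn0 : cn 0 = 0. Proof. exact: Normc.normc0. Qed.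
Lemma cn1 : cn 1 = 1. Proof. exact: Normc.normc1. Qed.
Lemma cnM z w : cn (z * w) = cn z * cn w. Proof. exact: Normc.normcM. Qed.
Lemma cnV z : cn z^-1 = (cn z)^-1. Proof. exact: Normc.normcV. Qed.
Lemma cnN z : cn (- z) = cn z. Proof. exact: normcN. Qed.
Lemma cnD z w : cn (z + w) <= cn z + cn w. Proof. exact: le_normcD. Qed.
Lemma cnB z w : cn (z - w) <= cn z + cn w.
Proof. by rewrite -(cnN w); exact: cnD. Qed.
Lemma cn_ge0 z : 0 <= cn z.
Proof. by rewrite -lecR -normcE' normr_ge0. Qed.
Lemma cn_eq0 z : (cn z == 0) = (z == 0).
Proof. by rewrite -(inj_eq (@complexI K)) -normcE' normr_eq0. Qed.
Lemma cn_gt0 z : (0 < cn z) = (z != 0).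
Proof. by rewrite lt0r cn_eq0 cn_ge0 andbT. Qed.
Lemma cnX z n : cn (z ^+ n) = cn z ^+ n.
Proof. by elim: n => [|n IH]; rewrite ?expr0 ?cn1 // !exprS cnM IH. Qed.
Lemma cn_real (x : K) : cn x%:C = `|x|.
Proof. by rewrite /cn /= expr0n /= addr0 sqrtr_sqr. Qed.
Lemma cn_nat n : cn n%:R = n%:R.
Proof. by rewrite -(rmorph_nat (real_complex K)) cn_real normr_nat. Qed.
Lemma cn_sum (I : Type) (r : seq I) (P : pred I) (F : I -> C) :
  cn (\sum_(i <- r | P i) F i) <= \sum_(i <- r | P i) cn (F i).
Proof.
elim/big_ind2 : _ => [|x x' y y' h h'|//]; first by rewrite cn0.
by apply: le_trans (cnD _ _) _; exact: lerD.
Qed.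
Lemma cn_prod (I : Type) (r : seq I) (P : pred I) (F : I -> C) :
  cn (\prod_(i <- r | P i) F i) = \prod_(i <- r | P i) cn (F i).
Proof. by elim/big_ind2 : _ => [|x x' y y' <- <-|//]; rewrite ?cn1 ?cnM. Qed.
Lemma cn_Re z : `|complex.Re z| <= cn z.
Proof.
case: z => x y; rewrite /cn /= -[leLHS]sqrtr_sqr; apply: ler_wsqrtr.
by rewrite lerDl sqr_ge0.
Qed.
Lemma cn_Im z : `|complex.Im z| <= cn z.
Proof.
case: z => x y; rewrite /cn /= -[leLHS]sqrtr_sqr; apply: ler_wsqrtr.
by rewrite lerDr sqr_ge0.
Qed.
Lemma Re_sum (I : Type) (r : seq I) (P : pred I) (F : I -> C) :
  complex.Re (\sum_(i <- r | P i) F i) = \sum_(i <- r | P i) complex.Re (F i).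
Proof. by apply: (big_morph (@complex.Re K)) => // -[a b] [c d]. Qed.
Lemma Im_sum (I : Type) (r : seq I) (P : pred I) (F : I -> C) :
  complex.Im (\sum_(i <- r | P i) F i) = \sum_(i <- r | P i) complex.Im (F i).
Proof. by apply: (big_morph (@complex.Im K)) => // -[a b] [c d]. Qed.
Lemma cn_i : cn 'i%C = 1 :> K.
Proof. by rewrite /cn /= expr0n /= add0r expr1n sqrtr1. Qed.
Lemma cn_le_ReIm z : cn z <= `|complex.Re z| + `|complex.Im z|.
Proof.
case: z => x y; rewrite [complex.Re _]/= [complex.Im _]/=.
have -> : x +i* y = x%:C + y%:C * 'i%C by apply/eqP; rewrite eq_complex /=; apply/andP; split; apply/eqP; ring.
by apply: le_trans (cnD _ _) _; rewrite cnM !cn_real cn_i mulr1.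
Qed.

(** Convergence in real epsilon-N form; [cvgtoE] relates it to the filter form on C^o. *)
Definition cvgto f l :=
  forall e : K, 0 < e -> exists N, forall n, (N <= n)%N -> cn (f n - l) < e.

Lemma cvgtoP f l : cvgto f l <->
  (forall e : K, 0 < e -> exists N, forall n, (N <= n)%N -> cn (f n - l) < e).
Proof. by []. Qed.

Lemma cvgtoE f l : cvgto f l <-> (f : nat -> C^o) @ \oo --> (l : C^o).
Proof.
split; last first.
  move=> /cvgrPdist_lt H e e0; have := H e%:C; rewrite ltcR => /(_ e0) [N _ hN].
  by exists N => n hn; rewrite -ltcR -normcE' distrC; exact: hN.
move=> H; apply/cvgrPdist_lt => e; case: e => x y.
rewrite ltcE /= => /andP[/eqP -> x0].
have [N hN] := H _ x0; exists N => // n hn.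
by rewrite distrC normcE' ltcR; exact: hN.
Qed.

Lemma cvgto_cn f l : cvgto f l <-> (fun n => cn (f n - l)) @ \oo --> (0 : K).
Proof.
rewrite cvgtoP; split.
  move=> H; apply/cvgrPdist_lt => e e0; have [N hN] := H _ e0.
  by exists N => // n hn; rewrite sub0r normrN ger0_norm ?cn_ge0 //; exact: hN.
move=> /cvgrPdist_lt H e e0; have [N _ hN] := H _ e0; exists N => n hn.
by have := hN _ hn; rewrite sub0r normrN ger0_norm ?cn_ge0.
Qed.

Lemma cvgto_squeeze f l (u : nat -> K) :
  (forall n, cn (f n - l) <= u n) -> u @ \oo --> (0 : K) -> cvgto f l.
Proof.
move=> H u0; apply/cvgto_cn; apply: (squeeze_cvgr _ (cvg_cst 0) u0).
by near=> n; rewrite cn_ge0 H.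
Unshelve. all: by end_near.
Qed.

Lemma cvgto_lim f l : cvgto f l -> limn (f : nat -> C^o) = l.
Proof. by move=> /cvgtoE h; apply: cvg_lim h; exact: norm_hausdorff. Qed.

Lemma cvgto_uniq f l l' : cvgto f l -> cvgto f l' -> l = l'.
Proof. by move=> /cvgto_lim <- /cvgto_lim <-. Qed.

Lemma cvgto_cst l : cvgto (fun=> l) l.
Proof. by move=> e e0; exists 0%N => n _; rewrite subrr cn0. Qed.
Lemma cvgtoD f g l l' : cvgto f l -> cvgto g l' -> cvgto (fun n => f n + g n) (l + l').
Proof. by move=> /cvgtoE h /cvgtoE h'; apply/cvgtoE; exact: (cvgD h h'). Qed.
Lemma cvgtoM f g l l' : cvgto f l -> cvgto g l' -> cvgto (fun n => f n * g n) (l * l').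
Proof. by move=> /cvgtoE h /cvgtoE h'; apply/cvgtoE; exact: (cvgM h h'). Qed.
Lemma cvgtoZ f l c : cvgto f l -> cvgto (fun n => c * f n) (c * l).
Proof. by move=> h; exact: cvgtoM (cvgto_cst c) h. Qed.
Lemma cvgtoN f l : cvgto f l -> cvgto (fun n => - f n) (- l).
Proof. by move=> /cvgtoE h; apply/cvgtoE; exact: (cvgN h). Qed.
Lemma cvgtoB f g l l' : cvgto f l -> cvgto g l' -> cvgto (fun n => f n - g n) (l - l').
Proof. by move=> h h'; exact: cvgtoD h (cvgtoN h'). Qed.
Lemma cvgtoV f l : l != 0 -> cvgto f l -> cvgto (fun n => (f n)^-1) l^-1.
Proof. by move=> l0 /cvgtoE h; apply/cvgtoE; exact: (cvgV l0 h). Qed.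
Lemma cvgto_sum (I : Type) (r : seq I) (P : pred I) (F : I -> nat -> C) (L : I -> C) :
  (forall i, P i -> cvgto (F i) (L i)) ->
  cvgto (fun n => \sum_(i <- r | P i) F i n) (\sum_(i <- r | P i) L i).
Proof.
move=> h; elim: r => [|i r IH].
  by rewrite big_nil; under [X in cvgto X]eq_fun do rewrite big_nil; exact: cvgto_cst.
rewrite big_cons; under [X in cvgto X]eq_fun do rewrite big_cons.
case: ifP => Pi; [exact: cvgtoD (h _ Pi) IH | exact: IH].
Qed.
Lemma cvgto_prod (I : Type) (r : seq I) (P : pred I) (F : I -> nat -> C) (L : I -> C) :
  (forall i, P i -> cvgto (F i) (L i)) ->
  cvgto (fun n => \prod_(i <- r | P i) F i n) (\prod_(i <- r | P i) L i).
Proof.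
move=> h; elim: r => [|i r IH].
  by rewrite big_nil; under [X in cvgto X]eq_fun do rewrite big_nil; exact: cvgto_cst.
rewrite big_cons; under [X in cvgto X]eq_fun do rewrite big_cons.
case: ifP => Pi; [exact: cvgtoM (h _ Pi) IH | exact: IH].
Qed.
Lemma eq_cvgto f g l : f =1 g -> cvgto f l -> cvgto g l.
Proof. by move=> /funext ->. Qed.

Lemma cvgto_sub f l (h : nat -> nat) : (forall n, (n <= h n)%N) ->
  cvgto f l -> cvgto (fun n => f (h n)) l.
Proof.
move=> hn /cvgtoP H; apply/cvgtoP => e e0; have [N HN] := H _ e0.
by exists N => n Nn; apply: HN; apply: leq_trans (hn n).
Qed.

Lemma cvgto_eventually f g l m :
  (forall n, (m <= n)%N -> f n = g n) -> cvgto f l -> cvgto g l.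
Proof.
move=> fg /cvgtoP H; apply/cvgtoP => e e0; have [N HN] := H _ e0.
exists (maxn m N) => n; rewrite geq_max => /andP[mn Nn].
by rewrite -fg //; exact: HN.
Qed.

Lemma cvgto_bounded f l : cvgto f l -> exists2 B : K, 0 < B & forall n, cn (f n) <= B.
Proof.
move=> /cvgtoP /(_ 1 ltr01) [N hN].
exists (cn l + 1 + \sum_(i < N) cn (f i)).
  by rewrite ltr_wpDr ?sumr_ge0 // => [i _|]; rewrite ?cn_ge0 // ltr_wpDl ?cn_ge0.
move=> n; have [nN|Nn] := ltnP n N.
  rewrite (bigD1 (Ordinal nN)) //= addrCA ler_wpDr // addr_ge0 ?addr_ge0 ?cn_ge0 //.
  by apply: sumr_ge0 => i _; exact: cn_ge0.
apply: ler_wpDr; first by apply: sumr_ge0 => i _; exact: cn_ge0.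
have -> : f n = (f n - l) + l by rewrite subrK.
by apply: le_trans (cnD _ _) _; rewrite addrC lerD // ltW //; exact: hN.
Qed.

Lemma cvgto_ReIm f (x y : K) :
  (fun n => complex.Re (f n)) @ \oo --> x -> (fun n => complex.Im (f n)) @ \oo --> y ->
  cvgto f (x +i* y).
Proof.
move=> /cvgrPdist_lt hx /cvgrPdist_lt hy; apply/cvgtoP => e e0.
have e2 : 0 < e / 2%:R by lra.
have [N1 _ h1] := hx _ e2; have [N2 _ h2] := hy _ e2.
exists (maxn N1 N2) => n; rewrite geq_max => /andP[n1 n2].
apply: le_lt_trans (cn_le_ReIm _) _.
have /= := h1 _ n1; have /= := h2 _ n2; rewrite ![`|_ - complex.Im _|]distrC ![`|_ - complex.Re _|]distrC.
case: (f n) => u v /=; lra.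
Qed.

(** Absolute summability, expressed by bounded partial sums so that comparison is immediate. *)
Definition absum a := exists M : K, forall n, \sum_(i < n) cn (a i) <= M.

Lemma bounded_sums_cvg M :
  (forall n, 0 <= M n) -> (exists B, forall n, \sum_(i < n) M i <= B) ->
  cvgn (series M).
Proof.
move=> M0 [B hB]; apply: nondecreasing_is_cvgn.
  apply/nondecreasing_seqP => n.
  by rewrite /series /= big_nat_recr //= lerDl.
by exists B => _ [n _ <-]; rewrite /series /= big_mkord.
Qed.

(** The tails are Cauchy differences of a bounded monotone series. *)
Lemma bounded_sums_tail M :
  (forall n, 0 <= M n) -> (exists B, forall n, \sum_(i < n) M i <= B) ->
  forall e : K, 0 < e -> exists N, forall n m, (N <= n)%N -> \sum_(n <= i < m) M i < e.
Proof.
move=> M0 hB e e0.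
have /cvg_cauchy /cauchy_seriesP /(_ _ e0) := bounded_sums_cvg M0 hB.
case=> -[A B] [[N1 _ h1] [N2 _ h2]] H.
exists (maxn N1 N2) => n m; rewrite geq_max => /andP[n1 n2].
have [nm|/ltnW mn] := leqP n m; last by rewrite big_geq.
apply: le_lt_trans (ler_norm _) _.
apply: (H (n, m)); split => /=; first exact: h1.
by apply: h2 => /=; exact: leq_trans nm.
Qed.

Lemma seriesE a n : series (a : nat -> C^o) n = \sum_(i < n) a i.
Proof. by rewrite /series /= big_mkord. Qed.

Lemma csums_toE a l : csums_to a l <-> cvgto (fun n => \sum_(i < n) a i) l.
Proof.
rewrite cvgtoE /csums_to; set F := series _.
by have -> : F = (fun n => \sum_(i < n) a i) by apply/funext => n; exact: seriesE.
Qed.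

Lemma csums_to_csum a l : csums_to a l -> csum a = l.
Proof.
move=> /csums_toE /cvgto_lim; rewrite /csum => <-; set F := series _.
by have -> : F = (fun n => \sum_(i < n) a i) by apply/funext => n; exact: seriesE.
Qed.

Lemma csums_to_summable a l : csums_to a l -> csummable a.
Proof. by move=> h; apply/cvg_ex; exists l. Qed.

Lemma real_absum (x : nat -> K) :
  (exists B, forall n, \sum_(i < n) `|x i| <= B) -> cvgn (series x).
Proof.
move=> hB; apply: normed_cvg.
exact: (bounded_sums_cvg (fun n => normr_ge0 (x n)) hB).
Qed.

(** The real and imaginary parts are dominated by the absolute values. *)
Lemma absum_csums a : absum a -> csums_to a (csum a).
Proof.
move=> [B hB].
have h1 : cvgn (series (fun n => complex.Re (a n))).
  apply: real_absum; exists B => n; apply: le_trans (hB n).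
  by apply: ler_sum => i _; exact: cn_Re.
have h2 : cvgn (series (fun n => complex.Im (a n))).
  apply: real_absum; exists B => n; apply: le_trans (hB n).
  by apply: ler_sum => i _; exact: cn_Im.
have key : csums_to a (limn (series (fun n => complex.Re (a n)))
                       +i* limn (series (fun n => complex.Im (a n)))).
  apply/csums_toE; apply: cvgto_ReIm.
    under eq_fun => n do rewrite -(big_mkord predT a) Re_sum.
    exact: h1.
  under eq_fun => n do rewrite -(big_mkord predT a) Im_sum.
  exact: h2.
by rewrite (csums_to_csum key).
Qed.

Lemma absum_le a M : (forall n, cn (a n) <= M n) ->
  (exists B, forall n, \sum_(i < n) M i <= B) -> absum a.
Proof.
move=> aM [B hB]; exists B => n; apply: le_trans (hB n).
by apply: ler_sum.
Qed.

(** The bound passes to the limit of the finite partial tails. *)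
Lemma csum_tail_le a M N (e : K) : (forall n, cn (a n) <= M n) ->
  (exists B, forall n, \sum_(i < n) M i <= B) ->
  (forall m, \sum_(N <= i < m) M i <= e) ->
  cn (csum a - \sum_(i < N) a i) <= e.
Proof.
move=> aM hB he.
have /absum_csums /csums_toE /cvgtoP H := absum_le aM hB.
rewrite leNgt; apply/negP => lt.
have d0 : 0 < cn (csum a - \sum_(i < N) a i) - e by rewrite subr_gt0.
have [n0 hn0] := H _ d0.
have := hn0 (maxn n0 N) (leq_maxl _ _); set n := maxn _ _.
rewrite -(big_mkord predT a) (@big_cat_nat _ _ _ N) ?leq_maxr //= big_mkord.
set A := \sum_(i < N) a i; set B := \sum_(N <= i < n) _.
have hBe : cn B <= e.
  apply: le_trans (cn_sum _ _ _) _; apply: le_trans (he n); exact: ler_sum.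
have : cn (csum a - A) <= cn (A + B - csum a) + cn B.
  have -> : csum a - A = - (A + B - csum a) + B by ring.
  by apply: le_trans (cnD _ _) _; rewrite cnN.
lra.
Qed.

(** Dominated convergence for series: beyond a large index both sums are small uniformly in k,
and finitely many terms converge termwise. *)
Lemma tannery (F : nat -> nat -> C) g M :
  (forall n, 0 <= M n) -> (exists B, forall n, \sum_(i < n) M i <= B) ->
  (forall k n, cn (F k n) <= M n) -> (forall n, cvgto (fun k => F k n) (g n)) ->
  (forall n, cn (g n) <= M n) /\ cvgto (fun k => csum (F k)) (csum g).
Proof.
move=> M0 hB FM Fg.
have gM n : cn (g n) <= M n.
  rewrite leNgt; apply/negP => lt.
  have d0 : 0 < cn (g n) - M n by rewrite subr_gt0.
  have /cvgtoP /(_ _ d0) [k0 /(_ k0 (leqnn _))] := Fg n.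
  have : cn (g n) <= cn (F k0 n - g n) + cn (F k0 n).
    have {1}-> : g n = - (F k0 n - g n) + F k0 n by ring.
    by apply: le_trans (cnD _ _) _; rewrite cnN.
  have := FM k0 n; lra.
split=> //; apply/cvgtoP => e e0.
have e3 : 0 < e / 3%:R by lra.
have [N hN] := bounded_sums_tail M0 hB e3.
have /cvgtoP /(_ _ e3) [k0 hk0] : cvgto (fun k => \sum_(i < N) F k i) (\sum_(i < N) g i).
  by apply: cvgto_sum => i _; exact: Fg.
exists k0 => k /hk0.
have t1 := csum_tail_le (FM k) hB (fun m => ltW (hN N m (leqnn N))).
have t2 := csum_tail_le gM hB (fun m => ltW (hN N m (leqnn N))).
set A := \sum_(i < N) F k i in t1 *; set B := \sum_(i < N) g i in t2 * => lt.
have -> : csum (F k) - csum g = (csum (F k) - A) + (A - B) - (csum g - B) by ring.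
apply: le_lt_trans (cnB _ _) _.
have := cnD (csum (F k) - A) (A - B); lra.
Qed.

Lemma csum_fin a N : (forall n, (N <= n)%N -> a n = 0) -> csum a = \sum_(i < N) a i.
Proof.
move=> a0; apply: csums_to_csum; apply/csums_toE.
apply: (@cvgto_eventually (fun=> \sum_(i < N) a i) _ _ N) => [n Nn|]; last exact: cvgto_cst.
rewrite -[RHS](big_mkord predT a) (@big_cat_nat _ _ _ N 0%N n) //= big_mkord.
by rewrite (_ : \sum_(N <= i < n) a i = 0) ?addr0 // big_nat big1 // => i /andP[h _]; exact: a0.
Qed.

(** A finite sum of growing length is a series that vanishes beyond its length. *)
Lemma tannery_fin (F : nat -> nat -> C) g M (h : nat -> nat) :
  (forall n, (n <= h n)%N) ->
  (forall n, 0 <= M n) -> (exists B, forall n, \sum_(i < n) M i <= B) ->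
  (forall k n, (n < h k)%N -> cn (F k n) <= M n) ->
  (forall n, cvgto (fun k => F k n) (g n)) ->
  (forall n, cn (g n) <= M n) /\ cvgto (fun k => \sum_(n < h k) F k n) (csum g).
Proof.
move=> hk M0 hB FM Fg.
pose F' k n := if (n < h k)%N then F k n else 0.
have [] := @tannery F' g M M0 hB.
- by move=> k n; rewrite /F'; case: ifP => [/FM //|_]; rewrite cn0.
- move=> n; apply: (@cvgto_eventually (F ^~ n) _ _ n.+1) (Fg n) => k nk.
  by rewrite /F' (leq_trans nk (hk k)).
move=> gM H; split=> //; apply: eq_cvgto H => k.
rewrite (@csum_fin _ (h k)) => [|n]; last by rewrite /F' ltnNge => ->.
by apply: eq_bigr => i _; rewrite /F' ltn_ord.
Qed.

Definition cauchy_prod a b n := \sum_(i < n.+1) a i * b (n - i)%N.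

Lemma sum_cauchy_prod (A : comNzRingType) (a b : nat -> A) n :
  \sum_(k < n) \sum_(i < k.+1) a i * b (k - i)%N
  = \sum_(i < n) a i * \sum_(j < n - i) b j.
Proof.
elim: n => [|n IH]; first by rewrite !big_ord0.
rewrite big_ord_recr IH /= !big_ord_recr /= subnn subSnn big_ord1 addrA -big_split /=.
congr (_ + _); apply: eq_bigr => i _.
by rewrite subSn ?(ltnW (ltn_ord i)) // big_ord_recr /= mulrDr.
Qed.

(** The difference between the triangular and the square partial sums is dominated by a tail of
one factor times the sum of the other (Mertens). *)
Lemma csums_cauchy_prod a b : absum a -> absum b ->
  csums_to (cauchy_prod a b) (csum a * csum b).
Proof.
move=> [A hA] hb; have [B hB] := hb.
have B0 : 0 <= B by apply: le_trans (hB 0%N); rewrite big_ord0.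
pose F k i := a i * \sum_(j < k - i) b j.
have [|||||_ H] := @tannery_fin F (fun n => a n * csum b) (fun n => cn (a n) * B) id.
- by [].
- by move=> n; rewrite mulr_ge0 ?cn_ge0.
- by exists (A * B) => n; rewrite -mulr_suml ler_wpM2r.
- move=> k n _; rewrite /F cnM ler_wpM2l ?cn_ge0 //.
  by apply: le_trans (cn_sum _ _ _) (hB _).
- move=> n; apply: cvgtoZ.
  have /csums_toE /cvgtoP H := absum_csums hb.
  apply/cvgtoP => e e0; have [N hN] := H _ e0; exists (N + n)%N => k hk.
  by apply: hN; lia.
apply/csums_toE.
have -> : csum a * csum b = csum (fun n => a n * csum b).
  apply/esym/csums_to_csum/csums_toE.
  have /absum_csums /csums_toE h : absum a by exists A.
  apply: eq_cvgto (cvgtoM h (cvgto_cst (csum b))) => n /=.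
  by rewrite mulr_suml.
apply: eq_cvgto H => n /=.
by rewrite /cauchy_prod sum_cauchy_prod.
Qed.

Lemma absum_cvg0 a : absum a -> cvgto a 0.
Proof.
move=> h; apply/cvgtoP => e e0.
have [|N hN] := bounded_sums_tail (fun n => cn_ge0 (a n)) _ e0; first exact: h.
by exists N => n Nn; have := hN n n.+1 Nn; rewrite big_nat1 subr0.
Qed.

Lemma geometric_bound (r : K) : 0 <= r < 1 -> forall n, \sum_(i < n) r ^+ i <= (1 - r)^-1.
Proof.
move=> /andP[r0 r1] n.
have d : 0 < 1 - r by lra.
rewrite -(ler_pM2l d) mulfV ?gt_eqF // mulrC.
have -> : (\sum_(i < n) r ^+ i) * (1 - r) = 1 - r ^+ n.
  rewrite -[RHS]opprB subrX1; ring.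
by have := exprn_ge0 n r0; lra.
Qed.

Lemma absum_geometric a (c r : K) : 0 <= r < 1 -> (forall n, cn (a n) <= c * r ^+ n) -> absum a.
Proof.
move=> r01 h; apply: (absum_le h).
exists (c * (1 - r)^-1) => n; rewrite -mulr_sumr.
have [c0|c0] := leP 0 c; first by rewrite ler_wpM2l // geometric_bound.
have := h 0%N; rewrite expr0 mulr1 => h0; have := cn_ge0 (a 0%N); lra.
Qed.

Lemma csumsD a b l l' : csums_to a l -> csums_to b l' -> csums_to (fun n => a n + b n) (l + l').
Proof.
move=> /csums_toE h /csums_toE h'; apply/csums_toE.
by apply: eq_cvgto (cvgtoD h h') => n; rewrite big_split.
Qed.
Lemma csumsZ c a l : csums_to a l -> csums_to (fun n => c * a n) (c * l).
Proof.
move=> /csums_toE h; apply/csums_toE.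
by apply: eq_cvgto (cvgtoZ c h) => n; rewrite mulr_sumr.
Qed.
Lemma csums_recl a l : csums_to (fun n => a n.+1) l -> csums_to a (a 0%N + l).
Proof.
move=> /csums_toE h; apply/csums_toE.
have /cvgtoP h' := cvgtoD (cvgto_cst (a 0%N)) h.
apply/cvgtoP => e e0; have [N hN] := h' _ e0; exists N.+1 => -[//|n] hn.
by rewrite big_ord_recl /=; exact: hN.
Qed.
Lemma csums_uniq a l l' : csums_to a l -> csums_to a l' -> l = l'.
Proof. by move=> /csums_toE h /csums_toE h'; exact: cvgto_uniq h h'. Qed.
Lemma eq_csums a b l : a =1 b -> csums_to a l -> csums_to b l.
Proof. by move=> /funext ->. Qed.

End ComplexSequences.

Arguments csums_uniq {K} [a l l'] _ _.
Arguments csumsD {K} [a b l l'] _ _.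
Arguments csumsZ {K} c [a l] _.
Arguments csums_recl {K} [a l] _.
Arguments eq_csums {K} [a b l] _ _.
Arguments csums_toE {K a l}.
Arguments absum_csums {K} [a] _.

(** * The complex exponential *)

Section ComplexExponential.
Context {K : realType}.
Local Notation C := K[i].
Implicit Types (z w tau : C).

Lemma cexpE (x y : K) : cexp (x +i* y) = (expR x * cos y) +i* (expR x * sin y).
Proof. by rewrite /cexp /=; apply/eqP; rewrite eq_complex /=; apply/andP; split; apply/eqP; ring. Qed.

Lemma cexpD z w : cexp (z + w) = cexp z * cexp w.
Proof.
case: z w => [a b] [c d].
rewrite -[LHS]/(cexp ((a + c) +i* (b + d))) !cexpE.
apply/eqP; rewrite eq_complex; rewrite [complex.Re _]/= [complex.Im _]/= [complex.Re (_ * _)]/= [complex.Im (_ * _)]/=.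
by rewrite expRD cosD sinD; apply/andP; split; apply/eqP; ring.
Qed.

Lemma cexp0 : cexp (0 : C) = 1.
Proof. by rewrite -[0]/(0 +i* 0) cexpE expR0 cos0 sin0 mulr0 mulr1. Qed.

Lemma cexp_neq0 z : cexp z != 0.
Proof.
apply/eqP => h; have := cexpD z (- z); rewrite subrr cexp0 h mul0r => /eqP.
by rewrite oner_eq0.
Qed.

Lemma cexpN z : cexp (- z) = (cexp z)^-1.
Proof.
apply: (mulfI (cexp_neq0 z)).
by rewrite -cexpD subrr cexp0 divff ?cexp_neq0.
Qed.

Lemma cexpMn z n : cexp (z * n%:R) = cexp z ^+ n.
Proof.
elim: n => [|n IH]; first by rewrite mulr0 cexp0 expr0.
by rewrite -natr1 mulrDr mulr1 cexpD IH exprSr.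
Qed.

Lemma cn_cexp z : cn (cexp z) = expR (complex.Re z).
Proof.
case: z => x y; rewrite cexpE /cn /=.
rewrite !exprMn -mulrDr cos2Dsin2 mulr1 sqrtr_sqr ger0_norm ?expR_ge0 //.
Qed.

Definition expterm z k : C := z ^+ k / k`!%:R.

Lemma real_exp_bound (x : K) n : 0 <= x -> \sum_(i < n) x ^+ i / i`!%:R <= expR x.
Proof.
move=> x0; rewrite -(big_mkord predT (fun i => x ^+ i / i`!%:R)).
apply: (@nondecreasing_cvgn_le _ (series (exp_coeff x))); last exact: is_cvg_series_exp_coeff.
  apply/nondecreasing_seqP => m.
  by rewrite /series /= big_nat_recr //= lerDl mulr_ge0 ?exprn_ge0 ?invr_ge0 ?ler0n.
Qed.

Lemma cn_expterm z k : cn (expterm z k) = cn z ^+ k / k`!%:R.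
Proof. by rewrite cnM cnX cnV cn_nat. Qed.

Lemma expterm_bound z n : \sum_(i < n) cn (expterm z i) <= expR (cn z).
Proof.
under eq_bigr do rewrite cn_expterm.
exact: real_exp_bound (cn_ge0 z).
Qed.

Lemma absum_exp z : absum (expterm z).
Proof. by exists (expR (cn z)); exact: expterm_bound. Qed.

Lemma exptermD z w k : expterm (z + w) k = cauchy_prod (expterm z) (expterm w) k.
Proof.
rewrite /expterm /cauchy_prod addrC exprDn big_distrl /=; apply: eq_bigr => i _.
have ik : (i <= k)%N by rewrite -ltnS.
have h := bin_fact ik.
have f0 m : m`!%:R != 0 :> C by rewrite pnatr_eq0 -lt0n fact_gt0.
have -> : k`!%:R = ('C(k, i) * (i`! * (k - i)`!))%:R :> C by rewrite h.
rewrite !natrM -mulr_natr.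
have c0 : 'C(k, i)%:R != 0 :> C by rewrite pnatr_eq0 -lt0n bin_gt0.
by field; rewrite c0 !f0.
Qed.

Lemma csum_expD z w : csum (expterm (z + w)) = csum (expterm z) * csum (expterm w).
Proof.
have h := csums_cauchy_prod (absum_exp z) (absum_exp w).
apply: csums_to_csum; apply: eq_csums h => k; exact/esym/exptermD.
Qed.

Lemma csum_exp_real (x : K) : csum (expterm x%:C) = (expR x)%:C.
Proof.
apply: csums_to_csum; apply/csums_toE.
have -> : (expR x)%:C = (expR x) +i* 0 by [].
have E k : expterm x%:C k = (exp_coeff x k)%:C.
  by rewrite /expterm /exp_coeff /= rmorphM rmorphXn fmorphV /= rmorph_nat.
apply: cvgto_ReIm.
  under eq_fun => n do (rewrite -(big_mkord predT (expterm _)) Re_sum; under eq_bigr => i _ do rewrite E /=).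
  exact: is_cvg_series_exp_coeff.
under eq_fun => n do (rewrite Im_sum big1 => [|i _]; [|by rewrite E]).
exact: cvg_cst.
Qed.

Lemma expterm_imag (y : K) k :
  expterm (y%:C * 'i%C) k = (cos_coeff y k) +i* (sin_coeff y k).
Proof.
rewrite /expterm exprMn.
have i2 m : 'i%C ^+ m.*2 = ((-1) ^+ m)%:C :> C.
  by rewrite -mul2n exprM sqr_i rmorphXn rmorphN rmorph1.
have -> : k`!%:R^-1 = (k`!%:R^-1 : K)%:C :> C by rewrite fmorphV /= rmorph_nat.
have -> : cos_coeff y k = (~~ odd k)%:R * (-1) ^+ k./2 * y ^+ k / k`!%:R by [].
have -> : sin_coeff y k = (odd k)%:R * (-1) ^+ k.-1./2 * y ^+ k / k`!%:R by [].
rewrite -rmorphXn; have := odd_double_half k.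
case: (odd k) => /= <-; rewrite ?add1n ?add0n ?[(k./2).*2.+1./2]uphalf_double ?doubleK /=.
  rewrite ?doubleK ?uphalf_double ['i%C ^+ _]exprS i2; apply/eqP; rewrite eq_complex /=.
  by apply/andP; split; apply/eqP; ring.
rewrite i2; apply/eqP; rewrite eq_complex /=.
by apply/andP; split; apply/eqP; ring.
Qed.

Lemma csum_exp_imag (y : K) : csum (expterm (y%:C * 'i%C)) = cos y +i* sin y.
Proof.
apply: csums_to_csum; apply/csums_toE; apply: cvgto_ReIm.
  under eq_fun => n do (rewrite -(big_mkord predT (expterm _)) Re_sum; under eq_bigr => i _ do rewrite expterm_imag /=).
  by rewrite cos.unlock; exact: is_cvg_series_cos_coeff.
under eq_fun => n do (rewrite -(big_mkord predT (expterm _)) Im_sum; under eq_bigr => i _ do rewrite expterm_imag /=).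
by rewrite sin.unlock; exact: is_cvg_series_sin_coeff.
Qed.

(** Real and imaginary exponents have the series of expR, cos and sin; the addition theorem
for the series combines them. *)
Lemma cexp_series z : csums_to (expterm z) (cexp z).
Proof.
suff -> : cexp z = csum (expterm z) by exact/absum_csums/absum_exp.
case: z => x y.
have -> : x +i* y = x%:C + y%:C * 'i%C.
  by apply/eqP; rewrite eq_complex /=; apply/andP; split; apply/eqP; ring.
rewrite csum_expD csum_exp_real csum_exp_imag cexpD.
rewrite -[x%:C]/(x +i* 0).
have -> : y%:C * 'i%C = 0 +i* y :> C.
  by apply/eqP; rewrite eq_complex /=; apply/andP; split; apply/eqP; ring.
rewrite !cexpE expR0 cos0 sin0 !mul1r mulr1 mulr0 //.
Qed.

(** The modulus forces a purely imaginary exponent, and cos y = 1 forces y into 2 pi Z. *)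
Lemma cexp_eq1 z : cexp z = 1 -> exists k : int, z = twopii * k%:~R.
Proof.
case: z => x y h.
have x0 : x = 0.
  have := cn_cexp (x +i* y); rewrite h cn1 /= => /esym e1.
  by apply/eqP; have := expR_inj; move=> /(_ K x 0); rewrite expR0 => /(_ e1) ->.
move: h; rewrite x0 cexpE expR0 !mul1r => /eqP; rewrite eq_complex /= => /andP[/eqP c1 /eqP s0].
have cs (m : int) (t : K) : (cos (t - m%:~R * (pi *+ 2)) = cos t).
  have per n u : cos (u + (pi *+ 2) *+ n) = cos (u : K).
    by rewrite (periodicn (@cosD2pi K)).
  case: m => m.
    by rewrite -[in RHS](subrK (m%:R * (pi *+ 2)) t) mulr_natl per.
  by rewrite NegzE mulrNz mulNr opprK mulr_natl per.
pose k : int := Num.floor (y / (pi *+ 2)).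
have p0 : (0 : K) < pi *+ 2 by rewrite mulrn_wgt0 ?pi_gt0.
pose t := y - k%:~R * (pi *+ 2).
have t0 : 0 <= t.
  by rewrite subr_ge0 -ler_pdivlMr // floor_le.
have t1 : t < pi *+ 2.
  rewrite ltrBlDr -{1}[pi *+ 2]mul1r -mulrDl -ltr_pdivrMr // addrC.
  by have := floorD1_gt (y / (pi *+ 2)); rewrite intrD.
have ct : cos t = 1 by rewrite cs.
have tE : t = (t / 2%:R) *+ 2 by rewrite -mulr_natr; field.
have st : sin (t / 2%:R) = 0.
  have := cos_mulr2n (t / 2%:R); rewrite -tE ct cos2sin2 => h.
  by apply/eqP; rewrite -sqrf_eq0; apply/eqP; move: h; rewrite -mulr_natr; lra.
have t00 : t = 0.
  apply/eqP; case: (ltgtP t 0) => // [|tp]; first by rewrite ltNge t0.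
  have : 0 < sin (t / 2%:R).
    by apply: sin_gt0_pi; move: t1; rewrite -mulr_natr => t1; apply/andP; split; lra.
  by rewrite st ltxx.
exists k; have -> : y = k%:~R * (pi *+ 2) by apply/eqP; rewrite -subr_eq0 -/t t00.
rewrite /twopii.
have -> : k%:~R = (k%:~R : K)%:C :> C by rewrite rmorph_int.
have -> : 2%:R = (2%:R : K)%:C :> C by rewrite rmorph_nat.
rewrite -(mulr_natr pi 2); move: (k%:~R : K) (pi : K) (2%:R : K) => a b c.
by apply/eqP; rewrite eq_complex /=; apply/andP; split; apply/eqP; ring.
Qed.

Lemma e2piiD z w : e2pii (z + w) = e2pii z * e2pii w.
Proof. by rewrite /e2pii mulrDr cexpD. Qed.
Lemma e2pii0 : e2pii (0 : C) = 1.
Proof. by rewrite /e2pii mulr0 cexp0. Qed.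
Lemma e2piiN z : e2pii (- z) = (e2pii z)^-1.
Proof. by rewrite /e2pii mulrN cexpN. Qed.
Lemma e2pii_neq0 z : e2pii z != 0.
Proof. exact: cexp_neq0. Qed.
Lemma e2piiMn z n : e2pii (z * n%:R) = e2pii z ^+ n.
Proof. by rewrite /e2pii mulrA cexpMn. Qed.
Lemma cn_e2pii z : cn (e2pii z) = expR (- (2%:R * pi * complex.Im z)).
Proof.
rewrite /e2pii cn_cexp; congr expR; case: z => x y; rewrite /twopii.
have -> : 2%:R = (2%:R : K)%:C :> C by rewrite rmorph_nat.
by move: (pi : K) (2%:R : K) => b c; rewrite /=; ring.
Qed.
Lemma cn_e2pii_lt1 z : 0 < complex.Im z -> cn (e2pii z) < 1.
Proof. by move=> h; rewrite cn_e2pii expR_lt1 oppr_lt0 !mulr_gt0 ?pi_gt0. Qed.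
Lemma twopii_neq0 : twopii != 0 :> C.
Proof.
rewrite -cn_eq0 !cnM cn_i cn_nat cn_real gtr0_norm ?pi_gt0 // mulr1.
by rewrite gt_eqF // mulr_gt0 ?pi_gt0.
Qed.
Lemma cn_twopii : cn (twopii : C) = 2%:R * pi.
Proof. by rewrite !cnM cn_i cn_nat cn_real ger0_norm ?pi_ge0 // mulr1. Qed.
Lemma e2pii_eq1 z : e2pii z = 1 -> exists k : int, z = k%:~R.
Proof. by move=> /cexp_eq1 [k /(mulfI twopii_neq0) ->]; exists k. Qed.

End ComplexExponential.

Arguments cexp_series {K} z.

(** * Infinite products and the triple product identity *)

Section InfiniteProducts.
Context {K : realType}.
Local Notation C := K[i].
Implicit Types (a : nat -> C).

Lemma prod_exp_bound (x : nat -> K) n : (forall i, 0 <= x i) ->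
  \prod_(i < n) (1 + x i) <= expR (\sum_(i < n) x i).
Proof.
move=> x0; elim: n => [|n IH]; first by rewrite !big_ord0 expR0.
rewrite !big_ord_recr /= expRD; apply: ler_pM => //.
- by apply: prodr_ge0 => i _; rewrite addr_ge0.
- by rewrite addr_ge0.
- exact: expR_ge1Dx.
Qed.

(** The increments of the partial products are summable, since the partial products are bounded. *)
Lemma prod_cvg a : absum a -> exists P, cvgto (fun n => \prod_(i < n) (1 - a i)) P.
Proof.
move=> [B hB].
pose p n := \prod_(i < n) (1 - a i).
have pB n : cn (p n) <= expR B.
  rewrite cn_prod; apply: (@le_trans _ _ (\prod_(i < n) (1 + cn (a i)))).
    apply: ler_prod => i _; rewrite cn_ge0 /=; apply: le_trans (cnB _ _) _.
    by rewrite cn1.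
  apply: le_trans (prod_exp_bound _ (fun i => cn_ge0 (a i))) _.
  by rewrite ler_expR.
have [l /csums_toE hl] : exists l, csums_to (fun n => p n.+1 - p n) l.
  exists (csum (fun n => p n.+1 - p n)); apply: absum_csums.
  apply: (@absum_le _ _ (fun n => expR B * cn (a n))).
    move=> n; rewrite /p big_ord_recr /=.
    have -> : forall x y : C, x * (1 - y) - x = - (x * y) by move=> x y; ring.
    by rewrite cnN cnM ler_wpM2r ?cn_ge0 ?pB.
  by exists (expR B * B) => n; rewrite -mulr_sumr ler_wpM2l ?expR_ge0.
exists (1 + l); apply: eq_cvgto (cvgtoD (cvgto_cst 1) hl) => n.
rewrite -(big_mkord predT (fun n => p n.+1 - p n)) telescope_sumr // /p big_ord0; ring.
Qed.

Lemma inv1B_bounded a : absum a -> (forall i, 1 - a i != 0) ->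
  exists2 B : K, 0 < B & forall n, cn (1 - a n)^-1 <= B.
Proof.
move=> /absum_cvg0 h a1.
have := cvgtoV _ (cvgtoB (cvgto_cst 1) h); rewrite subr0 => /(_ (oner_neq0 _)).
exact: cvgto_bounded.
Qed.

(** The inverse product has the factors 1 + a/(1 - a), so it converges too, and the limits
multiply to 1. *)
Lemma prod_cvg_neq0 a : absum a -> (forall i, 1 - a i != 0) ->
  exists2 P, P != 0 & cvgto (fun n => \prod_(i < n) (1 - a i)) P.
Proof.
move=> ha a1; have [P hP] := prod_cvg ha.
have [B B0 hB] := inv1B_bounded ha a1.
pose b n := - (a n / (1 - a n)).
have [Q hQ] : exists Q, cvgto (fun n => \prod_(i < n) (1 - b i)) Q.
  apply: prod_cvg; have [A hA] := ha.
  apply: (@absum_le _ _ (fun n => cn (a n) * B)).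
    by move=> n; rewrite cnN cnM ler_wpM2l ?cn_ge0.
  by exists (A * B) => n; rewrite -mulr_suml ler_wpM2r // ltW.
exists P => //; apply/eqP => P0.
have := cvgtoM hP hQ; rewrite P0 mul0r => h.
have : cvgto (fun=> 1 : C) 0.
  apply: eq_cvgto h => n; rewrite -big_split /=; apply: big1 => i _.
  by rewrite /b; field.
by move=> /(cvgto_uniq (cvgto_cst 1)) /eqP; rewrite oner_eq0.
Qed.

Lemma absum_shift a m : absum (fun n => a (m + n)%N) -> absum a.
Proof.
move=> [B hB]; exists (\sum_(i < m) cn (a i) + B) => n.
apply: (@le_trans _ _ (\sum_(i < m + n) cn (a i))).
  rewrite addnC big_split_ord /= lerDl; apply: sumr_ge0 => i _; exact: cn_ge0.
rewrite big_split_ord /= lerD2l; exact: hB.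
Qed.

Lemma absum_ratio a (r : K) N : 0 <= r < 1 ->
  (forall n, (N <= n)%N -> cn (a n.+1) <= r * cn (a n)) -> absum a.
Proof.
move=> r01 h; apply: (@absum_shift a N); apply: (@absum_geometric _ _ (cn (a N)) r r01).
elim=> [|n IH]; first by rewrite addn0 expr0 mulr1.
rewrite addnS; apply: le_trans (h _ (leq_addr _ _)) _.
rewrite exprS mulrCA ler_wpM2l //; by case/andP: r01.
Qed.

Lemma expr_cvg0 (q : C) : cn q < 1 -> cvgto (fun n => q ^+ n) 0.
Proof.
move=> q1; apply: absum_cvg0; apply: (@absum_geometric _ _ 1 (cn q)).
  by rewrite cn_ge0.
by move=> n; rewrite cnX mul1r.
Qed.

(** The ratio of consecutive terms tends to 0 like q^n. *)
Lemma absum_qratio a (q c : C) : cn q < 1 ->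
  (forall n, a n.+1 = c * q ^+ n * a n) -> absum a.
Proof.
move=> q1 h.
have := cvgtoZ c (expr_cvg0 q1); rewrite mulr0 => H.
have h2 : (0 : K) < 1 / 2%:R by lra.
have [N hN] := H _ h2.
apply: (@absum_ratio a (1 / 2%:R) N) => [|n Nn]; first by apply/andP; split; lra.
rewrite h cnM ler_wpM2r ?cn_ge0 //; have := hN _ Nn; rewrite subr0; exact: ltW.
Qed.

End InfiniteProducts.

Section JacobiTripleProduct.
Variables (F : fieldType) (q zeta : F) (s : int -> F).
Hypotheses (q0 : q != 0) (z0 : zeta != 0).
Hypothesis q1 : forall n, 1 - q ^+ n.+1 != 0.
Hypothesis s0 : s 0 = 1.
Hypothesis sS : forall k : int, s (k + 1) = - (q ^ (k + 1)) * zeta * s k.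

Definition qfact n : F := \prod_(i < n) (1 - q ^+ i.+1).

(** The Gaussian binomial coefficient. *)
Definition qbin n j : F :=
  if (j <= n)%N then qfact n / (qfact j * qfact (n - j)) else 0.

Lemma qfact_neq0 n : qfact n != 0.
Proof. by apply/prodf_neq0 => i _; exact: q1. Qed.
Lemma qfactS n : qfact n.+1 = qfact n * (1 - q ^+ n.+1).
Proof. by rewrite /qfact big_ord_recr. Qed.
Lemma qbin0 n : qbin n 0 = 1.
Proof. by rewrite /qbin /= subn0 {2}/qfact big_ord0 mul1r divff ?qfact_neq0. Qed.
Lemma qbinn n : qbin n n = 1.
Proof. by rewrite /qbin leqnn subnn {3}/qfact big_ord0 mulr1 divff ?qfact_neq0. Qed.
Lemma qbin_small n j : (n < j)%N -> qbin n j = 0.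
Proof. by move=> h; rewrite /qbin leqNgt h. Qed.

Lemma qbinS1 n j : (j <= n)%N -> qbin n.+1 j.+1 = qbin n j.+1 + q ^+ (n - j) * qbin n j.
Proof.
rewrite leq_eqVlt => /orP[/eqP ->|jn].
  by rewrite !qbinn qbin_small // subnn expr0 mul1r add0r.
have [m ->] : exists m, n = (j + m).+1 by exists (n - j.+1)%N; lia.
rewrite /qbin !ifT; try lia.
have -> : ((j + m).+2 - j.+1 = m.+1)%N by lia.
have -> : ((j + m).+1 - j.+1 = m)%N by lia.
have -> : ((j + m).+1 - j = m.+1)%N by lia.
rewrite !(qfactS (j + m).+1) (qfactS j) (qfactS m).
have -> : q ^+ (j + m).+2 = q ^+ j.+1 * q ^+ m.+1 by rewrite -exprD; congr (_ ^+ _); lia.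
have := q1 j; have := q1 m; have := qfact_neq0 j; have := qfact_neq0 m.
move: (q ^+ j.+1) (q ^+ m.+1) => x y h1 h2 h3 h4.
by field; rewrite h1 h2 h3 h4.
Qed.

Lemma qbinS2 n j : (j <= n)%N -> qbin n.+1 j.+1 = qbin n j + q ^+ j.+1 * qbin n j.+1.
Proof.
rewrite leq_eqVlt => /orP[/eqP ->|jn].
  by rewrite !qbinn qbin_small // mulr0 addr0.
have [m ->] : exists m, n = (j + m).+1 by exists (n - j.+1)%N; lia.
rewrite /qbin !ifT; try lia.
have -> : ((j + m).+2 - j.+1 = m.+1)%N by lia.
have -> : ((j + m).+1 - j.+1 = m)%N by lia.
have -> : ((j + m).+1 - j = m.+1)%N by lia.
rewrite !(qfactS (j + m).+1) (qfactS j) (qfactS m).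
have -> : q ^+ (j + m).+2 = q ^+ j.+1 * q ^+ m.+1 by rewrite -exprD; congr (_ ^+ _); lia.
have := q1 j; have := q1 m; have := qfact_neq0 j; have := qfact_neq0 m.
move: (q ^+ j.+1) (q ^+ m.+1) => x y h1 h2 h3 h4.
by field; rewrite h1 h2 h3 h4.
Qed.

Lemma finite_jtp_neg B :
  \prod_(i < B) (1 - zeta^-1 * q ^+ i) = \sum_(j < B.+1) s (j%:Z - B%:Z) * qbin B j.
Proof.
elim: B => [|B IH]; first by rewrite big_ord0 big_ord1 subr0 s0 qbin0 mulr1.
rewrite big_ord_recr /= IH mulrBr mulr1.
rewrite [RHS]big_ord_recl qbin0 mulr1 sub0r.
rewrite [X in _ - X * _]big_ord_recl qbin0 mulr1 sub0r.
rewrite mulrDl opprD addrCA; congr (_ + _).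
  have := sS (- B.+1%:Z).
  have -> : - B.+1%:Z + 1 = - B%:Z by lia.
  move=> ->; rewrite -exprnN; field; by rewrite expf_neq0 // z0.
rewrite mulr_suml -sumrN.
have -> : \sum_(i < B) - (s ((bump 0 i)%:Z - B%:Z) * qbin B (bump 0 i) * (zeta^-1 * q ^+ B))
  = \sum_(i < B.+1) s ((bump 0 i)%:Z - B.+1%:Z) * q ^+ i.+1 * qbin B i.+1.
  rewrite [RHS]big_ord_recr /= (qbin_small (ltnSn B)) mulr0 addr0.
  apply: eq_bigr => i _; have := sS (i.+1%:Z - B.+1%:Z).
  have -> : i.+1%:Z - B.+1%:Z + 1 = i.+1%:Z - B%:Z by lia.
  rewrite /bump leq0n add1n => ->.
  have -> : q ^+ i.+1 = q ^ (i.+1%:Z - B%:Z) * q ^+ B.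
    by rewrite -[q ^+ i.+1]/(q ^ i.+1%:Z) -[q ^+ B]/(q ^ B%:Z) -expfzDr // subrK.
  field; exact: z0.
rewrite -big_split /=; apply: eq_bigr => i _.
rewrite qbinS2; last by rewrite -ltnS ltn_ord.
rewrite /bump leq0n add1n.
have -> : i.+1%:Z - B.+1%:Z = i%:Z - B%:Z by lia.
ring.
Qed.

(** The q-binomial theorem, shifted so that the index of summation is centred; s j stands for
(-1)^j q^(j(j+1)/2) zeta^j, of which only the recursion matters. *)
Lemma finite_jtp A B :
  \prod_(i < A) (1 - zeta * q ^+ i.+1) * \prod_(i < B) (1 - zeta^-1 * q ^+ i)
  = \sum_(j < (A + B).+1) s (j%:Z - B%:Z) * qbin (A + B) j.
Proof.
elim: A => [|A IH]; first by rewrite big_ord0 mul1r finite_jtp_neg.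
rewrite big_ord_recr /= mulrAC IH mulrBr mulr1 addSn.
rewrite [RHS]big_ord_recl qbin0.
rewrite [X in X - _]big_ord_recl qbin0 -addrA; congr (_ + _).
have -> : \sum_(i < A + B) s ((bump 0 i)%:Z - B%:Z) * qbin (A + B) (bump 0 i)
  = \sum_(i < (A + B).+1) s (i.+1%:Z - B%:Z) * qbin (A + B) i.+1.
  by rewrite [RHS]big_ord_recr /= (qbin_small (ltnSn _)) mulr0 addr0.
rewrite mulr_suml -sumrB; apply: eq_bigr => i _.
have iAB : (i <= A + B)%N by rewrite -ltnS ltn_ord.
rewrite ?lift0 qbinS1 //.
have := sS (i%:Z - B%:Z).
have -> : i%:Z - B%:Z + 1 = i.+1%:Z - B%:Z by lia.
move=> ->.
have -> : q ^+ A.+1 = q ^ (i.+1%:Z - B%:Z) * q ^+ (A + B - i).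
  rewrite -[q ^+ A.+1]/(q ^ A.+1%:Z) -[q ^+ (_ - _)]/(q ^ (A + B - i)%N%:Z) -expfzDr //.
  by congr (_ ^ _); rewrite -subzn //; lia.
ring.
Qed.

End JacobiTripleProduct.

(** * The theta quotient as an infinite product *)

Section ThetaQuotient.
Context {K : realType}.
Local Notation C := K[i].
Variables (z tau : C).
Hypothesis tau_gt0 : 0 < complex.Im tau.
Local Notation q := (e2pii tau).
Local Notation zeta := (e2pii z).

Lemma cn_q_lt1 : cn q < 1. Proof. exact: cn_e2pii_lt1. Qed.
Lemma q_neq0 : q != 0. Proof. exact: e2pii_neq0. Qed.
Lemma zeta_neq0 : zeta != 0. Proof. exact: e2pii_neq0. Qed.

Lemma qS_neq1 n : 1 - q ^+ n.+1 != 0.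
Proof.
rewrite subr_eq0; apply/eqP => h.
have : cn (q ^+ n.+1) < 1 by rewrite cnX exprn_ilt1 ?cn_ge0 ?cn_q_lt1.
by rewrite -h cn1 ltxx.
Qed.

Lemma absum_qS : absum (fun n => q ^+ n.+1).
Proof.
apply: (@absum_geometric _ _ (cn q) (cn q)); first by rewrite cn_ge0 cn_q_lt1.
by move=> n; rewrite cnX exprS.
Qed.

Lemma qfact_cvg : exists2 P : C, P != 0 & cvgto (qfact q) P.
Proof. exact: prod_cvg_neq0 absum_qS qS_neq1. Qed.

(** The summand (-1)^k q^(k(k+1)/2) zeta^k of the theta series. *)
Definition thetaterm (k : int) : C :=
  (-1) ^ k * e2pii (tau * (k%:~R * (k%:~R + 1) / 2%:R) + z * k%:~R).

Lemma e2piiMz (w : C) (k : int) : e2pii (w * k%:~R) = e2pii w ^ k.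
Proof.
case: k => n; first by rewrite -pmulrn e2piiMn.
by rewrite NegzE mulrNz mulrN e2piiN -pmulrn e2piiMn.
Qed.

Lemma thetaterm0 : thetaterm 0 = 1.
Proof. by rewrite /thetaterm !mulr0z !mul0r !mulr0 addr0 e2pii0 mulr1. Qed.

Lemma thetatermS k : thetaterm (k + 1) = - (q ^ (k + 1)) * zeta * thetaterm k.
Proof.
rewrite /thetaterm exprzDr ?unitrN1 // expr1z -!e2piiMz mulrN1 !intrD.
have -> : tau * ((k%:~R + 1%:~R) * (k%:~R + 1%:~R + 1) / 2%:R) + z * (k%:~R + 1%:~R)
  = tau * (k%:~R + 1%:~R) + z + (tau * (k%:~R * (k%:~R + 1) / 2%:R) + z * k%:~R).
  by field.
rewrite !e2piiD; ring.
Qed.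

Lemma absum_thetaterm_pos : absum (fun n => thetaterm n%:Z).
Proof.
apply: (@absum_qratio _ _ q (- q * zeta) cn_q_lt1) => n.
have := thetatermS n%:Z; have -> : n%:Z + 1 = n.+1%:Z by lia.
move=> ->; rewrite -[q ^ n.+1%:Z]/(q ^+ n.+1) exprS; ring.
Qed.

Lemma absum_thetaterm_neg : absum (fun n => thetaterm (- n.+1%:Z)).
Proof.
apply: (@absum_qratio _ _ q (- q * zeta^-1) cn_q_lt1) => n.
have := thetatermS (- n.+2%:Z); have -> : - n.+2%:Z + 1 = - n.+1%:Z by lia.
move=> ->; rewrite -exprnN exprS.
by field; rewrite zeta_neq0 expf_neq0 q_neq0 // q_neq0.
Qed.

(** In the finite identity with A = B = N each Gaussian binomial tends to 1/(q; q)_oo and all are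
bounded, so dominated convergence applies to the two halves of the sum. *)
Lemma jacobi_triple_cvg P : P != 0 -> cvgto (qfact q) P ->
  cvgto (fun N => \prod_(i < N) ((1 - zeta * q ^+ i.+1) * (1 - zeta^-1 * q ^+ i)))
        (zsum thetaterm / P).
Proof.
move=> P0 hP.
have [U U0 hU] := cvgto_bounded hP.
have [W W0 hW] := cvgto_bounded (cvgtoV P0 hP).
have bB n j : cn (qbin q n j) <= U * (W * W).
  rewrite /qbin; case: ifP => _; last by rewrite cn0 !mulr_ge0 // ltW.
  by rewrite invfM !cnM !ler_pM ?mulr_ge0 ?cn_ge0.
have hsub (h : nat -> nat) : (forall n, (n <= h n)%N) -> cvgto (fun n => qfact q (h n)) P.
  by move=> hh; exact: cvgto_sub hh hP.
have lim_pos k : cvgto (fun N => qbin q (N + N) (N + k)) P^-1.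
  apply: (@cvgto_eventually _ (fun N => qfact q (N + N) / (qfact q (N + k) * qfact q (N - k))) _ _ k).
    move=> N kN; rewrite /qbin leq_add2l kN; congr (_ / (_ * qfact q _)); lia.
  have -> : P^-1 = P / (P * P) by field.
  apply: cvgtoM; first by apply: hsub => n; lia.
  apply: cvgtoV; first by rewrite mulf_neq0.
  apply: cvgtoM; first by apply: hsub => n; lia.
  move=> e e0; have [N hN] := hP _ e0; exists (N + k)%N => n hn; apply: hN; lia.
have lim_neg k : cvgto (fun N => qbin q (N + N) (N - k.+1)) P^-1.
  apply: (@cvgto_eventually _ (fun N => qbin q (N + N) (N + k.+1)) _ _ k.+1); last exact: lim_pos.
  move=> N kN; rewrite /qbin !ifT; try lia.
  rewrite (_ : N + N - (N + k.+1) = N - k.+1)%N; last lia.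
  rewrite (_ : N + N - (N - k.+1) = N + k.+1)%N; last lia.
  congr (_ / _); exact: mulrC.
have Msum (a : nat -> C) : absum a ->
    exists B, forall n, \sum_(i < n) cn (a i) * (U * (W * W)) <= B.
  move=> [A hA]; exists (A * (U * (W * W))) => n; rewrite -mulr_suml ler_wpM2r //.
  by rewrite !mulr_ge0 // ltW.
have [|||||_ H1] := @tannery_fin _ (fun N k => thetaterm k%:Z * qbin q (N + N) (N + k))
    (fun k => thetaterm k%:Z * P^-1) (fun k => cn (thetaterm k%:Z) * (U * (W * W))) S.
- by [].
- by move=> n; rewrite !mulr_ge0 ?cn_ge0 // ltW.
- exact: Msum absum_thetaterm_pos.
- by move=> k n _; rewrite cnM ler_wpM2l ?cn_ge0.
- by move=> n; apply: cvgtoZ; exact: lim_pos.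
have [|||||_ H2] := @tannery_fin _ (fun N k => thetaterm (- k.+1%:Z) * qbin q (N + N) (N - k.+1))
    (fun k => thetaterm (- k.+1%:Z) * P^-1) (fun k => cn (thetaterm (- k.+1%:Z)) * (U * (W * W))) id.
- by [].
- by move=> n; rewrite !mulr_ge0 ?cn_ge0 // ltW.
- exact: Msum absum_thetaterm_neg.
- by move=> k n _; rewrite cnM ler_wpM2l ?cn_ge0.
- by move=> n; apply: cvgtoZ; exact: lim_neg.
have cs (a : nat -> C) : absum a -> csum (fun k => a k * P^-1) = csum a * P^-1.
  move=> ha; apply: csums_to_csum.
  have := csumsZ P^-1 (absum_csums ha); rewrite mulrC.
  by apply: eq_csums => n; rewrite mulrC.
rewrite /zsum mulrDl.
have := cvgtoD H2 H1; rewrite (cs _ absum_thetaterm_pos) (cs _ absum_thetaterm_neg) addrC.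
apply: eq_cvgto => N.
rewrite big_split /= (finite_jtp q_neq0 zeta_neq0 qS_neq1 thetaterm0 thetatermS) -addnS big_split_ord /=.
congr (_ + _); last first.
  by apply: eq_bigr => i _; congr (thetaterm _ * _); lia.
rewrite (reindex_inj rev_ord_inj) /=; apply: eq_bigr => i _.
have := ltn_ord i => iN.
congr (thetaterm _ * qbin q _ _); last by lia.
rewrite /=; lia.
Qed.

(** Completing the square: the exponents 1/2 (n + 1/2)^2 and n (n + 1)/2 differ by 1/8. *)
Lemma thetaE : theta1 z tau
  = 'i%C * e2pii (z / 2%:R) * e2pii (tau / 8%:R) * zsum thetaterm.
Proof.
rewrite /theta1 -!mulrA; congr (_ * _); rewrite /zsum.
have E (n : int) : (-1) ^ n
    * e2pii (tau * (2%:R^-1 * (n%:~R + 2%:R^-1) ^+ 2))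
    * e2pii (z * (n%:~R + 2%:R^-1))
  = (e2pii (z / 2%:R) * e2pii (tau / 8%:R)) * thetaterm n.
  rewrite /thetaterm [RHS]mulrCA -[LHS]mulrA; congr (_ * _).
  by rewrite -!e2piiD; congr e2pii; field.
have cs (a b : nat -> C) c : absum a -> (forall n, b n = c * a n) -> csum b = c * csum a.
  move=> ha ab; apply: csums_to_csum.
  by apply: eq_csums (csumsZ c (absum_csums ha)) => n; rewrite ab.
rewrite (cs _ _ _ absum_thetaterm_pos (fun n => E n%:Z)).
rewrite (cs _ _ _ absum_thetaterm_neg (fun n => E (- n.+1%:Z))).
by rewrite -!mulrA !mulrDr.
Qed.

Lemma etaE P : cvgto (qfact q) P -> eta tau = e2pii (tau / 24%:R) * P.
Proof.
move=> /cvgto_lim <-; rewrite /eta; congr (_ * _); set F := (X in limn X).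
have -> : F = qfact q.
  apply/funext => N; rewrite /F /qfact big_add1 big_mkord.
  by apply: eq_bigr => i _; rewrite e2piiMn.
by [].
Qed.

Lemma theta_eta_cvg :
  cvgto (fun N => 'i%C * e2pii (z / 2%:R) * e2pii (tau / 12%:R) *
     \prod_(i < N) ((1 - zeta * q ^+ i.+1) * (1 - zeta^-1 * q ^+ i)))
        (theta1 z tau / eta tau).
Proof.
have [P P0 hP] := qfact_cvg.
rewrite thetaE (etaE hP).
have -> : 'i%C * e2pii (z / 2%:R) * e2pii (tau / 8%:R) * zsum thetaterm /
    (e2pii (tau / 24%:R) * P)
  = 'i%C * e2pii (z / 2%:R) * e2pii (tau / 12%:R) * (zsum thetaterm / P).
  have -> : e2pii (tau / 8%:R) = e2pii (tau / 12%:R) * e2pii (tau / 24%:R).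
    by rewrite -e2piiD; congr e2pii; field.
  field; by rewrite P0 e2pii_neq0.
by apply: cvgtoZ; exact: jacobi_triple_cvg.
Qed.

End ThetaQuotient.

(** * The expansion coefficients G_k *)

Section BernoulliSeries.
Context {K : realType}.
Local Notation C := K[i].

(** All values below n at once, so that the strong recursion is structural. *)
Fixpoint bern_seq (n : nat) : seq C :=
  if n is m.+1 then
    let s := bern_seq m in
    rcons s ((m`!%:R)^-1 - \sum_(j < m) nth 0 s j / ((m - j).+1)`!%:R)
  else [::].

(** The coefficients of u e^u / (e^u - 1). *)
Definition bern (k : nat) : C := nth 0 (bern_seq k.+1) k.

Lemma size_bern_seq n : size (bern_seq n) = n.
Proof. by elim: n => //= n IH; rewrite size_rcons IH. Qed.

Lemma nth_bern_seq n k : (k < n)%N -> nth 0 (bern_seq n) k = bern k.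
Proof.
elim: n => // n IH; rewrite ltnS leq_eqVlt => /orP[/eqP -> //|kn].
by rewrite /= nth_rcons size_bern_seq kn IH.
Qed.

Lemma bernE k : bern k = (k`!%:R)^-1 - \sum_(j < k) bern j / ((k - j).+1)`!%:R.
Proof.
rewrite /bern /= nth_rcons size_bern_seq ltnn eqxx; congr (_ - _).
by apply: eq_bigr => j _; rewrite nth_bern_seq.
Qed.

Lemma bern_conv k : \sum_(j < k.+1) bern j / ((k - j).+1)`!%:R = (k`!%:R)^-1.
Proof.
by rewrite big_ord_recr /= subnn divr1 [X in _ + X]bernE addrC subrK.
Qed.

Lemma bern0 : bern 0 = 1.
Proof. by rewrite bernE big_ord0 subr0 invr1. Qed.

(** A crude bound, enough for convergence near 0. *)
Lemma bern_bound k : cn (bern k) <= 2%:R ^+ k.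
Proof.
elim/ltn_ind: k => -[|k] IH; first by rewrite bern0 cn1 expr0.
rewrite bernE; apply: le_trans (cnB _ _) _.
have h1 : cn ((k.+1)`!%:R^-1 : C) <= 1.
  by rewrite cnV cn_nat invf_le1 ?ltr0n ?fact_gt0 // ler1n fact_gt0.
have h2 : cn (\sum_(j < k.+1) bern j / ((k.+1 - j).+1)`!%:R) <= \sum_(j < k.+1) 2%:R ^+ j / 2%:R.
  apply: le_trans (cn_sum _ _ _) _; apply: ler_sum => j _.
  rewrite cnM cnV cn_nat; apply: ler_pM; rewrite ?cn_ge0 ?invr_ge0 ?ler0n ?IH //.
  rewrite lef_pV2 ?posrE ?ltr0n ?fact_gt0 // ler_nat.
  have := ltn_ord j; rewrite subSn ?leq_ord // => _.
  by rewrite factS; have := fact_gt0 (k - j).+1; nia.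
have h3 : \sum_(j < k.+1) 2%:R ^+ j / 2%:R = (2%:R ^+ k.+1 - 1) / 2%:R :> K.
  rewrite -mulr_suml subrX1; congr (_ / _).
  by rewrite (_ : 2%:R - 1 = 1 :> K) ?mul1r //; lra.
have h4 : 1 <= 2%:R ^+ k.+1 :> K by rewrite exprn_ege1 // ler1n.
lra.
Qed.

Lemma half_ball_cexp (u : C) : complex.Re u < 0 -> cexp u - 1 != 0.
Proof.
move=> h; rewrite subr_eq0; apply/eqP => e; have := cn_cexp u.
by rewrite e cn1 => /esym e1; move: h; rewrite -expR_lt1 e1 ltxx.
Qed.

(** Cauchy product of the series with (e^u - 1)/u. *)
Lemma bern_series (u : C) : cn u < 1 / 2%:R -> complex.Re u < 0 ->
  csums_to (fun k => bern k.+1 * u ^+ k) (cexp u / (cexp u - 1) - u^-1).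
Proof.
move=> u2 ur.
have u0 : u != 0 by apply/eqP => e; move: ur; rewrite e ltxx.
have e1 := half_ball_cexp ur.
have r01 : 0 <= 2%:R * cn u < 1 by have := cn_ge0 u; lra.
have ab : absum (fun k => bern k * u ^+ k).
  apply: (@absum_geometric _ _ 1 (2%:R * cn u)) => // n.
  by rewrite mul1r cnM cnX exprMn ler_wpM2r ?exprn_ge0 ?cn_ge0 ?bern_bound.
have fS k : expterm u k.+1 = u * (u ^+ k / (k.+1)`!%:R).
  by rewrite /expterm exprS mulrA.
have ae : absum (fun k => u ^+ k / (k.+1)`!%:R).
  have [B hB] := absum_exp u; exists (B / cn u) => n.
  have -> : \sum_(i < n) cn (u ^+ i / (i.+1)`!%:R) = (\sum_(i < n) cn (expterm u i.+1)) / cn u.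
    rewrite mulr_suml; apply: eq_bigr => i _; rewrite fS [cn (u * _)]cnM [RHS]mulrC mulKf //.
    by rewrite cn_eq0.
  rewrite ler_pM2r ?invr_gt0 ?cn_gt0 //; apply: le_trans (hB n.+1).
  by rewrite big_ord_recl ler_wpDl ?cn_ge0.
have sE : csum (fun k => u ^+ k / (k.+1)`!%:R) = (cexp u - 1) / u.
  have h := csums_recl (a := expterm u) (eq_csums (fun k => esym (fS k)) (csumsZ u (absum_csums ae))).
  rewrite -(csums_uniq h (cexp_series u)).
  by rewrite /expterm expr0 fact0 divr1; field.
have := csums_cauchy_prod ab ae; rewrite sE => h.
have hc : csums_to (expterm u) (csum (fun k => bern k * u ^+ k) * ((cexp u - 1) / u)).
  apply: eq_csums h => k; rewrite /cauchy_prod /expterm mulrC -bern_conv mulr_suml.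
  apply: eq_bigr => j _; have jk : (j <= k)%N by rewrite -ltnS.
  have -> : u ^+ k = u ^+ j * u ^+ (k - j) by rewrite -exprD subnKC.
  ring.
have S := csums_uniq hc (cexp_series u).
have S' : csum (fun k => bern k * u ^+ k) = u * cexp u / (cexp u - 1).
  have nz : (cexp u - 1) / u != 0 by rewrite mulf_neq0 ?invr_eq0.
  by apply: (mulIf nz); rewrite S; field; rewrite u0 e1.
have ab' : absum (fun k => bern k.+1 * u ^+ k).
  apply: (@absum_geometric _ _ 2%:R (2%:R * cn u)) => // n.
  rewrite cnM cnX exprMn mulrA -exprS ler_wpM2r ?exprn_ge0 ?cn_ge0 ?bern_bound //.
have bS k : u * (bern k.+1 * u ^+ k) = bern k.+1 * u ^+ k.+1 by rewrite exprS; ring.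
have h2 := csums_recl (a := fun k => bern k * u ^+ k) (eq_csums bS (csumsZ u (absum_csums ab'))).
have := csums_uniq h2 (absum_csums ab); rewrite S' bern0 expr0 mulr1.
set X := csum _ => hX.
have -> : cexp u / (cexp u - 1) - u^-1 = X.
  by apply: (mulfI u0); rewrite mulrBr divff // mulrA -hX; ring.
exact: absum_csums.
Qed.

End BernoulliSeries.

Arguments bern_series {K} [u] _ _.

Section GtildeExpansion.
Context {K : realType}.
Local Notation C := K[i].
Variables (z tau : C).
Hypothesis tau_gt0 : 0 < complex.Im tau.
Hypothesis z_generic : forall a b : int, z <> a%:~R + b%:~R * tau.
Local Notation q := (e2pii tau).
Local Notation zeta := (e2pii z).

(** zeta q^k = 1 would put z on the lattice of periods. *)
Lemma zeta_q_neq1 (k : int) : zeta * q ^ k != 1.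
Proof.
apply/eqP => h; have [|m hm] := @e2pii_eq1 _ (z + tau * k%:~R).
  by rewrite e2piiD e2piiMz.
by apply: (z_generic (a := m) (b := - k)); rewrite -hm rmorphN /=; ring.
Qed.

Lemma pfactor_neq0 n : 1 - zeta * q ^+ n != 0.
Proof. by rewrite subr_eq0 eq_sym; exact: (zeta_q_neq1 n%:Z). Qed.

Lemma nfactor_neq0 n : 1 - zeta^-1 * q ^+ n != 0.
Proof.
rewrite subr_eq0; apply/eqP => h; have /eqP := zeta_q_neq1 (- n%:Z); apply.
rewrite -exprnN; apply: invr_inj; by rewrite invr1 invfM invrK -h.
Qed.

(** Coefficients of the Lambert series: the term of P_1 with n >= 1 is q_w^n times
1 + [pcoef n], and the one with index - n is - q_w^(-n) times [ncoef n]. *)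
Definition pcoef n := zeta * q ^+ n / (1 - zeta * q ^+ n).
Definition ncoef n := zeta^-1 * q ^+ n / (1 - zeta^-1 * q ^+ n).

Lemma absum_cq (c : C) : absum (fun n => c * q ^+ n).
Proof.
apply: (@absum_geometric _ _ (cn c) (cn q)); first by rewrite cn_ge0 cn_q_lt1.
by move=> n; rewrite cnM cnX.
Qed.

Lemma coef_bound : exists2 B : K, 0 < B &
  forall n, cn (pcoef n) <= B * cn q ^+ n /\ cn (ncoef n) <= B * cn q ^+ n.
Proof.
have [B1 B10 hB1] := inv1B_bounded (absum_cq zeta) pfactor_neq0.
have [B2 B20 hB2] := inv1B_bounded (absum_cq zeta^-1) nfactor_neq0.
have a0 : 0 <= cn zeta * B1 by rewrite mulr_ge0 ?cn_ge0 ?ltW.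
have b0 : 0 <= cn zeta^-1 * B2 by rewrite mulr_ge0 ?cn_ge0 ?ltW.
exists (1 + cn zeta * B1 + cn zeta^-1 * B2) => [|n]; first lra.
split; rewrite /pcoef /ncoef [cn (_ / _)]cnM [cn (_ * _)]cnM cnX mulrAC.
  apply: ler_wpM2r; first by rewrite exprn_ge0 ?cn_ge0.
  by apply: (@le_trans _ _ (cn zeta * B1)); [rewrite ler_wpM2l ?cn_ge0|lra].
apply: ler_wpM2r; first by rewrite exprn_ge0 ?cn_ge0.
by apply: (@le_trans _ _ (cn zeta^-1 * B2)); [rewrite ler_wpM2l ?cn_ge0|lra].
Qed.

Definition gterm k n : C :=
  (n.+1)%:R ^+ k / k`!%:R * pcoef n.+1 - (- (n.+1)%:R) ^+ k / k`!%:R * ncoef n.+1.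

(** The explicit form of G_(k+1). *)
Definition gcoef k : C :=
  - bern k.+1 + (if k == 0%N then (1 - zeta)^-1 else 0) + csum (gterm k).

(** A partial sum of the exponential series is at most e^|u|, uniformly in its length. *)
Lemma gterm_bound : exists2 B : K, 0 < B & forall (u : C) (m k n : nat),
  cn (\sum_(k < m) u ^+ k * gterm k n) <= B * (cn q * expR (cn u)) ^+ n.+1.
Proof.
have [B B0 hB] := coef_bound; exists (B + B) => [|u m _ n]; first lra.
have -> : \sum_(k < m) u ^+ k * gterm k n
  = (\sum_(k < m) expterm (u * n.+1%:R) k) * pcoef n.+1
    - (\sum_(k < m) expterm (- (u * n.+1%:R)) k) * ncoef n.+1.
  rewrite !mulr_suml -sumrB; apply: eq_bigr => k _.
  by rewrite /gterm /expterm -[- (u * _)]mulrN !exprMn; move: (n.+1%:R : C) (pcoef _) (ncoef _) => a1 a2 a3; ring.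
have eb (w : C) : cn w = cn u * n.+1%:R ->
    cn (\sum_(k < m) expterm w k) <= expR (cn u) ^+ n.+1.
  move=> hw; apply: le_trans (cn_sum _ _ _) _; apply: le_trans (expterm_bound _ _) _.
  by rewrite hw expRM_natr.
have [h1 h2] := hB n.+1.
rewrite exprMn mulrDl; apply: le_trans (cnB _ _) _.
rewrite [cn (_ * pcoef _)]cnM [cn (_ * ncoef _)]cnM.
rewrite (_ : B * _ = expR (cn u) ^+ n.+1 * (B * cn q ^+ n.+1)); last ring.
apply: lerD; apply: ler_pM; rewrite ?cn_ge0 //; apply: eb.
  by rewrite cnM cn_nat.
by rewrite cnN cnM cn_nat.
Qed.

(** Polynomial times geometric growth. *)
Lemma absum_gterm k : absum (gterm k).
Proof.
have [B B0 hB] := coef_bound.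
have [a a0 qa] : exists2 a : K, 0 < a & cn q * expR a < 1.
  have a0 : 0 < pi * complex.Im tau by rewrite mulr_gt0 ?pi_gt0.
  exists (pi * complex.Im tau) => //.
  by rewrite cn_e2pii -expRD expR_lt1; lra.
apply: (@absum_le _ _ (fun n => (B + B) / a ^+ k * (cn q * expR a) ^+ n.+1)).
  move=> n; have [h1 h2] := hB n.+1.
  have pw : n.+1%:R ^+ k / k`!%:R <= expR a ^+ n.+1 / a ^+ k :> K.
    rewrite ler_pdivlMr ?exprn_gt0 // -expRM_natr mulrAC -exprMn.
    apply: (@le_trans _ _ (\sum_(i < k.+1) (a * n.+1%:R) ^+ i / i`!%:R)).
      rewrite big_ord_recr /= [a * _]mulrC lerDr sumr_ge0 // => i _.
      by rewrite mulr_ge0 ?invr_ge0 ?ler0n // exprn_ge0 // mulr_ge0 // ltW.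
    by apply: real_exp_bound; rewrite mulr_ge0 // ltW.
  rewrite [X in _ <= X](_ : _ = (expR a ^+ n.+1 / a ^+ k) * (B * cn q ^+ n.+1) + (expR a ^+ n.+1 / a ^+ k) * (B * cn q ^+ n.+1)); last by rewrite exprMn; ring.
  rewrite /gterm; apply: le_trans (cnB _ _) _.
  rewrite [cn (_ * pcoef _)]cnM [cn (_ * ncoef _)]cnM.
  rewrite ![cn (_ / k`!%:R)]cnM !cnX !cnV cnN !cn_nat.
  by apply: lerD; apply: ler_pM; rewrite ?cn_ge0 // mulr_ge0 ?exprn_ge0 ?invr_ge0 ?ler0n.
have [D hD] : exists D, forall n, \sum_(i < n) (cn q * expR a) ^+ i <= D.
  by exists (1 - cn q * expR a)^-1 => n; apply: geometric_bound; rewrite qa mulr_ge0 ?cn_ge0 ?expR_ge0.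
exists ((B + B) / a ^+ k * (cn q * expR a) * D) => n.
under eq_bigr do rewrite exprS mulrA.
rewrite -mulr_sumr ler_wpM2l //.
by rewrite !mulr_ge0 ?cn_ge0 ?expR_ge0 ?invr_ge0 ?exprn_ge0 // ?ltW // addr_gt0.
Qed.

Lemma csums_fin (I : Type) (r : seq I) (P : pred I) (F : I -> nat -> C) (L : I -> C) :
  (forall i, P i -> csums_to (F i) (L i)) ->
  csums_to (fun n => \sum_(i <- r | P i) F i n) (\sum_(i <- r | P i) L i).
Proof.
move=> h; apply/csums_toE.
have := @cvgto_sum _ _ r P (fun i n => \sum_(j < n) F i j) L (fun i Pi => csums_toE.1 (h i Pi)).
by apply: eq_cvgto => n; rewrite exchange_big.
Qed.

(** Exchange of the expansion in powers of u with the Lambert sum, by dominated convergence. *)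
Lemma gseries_lim (u : C) : cn q * expR (cn u) < 1 ->
  csums_to (fun k => u ^+ k * csum (gterm k))
    (csum (fun n => cexp (u * n.+1%:R) * pcoef n.+1 - cexp (- (u * n.+1%:R)) * ncoef n.+1)).
Proof.
move=> q1; have [B B0 hB] := gterm_bound.
have qu0 : 0 <= cn q * expR (cn u) by rewrite mulr_ge0 ?cn_ge0 ?expR_ge0.
have [||||_] := @tannery _ (fun m n => \sum_(k < m) u ^+ k * gterm k n)
   (fun n => cexp (u * n.+1%:R) * pcoef n.+1 - cexp (- (u * n.+1%:R)) * ncoef n.+1)
   (fun n => B * (cn q * expR (cn u)) ^+ n.+1).
- by move=> n; rewrite mulr_ge0 ?exprn_ge0 // ltW.
- exists (B * (cn q * expR (cn u)) * (1 - cn q * expR (cn u))^-1) => n.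
  under eq_bigr do rewrite exprS mulrA.
  rewrite -mulr_sumr; apply: ler_wpM2l; first by rewrite mulr_ge0 // ltW.
  by apply: geometric_bound; rewrite qu0 q1.
- by move=> m n; exact: hB.
- move=> n.
  have h w := csums_toE.1 (cexp_series (w : C)).
  have := cvgtoB (cvgtoM (h (u * n.+1%:R)) (cvgto_cst (pcoef n.+1)))
                 (cvgtoM (h (- (u * n.+1%:R))) (cvgto_cst (ncoef n.+1))).
  apply: eq_cvgto => m.
  rewrite !mulr_suml -sumrB; apply: eq_bigr => k _.
  by rewrite /gterm /expterm -[- (u * _)]mulrN !exprMn; move: (n.+1%:R : C) (pcoef _) (ncoef _) => a1 a2 a3; ring.
move=> H; apply/csums_toE; apply: eq_cvgto H => m.
apply: csums_to_csum; apply: csums_fin => k _.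
by apply: csumsZ; apply: absum_csums; exact: absum_gterm.
Qed.

(** The terms 1 of 1 + [pcoef n] form a geometric series in e^u; the remaining sums converge in a
full neighbourhood of w = 0. *)
Lemma P1tildeE (w : C) : 0 < complex.Im w -> cn w * (2%:R * pi) < 2%:R * pi * complex.Im tau ->
  let u := twopii * w in
  - P1tilde w z tau = (1 - zeta)^-1 + cexp u / (1 - cexp u) +
    csum (fun n => cexp (u * n.+1%:R) * pcoef n.+1 - cexp (- (u * n.+1%:R)) * ncoef n.+1).
Proof.
move=> w0 wt u.
have cu : cn u = cn w * (2%:R * pi) by rewrite cnM cn_twopii mulrC.
have qu1 : cn q * expR (cn u) < 1.
  rewrite cn_e2pii -expRD expR_lt1 cu; lra.
have qu0 : 0 <= cn q * expR (cn u) by rewrite mulr_ge0 ?cn_ge0 ?expR_ge0.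
have eu : cn (cexp u) < 1 by exact: cn_e2pii_lt1.
have ce (v : C) : cn v = cn u -> cn (cexp v) <= expR (cn u).
  move=> hv; rewrite cn_cexp ler_expR -hv; apply: le_trans (ler_norm _) _; exact: cn_Re.
have [B B0 hB] := coef_bound.
have ab (v : C) (c : nat -> C) : cn v = cn u -> (forall n, cn (c n) <= B * cn q ^+ n) ->
    absum (fun n => cexp (v * n.+1%:R) * c n.+1).
  move=> hv hc; apply: (@absum_geometric _ _ (B * (cn q * expR (cn u))) (cn q * expR (cn u))).
    by rewrite qu0.
  move=> n; rewrite -mulrA -exprS.
  rewrite (_ : B * _ = expR (cn u) ^+ n.+1 * (B * cn q ^+ n.+1)); last by rewrite exprMn; ring.
  rewrite [cn (_ * c _)]cnM cexpMn cnX; apply: ler_pM; rewrite ?exprn_ge0 ?cn_ge0 //.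
  by rewrite lerXn2r ?nnegrE ?cn_ge0 ?expR_ge0 ?ce.
have a1 := ab u pcoef erefl (fun n => (hB n).1).
have a2 := ab (- u) ncoef (cnN u) (fun n => (hB n).2).
rewrite /P1tilde opprK /zsum.
have pos : csums_to (fun n => e2pii (w * n%:~R) / (1 - zeta * e2pii (tau * n%:~R)))
   ((1 - zeta)^-1 + cexp u / (1 - cexp u) + csum (fun n => cexp (u * n.+1%:R) * pcoef n.+1)).
  rewrite -addrA.
  have -> : (1 - zeta)^-1 = e2pii (w * 0%:~R) / (1 - zeta * e2pii (tau * 0%:~R)).
    by rewrite !mulr0z !mulr0 !e2pii0 mulr1 mul1r.
  apply: (csums_recl (a := fun n : nat => e2pii (w * n%:~R) / (1 - zeta * e2pii (tau * n%:~R)))).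
  have geo : csums_to (fun n => cexp u ^+ n.+1) (cexp u / (1 - cexp u)).
    apply/csums_toE.
    have e1 : 1 - cexp u != 0.
      by rewrite subr_eq0; apply/eqP => h; move: eu; rewrite -h cn1 ltxx.
    have := cvgtoZ (cexp u / (1 - cexp u)) (cvgtoB (cvgto_cst 1) (expr_cvg0 eu)).
    rewrite subr0 mulr1; apply: eq_cvgto => n.
    under eq_bigr do rewrite exprS.
    rewrite -mulr_sumr; have := subrX1 (cexp u) n => h.
    have -> : 1 - cexp u ^+ n = - ((cexp u - 1) * \sum_(i < n) cexp u ^+ i) by rewrite -h; ring.
    by field.
  apply: eq_csums (csumsD geo (absum_csums a1)) => n.
  rewrite -!pmulrn !e2piiMn [cexp (u * _)]cexpMn -[e2pii w]/(cexp u) /pcoef.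
  by field; exact: pfactor_neq0.
have neg : csums_to (fun n => e2pii (w * (- n.+1%:Z)%:~R) / (1 - zeta * e2pii (tau * (- n.+1%:Z)%:~R)))
   (- csum (fun n => cexp (- u * n.+1%:R) * ncoef n.+1)).
  have := csumsZ (- 1) (absum_csums a2); rewrite mulN1r.
  apply: eq_csums => n.
  have -> : e2pii (w * (- n.+1%:Z)%:~R) = (cexp u ^+ n.+1)^-1.
    by rewrite mulrNz -pmulrn mulrN e2piiN e2piiMn.
  have -> : e2pii (tau * (- n.+1%:Z)%:~R) = (q ^+ n.+1)^-1.
    by rewrite mulrNz -pmulrn mulrN e2piiN e2piiMn.
  have -> : cexp (- u * n.+1%:R) = (cexp u ^+ n.+1)^-1 by rewrite mulNr cexpN cexpMn.
  rewrite /ncoef.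
  have := nfactor_neq0 n.+1; have := pfactor_neq0; have := q_neq0 tau; have := zeta_neq0 z.
  have := zeta_q_neq1 (- n.+1%:Z); rewrite -exprnN.
  have x0 : q ^+ n.+1 != 0 by rewrite expf_neq0 ?q_neq0.
  have y0 : cexp u ^+ n.+1 != 0 by rewrite expf_neq0 ?cexp_neq0.
  move: (q ^+ n.+1) (cexp u ^+ n.+1) x0 y0 => x y x0 y0 h1 z0 _ _ h2.
  have h3 : x - zeta != 0.
    by apply: contra h1 => /eqP h; rewrite (_ : x = zeta) ?divff // -[LHS](subrK zeta) h add0r.
  have h4 : zeta - x != 0 by rewrite -opprB oppr_eq0.
  by field; rewrite ?y0 ?x0 ?z0 ?h3 ?h4.
rewrite (csums_to_csum pos) (csums_to_csum neg) -!addrA; congr (_ + (_ + _)).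
apply/esym/csums_to_csum.
have := csumsD (absum_csums a1) (csumsZ (-1) (absum_csums a2)); rewrite mulN1r.
by apply: eq_csums => n; rewrite mulN1r mulNr.
Qed.

Lemma gcoef_is_Gtilde (G : nat -> C) : G 0%N = -1 -> (forall k, G k.+1 = gcoef k) ->
  is_Gtilde z tau G.
Proof.
move=> G0 GS; split=> //.
have p0 := pi_gt0 K.
exists (Num.min (1 / (4%:R * pi)) (complex.Im tau)); split.
  by rewrite lt_min tau_gt0 andbT divr_gt0 // mulr_gt0.
move=> w; rewrite normcE' ltcR lt_min => /andP[w1 w2] wI.
have wt : cn w * (2%:R * pi) < 2%:R * pi * complex.Im tau.
  by rewrite mulrC ltr_pM2l // mulr_gt0.
have hw := P1tildeE wI wt; move: hw; set u := twopii * w => /= hw.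
have cu : cn u = cn w * (2%:R * pi) by rewrite cnM cn_twopii mulrC.
have u2 : cn u < 1 / 2%:R.
  by rewrite cu; move: w1; rewrite ltr_pdivlMr ?mulr_gt0 //; lra.
have eu : cn (cexp u) < 1 by exact: cn_e2pii_lt1.
have ur : complex.Re u < 0 by move: eu; rewrite cn_cexp expR_lt1.
have qu1 : cn q * expR (cn u) < 1 by rewrite cn_e2pii -expRD expR_lt1 cu; lra.
have e1 : csums_to (fun k => (if k == 0%N then (1 - zeta)^-1 else 0) * u ^+ k) (1 - zeta)^-1.
  apply/csums_toE; apply: (@cvgto_eventually _ (fun=> (1 - zeta)^-1) _ _ 1); last exact: cvgto_cst.
  by case=> // n _; rewrite big_ord_recl /= expr0 mulr1 big1 ?addr0 // => i _; rewrite mul0r.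
have := csumsD (csumsD (csumsZ (-1) (bern_series u2 ur)) e1) (gseries_lim qu1).
have -> : u^-1 - P1tilde w z tau = -1 * (cexp u / (cexp u - 1) - u^-1) + (1 - zeta)^-1 +
  csum (fun n => cexp (u * n.+1%:R) * pcoef n.+1 - cexp (- (u * n.+1%:R)) * ncoef n.+1).
  rewrite hw -[1 - cexp u]opprB invrN; ring.
by apply: eq_csums => k; rewrite GS /gcoef; ring.
Qed.

Lemma cterms_cvg0 (a : nat -> C) l : csums_to a l -> cvgto a 0.
Proof.
move=> /csums_toE h.
have := cvgtoB (cvgto_sub (h := S) (fun n => leqnSn n) h) h; rewrite subrr.
by apply: eq_cvgto => n; rewrite big_ord_recr /= addrAC subrr add0r.
Qed.

(** Divide by the lowest power with an unknown coefficient and let s tend to 0. *)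
Lemma pseries_eq0 (d : nat -> C) (s0 : K) : 0 < s0 ->
  (forall s : K, 0 < s < s0 -> csums_to (fun k => d k * s%:C ^+ k) 0) ->
  forall k, d k = 0.
Proof.
move=> s0p H; elim/ltn_ind => m IH.
have sC (s : K) : 0 < s -> s%:C != 0 :> C.
  by move=> sp; rewrite -cn_eq0 cn_real normr_eq0 gt_eqF.
have H2 (s : K) : 0 < s < s0 -> csums_to (fun k => d (m + k)%N * s%:C ^+ k) 0.
  move=> hs; have s_neq := sC _ (andP hs).1.
  have /csums_toE h := H s hs; apply/csums_toE.
  have hm : cvgto (fun n => \sum_(i < m + n) d i * s%:C ^+ i) 0.
    exact: (cvgto_sub (h := fun n => (m + n)%N) (fun n => leq_addl m n) h).
  have := cvgtoZ (s%:C ^- m) hm; rewrite mulr0; apply: eq_cvgto => n.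
  rewrite big_split_ord /= [X in X + _]big1 ?add0r => [|i _]; last by rewrite IH ?mul0r.
  rewrite mulr_sumr; apply: eq_bigr => i _.
  by rewrite exprD; field; rewrite expf_neq0.
have s1p : 0 < s0 / 2%:R < s0 by apply/andP; split; lra.
have [B B0 hB] := cvgto_bounded (cterms_cvg0 (H2 _ s1p)).
set s1 := s0 / 2%:R in s1p hB.
have s10 : 0 < s1 by case/andP: s1p.
have key (t : K) : 0 < t < 1 / 2%:R -> cn (d m) <= 2%:R * B * t.
  move=> /andP[t0 t2].
  have hs : 0 < t * s1 < s0 by apply/andP; split; [exact: mulr_gt0|rewrite /s1; nra].
  have /csums_toE h := H2 _ hs.
  rewrite leNgt; apply/negP => lt.
  have e0 : 0 < cn (d m) - 2%:R * B * t by lra.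
  have [N hN] := h _ e0; have := hN N.+1 (leqnSn N).
  rewrite subr0 big_ord_recl /= addn0 expr0 mulr1.
  set S := \sum_(i < N) _ => hlt.
  have hS : cn S <= 2%:R * B * t.
    apply: le_trans (cn_sum _ _ _) _.
    apply: (@le_trans _ _ (\sum_(i < N) B * t * t ^+ i)).
      apply: ler_sum => i _; rewrite /bump leq0n add1n rmorphM exprMn mulrCA cnM -mulrA -exprS.
      have := hB i.+1; rewrite cnX cn_real gtr0_norm // => hb.
      by rewrite [leRHS]mulrC ler_wpM2l // exprn_ge0 // ltW.
    rewrite -mulr_sumr.
    have : \sum_(i < N) t ^+ i <= 2%:R.
      apply: le_trans (geometric_bound _ _) _; first by apply/andP; split; lra.
      by rewrite -[leRHS]invrK lef_pV2 ?posrE; lra.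
    have : 0 < B * t by exact: mulr_gt0.
    nra.
  have : cn (d m) <= cn (d m + S) + cn S.
    by rewrite -{1}[d m](addrK S); exact: cnB.
  lra.
apply/eqP; rewrite -cn_eq0; apply/eqP/le_anti; rewrite cn_ge0 andbT.
rewrite leNgt; apply/negP => dm.
have c0 : 0 < 4%:R * B + 4%:R * cn (d m) by lra.
pose t := cn (d m) / (4%:R * B + 4%:R * cn (d m)).
have tE : t * (4%:R * B + 4%:R * cn (d m)) = cn (d m) by rewrite /t divfK // gt_eqF.
have t0 : 0 < t by rewrite divr_gt0.
have := key t; rewrite t0 /= => /(_ _); have : t < 1 / 2%:R by nra.
by move=> -> /(_ isT); nra.
Qed.

(** On the positive imaginary axis 2 pi i w is a negative real number, so two expansions differ by a
power series that vanishes on an interval. *)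
Lemma is_Gtilde_uniq (G G' : nat -> C) : is_Gtilde z tau G -> is_Gtilde z tau G' -> G =1 G'.
Proof.
move=> [G0 [r [r0 hr]]] [G0' [r' [r0' hr']]] [|k]; first by rewrite G0 G0'.
have p0 : 0 < 2%:R * pi :> K by rewrite mulr_gt0 ?pi_gt0.
suff : (-1) ^+ k * (G k.+1 - G' k.+1) = 0.
  by move=> /eqP; rewrite mulf_eq0 signr_eq0 subr_eq0 => /eqP.
apply: (pseries_eq0 (s0 := 2%:R * pi * Num.min r r') (d := fun k => (-1) ^+ k * (G k.+1 - G' k.+1))).
  by rewrite mulr_gt0 // lt_min r0.
move=> s /andP[sp ss]; pose w : C := 0 +i* (s / (2%:R * pi)).
have wi : 0 < complex.Im w by rewrite /= divr_gt0.
have cw : cn w = s / (2%:R * pi).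
  by rewrite /cn /= expr0n /= add0r sqrtr_sqr gtr0_norm // divr_gt0.
have ws : twopii * w = - s%:C.
  rewrite /w /twopii.
  have -> : 2%:R = (2%:R : K)%:C :> C by rewrite rmorph_nat.
  have e : 2%:R * pi * (s / (2%:R * pi)) = s by rewrite mulrC divfK // gt_eqF.
  rewrite -[in RHS]e; move: (s / (2%:R * pi)) => t; move: (2%:R : K) (pi : K) => b c.
  by apply/eqP; rewrite eq_complex /=; apply/andP; split; apply/eqP; ring.
have lt : cn w < Num.min r r' by rewrite cw ltr_pdivrMr // mulrC.
move: lt; rewrite lt_min => /andP[l1 l2].
have h1 := hr w _ wi; have h2 := hr' w _ wi.
rewrite !normcE' !ltcR in h1 h2.
have := csumsD (h1 l1) (csumsZ (-1) (h2 l2)); rewrite mulN1r subrr ws.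
by apply: eq_csums => j; rewrite [(- s%:C) ^+ _]exprNn; ring.
Qed.

Lemma GtildeE k : Gtilde z tau k.+1 = gcoef k.
Proof.
pose G k := if k is j.+1 then gcoef j else -1.
have hG : is_Gtilde z tau G by exact: gcoef_is_Gtilde.
have h : is_Gtilde z tau (Gtilde z tau).
  by rewrite /Gtilde; apply: (xgetPex (fun=> 0)); exists G.
exact: (is_Gtilde_uniq h hG k.+1).
Qed.

Lemma Gtilde0 : Gtilde z tau 0 = -1.
Proof.
pose G k := if k is j.+1 then gcoef j else -1.
have hG : is_Gtilde z tau G by exact: gcoef_is_Gtilde.
by have [] : is_Gtilde z tau (Gtilde z tau) by rewrite /Gtilde; apply: (xgetPex (fun=> 0)); exists G.
Qed.

End GtildeExpansion.

(** * Formal exponential, logarithm and binomial series *)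

Section TruncatedSeries.
Context {K : realType}.
Local Notation C := K[i].
Implicit Types (p r s t : {poly C}) (a b h : C).

(** Congruence modulo X^n: formal power series are handled as polynomials up to this relation. *)
Definition eqX n p r := forall i, (i < n)%N -> p`_i = r`_i.

Lemma eqX_refl n p : eqX n p p. Proof. by []. Qed.
Lemma eqX_sym n p r : eqX n p r -> eqX n r p.
Proof. by move=> h i hi; rewrite h. Qed.
Lemma eqX_trans n p r s : eqX n p r -> eqX n r s -> eqX n p s.
Proof. by move=> h h' i hi; rewrite h // h'. Qed.
Lemma eqX_le m n p r : (m <= n)%N -> eqX n p r -> eqX m p r.
Proof. by move=> mn h i hi; apply: h; exact: leq_trans mn. Qed.
Lemma eqXD n p p' r r' : eqX n p p' -> eqX n r r' -> eqX n (p + r) (p' + r').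
Proof. by move=> h h' i hi; rewrite !coefD h // h'. Qed.
Lemma eqXN n p p' : eqX n p p' -> eqX n (- p) (- p').
Proof. by move=> h i hi; rewrite !coefN h. Qed.
Lemma eqXB n p p' r r' : eqX n p p' -> eqX n r r' -> eqX n (p - r) (p' - r').
Proof. by move=> h h'; apply: eqXD => //; exact: eqXN. Qed.
Lemma eqXM n p p' r r' : eqX n p p' -> eqX n r r' -> eqX n (p * r) (p' * r').
Proof.
move=> h h' i hi; rewrite !coefM; apply: eq_bigr => j _.
by rewrite h ?h' //; apply: leq_ltn_trans hi; rewrite ?leq_subr // -ltnS.
Qed.
Lemma eqXMl n p r r' : eqX n r r' -> eqX n (p * r) (p * r').
Proof. by move=> h; apply: eqXM. Qed.
Lemma eqXMr n p r r' : eqX n r r' -> eqX n (r * p) (r' * p).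
Proof. by move=> h; apply: eqXM. Qed.
Lemma eqXX n p p' k : eqX n p p' -> eqX n (p ^+ k) (p' ^+ k).
Proof.
by move=> h; elim: k => [|k IH]; rewrite ?expr0 // !exprS; exact: eqXM.
Qed.
Lemma eqXZ n a p p' : eqX n p p' -> eqX n (a *: p) (a *: p').
Proof. by move=> h i hi; rewrite !coefZ h. Qed.
Lemma eqX_deriv n p p' : eqX n.+1 p p' -> eqX n p^`() p'^`().
Proof. by move=> h i hi; rewrite !coef_deriv h. Qed.
Lemma eqX_expr0 n p m : p`_0 = 0 -> (n <= m)%N -> eqX n (p ^+ m) 0.
Proof.
move=> p0 nm; have -> : p = 'X * \poly_(i < size p) p`_i.+1.
  apply/polyP => -[|i]; rewrite coefXM //= coef_poly; case: ltnP => // h.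
  by rewrite nth_default // (leq_trans h).
by move=> i hi; rewrite exprMn coefXnM (leq_trans hi nm) coef0.
Qed.

Lemma nat_roots_eq0 p : (forall n : nat, p.[n%:R] = 0) -> p = 0.
Proof.
move=> h; apply/eqP/negPn/negP => p0.
suff : (size p < size p)%N by rewrite ltnn.
have := @max_poly_roots _ p [seq i%:R | i <- iota 0 (size p)] p0.
rewrite size_map size_iota; apply.
  by apply/allP => x /mapP[i _ ->]; rewrite /root h eqxx.
by rewrite map_inj_uniq ?iota_uniq // => i j /eqP; rewrite eqr_nat => /eqP.
Qed.

Definition gbin a (j : nat) : C := (\prod_(i < j) (a - i%:R)) / (j`!)%:R.

Lemma binzE (m : int) j : binz K m j = gbin m%:~R j. Proof. by []. Qed.

Lemma gbin0 a : gbin a 0 = 1.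
Proof. by rewrite /gbin big_ord0 fact0 divr1. Qed.

Lemma factC_neq0 n : n`!%:R != 0 :> C.
Proof. by rewrite pnatr_eq0 -lt0n fact_gt0. Qed.

Lemma natS_neq0C n : 1 + n%:R != 0 :> C.
Proof. by rewrite addrC natr1 pnatr_eq0. Qed.

Lemma gbinS a j : gbin a j.+1 = gbin a j * (a - j%:R) / j.+1%:R.
Proof.
rewrite /gbin big_ord_recr /= factS natrM; field.
by rewrite ?factC_neq0 ?natS_neq0C.
Qed.

Lemma gbin_nat n j : gbin n%:R j = 'C(n, j)%:R.
Proof.
elim: j => [|j IH]; first by rewrite gbin0 bin0.
rewrite gbinS IH; apply: (mulIf (x := j.+1%:R)); first by rewrite pnatr_eq0.
rewrite divfK ?pnatr_eq0 // -natrM [('C(_, _.+1) * _)%N]mulnC mul_bin_left natrM.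
have [jn|nj] := leqP j n; first by rewrite natrB // mulrC.
by rewrite bin_small // mul0r mulr0.
Qed.

(** The binomial coefficient as a polynomial in its upper argument. *)
Definition gbinp (j : nat) : {poly C} := (j`!%:R)^-1 *: \prod_(i < j) ('X - (i%:R)%:P).

Lemma horner_gbinp a j : (gbinp j).[a] = gbin a j.
Proof.
rewrite /gbinp hornerZ horner_prod /gbin mulrC; congr (_ / _).
by apply: eq_bigr => i _; rewrite hornerXsubC.
Qed.

(** log(1 + s) = sum_n logcoef n s^n. *)
Definition logcoef (n : nat) : C := if n is m.+1 then (-1) ^+ m / n%:R else 0.

(** (1 + s)^a = 1 + a log(1 + s) + O(a^2). *)
Lemma gbinp_coef1 j : (gbinp j)`_1 = logcoef j.
Proof.
case: j => [|j]; first by rewrite /gbinp big_ord0 fact0 invr1 scale1r coef1.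
rewrite /gbinp big_ord_recl /= subr0 coefZ coefXM /= -horner_coef0 horner_prod.
have -> : \prod_(i < j) ('X - ((bump 0 i)%:R)%:P).[0] = (-1) ^+ j * j`!%:R :> C.
  elim: j => [|j IH]; first by rewrite big_ord0 expr0 fact0 mulr1.
  rewrite big_ord_recr IH /= hornerXsubC exprS factS natrM /bump leq0n add1n; ring.
rewrite /logcoef factS natrM; field.
by rewrite ?factC_neq0 ?natS_neq0C.
Qed.

Lemma texp_coef N a i : (i <= N)%N -> (texp N a)`_i = expterm a i.
Proof. by move=> h; rewrite /texp coef_poly ltnS h. Qed.

Lemma texpD N a b : eqX N.+1 (texp N a * texp N b) (texp N (a + b)).
Proof.
move=> i hi; rewrite texp_coef // exptermD coefM; apply: eq_bigr => j _.
by rewrite !texp_coef //; have := ltn_ord j; lia.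
Qed.

Lemma texp_nat N n : eqX N.+1 (texp N 1 ^+ n) (texp N n%:R).
Proof.
elim: n => [|n IH].
  rewrite expr0 => -[|i] hi; rewrite texp_coef // coef1 /expterm ?expr0 ?fact0 ?divr1 //.
  by rewrite expr0n mul0r.
rewrite exprS -natr1 addrC; apply: eqX_trans; last exact: texpD.
exact: eqXMl.
Qed.

(** The series t = e^u - 1 in the variable u. *)
Definition tvar N : {poly C} := texp N 1 - 1.

Lemma tvar0 N : (tvar N)`_0 = 0.
Proof. by rewrite coefB texp_coef // /expterm expr0 fact0 divr1 coef1 subrr. Qed.

Lemma tvarE N : eqX N.+1 (tvar N) ('X * tB N).
Proof.
move=> [|i] hi; rewrite coefXM /= ?tvar0 // coefB texp_coef // coef1 subr0.
by rewrite /expterm expr1n mul1r coef_poly ltnW.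
Qed.

(** The identity (1 + t)^a = e^(a u) holds at the natural numbers a by the binomial theorem, and each
coefficient is a polynomial in a. *)
Lemma gbin_series_poly N i : (i <= N)%N ->
  \sum_(m < N.+1) (tvar N ^+ m)`_i *: gbinp m = (i`!%:R)^-1 *: 'X^i.
Proof.
move=> iN; apply/eqP; rewrite -subr_eq0; apply/eqP/nat_roots_eq0 => n.
rewrite hornerD hornerN hornerZ hornerXn horner_sum; apply/eqP; rewrite subr_eq0; apply/eqP.
have := texp_nat (N := N) n (i := i); rewrite ltnS => /(_ iN).
rewrite texp_coef // /expterm mulrC => <-.
have -> : texp N 1 = 1 + tvar N by rewrite /tvar addrC subrK.
rewrite exprDn.
have -> : \sum_(m < N.+1) ((tvar N ^+ m)`_i *: gbinp m).[n%:R]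
  = \sum_(m < N.+1) 'C(n, m)%:R * (tvar N ^+ m)`_i.
  by apply: eq_bigr => m _; rewrite hornerZ horner_gbinp gbin_nat mulrC.
rewrite coef_sum.
transitivity (\sum_(m < (n + N).+1) 'C(n, m)%:R * (tvar N ^+ m)`_i).
  rewrite -addnS addnC big_split_ord /= [X in _ = _ + X]big1 ?addr0 // => m _.
  by rewrite (eqX_expr0 (tvar0 N) (leq_addr m N.+1)) ?coef0 ?mulr0 // ltnS.
rewrite -addSn big_split_ord /= [X in _ + X]big1 ?addr0 => [|m _].
  by apply: eq_bigr => m _; rewrite expr1n mul1r coefMn mulr_natl.
by rewrite bin_small ?mul0r // addSn ltnS leq_addr.
Qed.

(** (1 + t)^a = e^(a u). *)
Lemma gbin_series N a : eqX N.+1 (\sum_(m < N.+1) gbin a m *: tvar N ^+ m) (texp N a).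
Proof.
move=> i hi; rewrite texp_coef // coef_sum.
have := congr1 (fun p => p.[a]) (gbin_series_poly (N := N) (i := i) hi).
rewrite hornerZ hornerXn horner_sum /expterm mulrC => <-.
by apply: eq_bigr => m _; rewrite coefZ hornerZ horner_gbinp mulrC.
Qed.

(** log(1 + t) = u: the linear term in a of the previous identity. *)
Lemma logcoef_series N : eqX N.+1 (\sum_(m < N.+1) logcoef m *: tvar N ^+ m) 'X.
Proof.
move=> i hi; rewrite coef_sum.
have h := gbin_series_poly (N := N) (i := i) hi.
have -> : 'X`_i = ((i`!%:R)^-1 *: 'X^i : {poly C})`_1.
  rewrite coefZ coefXn coefX eq_sym; case: eqP => [<-|_]; last by rewrite mulr0.
  by rewrite invr1 mulr1.
rewrite -h coef_sum; apply: eq_bigr => m _.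
by rewrite (coefZ (tvar N ^+ m)`_i) gbinp_coef1 coefZ mulrC.
Qed.

Definition logser N : {poly C} := \poly_(n < N.+1) logcoef n.

Lemma deriv_sum (I : Type) (l : seq I) (P : pred I) (F : I -> {poly C}) :
  (\sum_(i <- l | P i) F i)^`() = \sum_(i <- l | P i) (F i)^`().
Proof. by apply: (big_morph _ (@derivD _)); rewrite raddf0. Qed.

(** The derivative of log(1 + s), times 1 + s, is 1. *)
Lemma logser_deriv N : (1 + 'X) * (logser N)^`() = 1 - (- 'X) ^+ N.
Proof.
have -> : (logser N)^`() = \sum_(i < N) (- 'X) ^+ i.
  apply/polyP => i; rewrite coef_deriv coef_poly coef_sum ltnS.
  have E (j : nat) : ((- 'X : {poly C}) ^+ j)`_i = (-1) ^+ j * (i == j)%:R.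
    by rewrite -scaleN1r exprZn coefZ coefXn.
  under eq_bigr do rewrite E.
  case: ltnP => iN.
    rewrite (bigD1 (Ordinal iN)) //= eqxx mulr1 big1 ?addr0 => [|j /negPf ji].
      by rewrite /logcoef -[LHS]mulr_natr divfK // pnatr_eq0.
    by rewrite -[(i == j :> nat)]/(Ordinal iN == j) eq_sym ji mulr0.
  rewrite mul0rn big1 // => j _.
  by rewrite gtn_eqF ?mulr0 // (leq_trans (ltn_ord j)).
have := subrX1 (- 'X : {poly C}) N => h; rewrite -[RHS]opprB h; ring.
Qed.

(** Both exp(a log(1 + s)) and (1 + s)^a solve (1 + s) E' = a E, E(0) = 1. *)
Lemma exp_logser N a :
  eqX N.+1 (\sum_(k < N.+1) (a ^+ k / k`!%:R) *: logser N ^+ k) (\poly_(m < N.+1) gbin a m).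
Proof.
set E := \sum_(k < _) _.
have L0 : (logser N)`_0 = 0 by rewrite coef_poly.
have dE : eqX N ((1 + 'X) * E^`()) (a *: E).
  have -> : E^`() = a *: ((logser N)^`() * (E - (a ^+ N / N`!%:R) *: logser N ^+ N)).
    have -> : E - (a ^+ N / N`!%:R) *: logser N ^+ N = \sum_(k < N) (a ^+ k / k`!%:R) *: logser N ^+ k.
      by rewrite /E big_ord_recr /= addrK.
    rewrite /E deriv_sum big_ord_recl expr0 alg_polyC derivC add0r.
    rewrite mulr_sumr scaler_sumr; apply: eq_bigr => i _.
    rewrite lift0 derivZ deriv_exp /= -[_ *+ i.+1]scaler_nat -scalerAr !scalerA; congr (_ *: _).
    rewrite exprS factS natrM; field.
    by rewrite ?factC_neq0 ?natS_neq0C.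
  rewrite -scalerAr mulrA logser_deriv; apply: eqXZ.
  have h1 : eqX N (1 - (- 'X) ^+ N) 1.
    have X0 : (- 'X : {poly C})`_0 = 0 by rewrite coefN coefX oppr0.
    by have := eqXB (@eqX_refl N 1) (eqX_expr0 X0 (leqnn N)); rewrite subr0.
  have h2 : eqX N (E - (a ^+ N / N`!%:R) *: logser N ^+ N) E.
    have := eqXB (@eqX_refl N E) (eqXZ (a ^+ N / N`!%:R) (eqX_expr0 L0 (leqnn N))).
    by rewrite scaler0 subr0.
  by have := eqXM h1 h2; rewrite mul1r.
have E0 : E`_0 = 1.
  rewrite coef_sum big_ord_recl /= expr0 fact0 divr1 scale1r expr0 coef1 big1 ?addr0 // => i _.
  by rewrite coefZ (eqX_expr0 (n := 1) L0) ?coef0 ?mulr0 //.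
clearbody E; elim=> [|m IH] mN; first by rewrite E0 coef_poly gbin0.
have := dE m mN; rewrite coefZ mulrDl mul1r coefD coefXM !coef_deriv.
have Em : E`_m = gbin a m by rewrite (IH (ltnW mN)) coef_poly ltnW.
have -> : (if m == 0%N then 0 else E`_m.-1.+1 *+ m.-1.+1) = E`_m *+ m by case: (m).
rewrite Em => h; rewrite [RHS]coef_poly mN gbinS; move: (E`_m.+1) h => x.
rewrite -(mulr_natr x) -(mulr_natr (gbin a m)) => h.
apply: (mulIf (x := m.+1%:R)); first by rewrite pnatr_eq0.
rewrite divfK ?pnatr_eq0 // mulrBr -[LHS](addrK (gbin a m * m%:R)) h; ring.
Qed.

End TruncatedSeries.

(** * Coefficients of the square bracket modes *)

Section SquareBracketCoefficients.
Context {K : realType}.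
Local Notation C := K[i].
Implicit Types (p r s t : {poly C}) (a b h : C).

Lemma coef_congr p r i : p = r -> p`_i = r`_i.
Proof. by move=> ->. Qed.

Lemma texp_tB N : eqX N.+1 (texp N 1) (1 + 'X * tB N : {poly C}).
Proof.
have h := eqXD (@eqX_refl K N.+1 1) (@tvarE K N).
by move: h; rewrite /tvar addrCA subrr addr0.
Qed.

Lemma tB0 N : (tB N)`_0 = 1 :> C.
Proof. by rewrite coef_poly /= invr1. Qed.

Lemma tBinvP N : eqX N.+1 (tBinv N * tB N) (1 : {poly C}).
Proof.
have E : tBinv N * tB N = 1 - (1 - tB N) ^+ N.+1 :> {poly C}.
  have h := subrX1 (1 - tB N : {poly C}) N.+1.
  rewrite -[RHS]opprB h /tBinv; ring.
have z : (1 - tB N : {poly C})`_0 = 0 by rewrite coefB coef1 tB0 subrr.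
have := eqXB (@eqX_refl K N.+1 1) (eqX_expr0 z (leqnn N.+1)).
by rewrite subr0 -E.
Qed.

Lemma tB_le n N : (n <= N)%N -> eqX n.+1 (tB n) (tB N : {poly C}).
Proof. by move=> nN i hi; rewrite !coef_poly hi ltnS (leq_trans _ nN). Qed.

Lemma texp_le n N a : (n <= N)%N -> eqX n.+1 (texp n a) (texp N a).
Proof. by move=> nN i hi; rewrite !coef_poly hi ltnS (leq_trans _ nN). Qed.

Lemma tBinv_le n N : (n <= N)%N -> eqX n.+1 (tBinv n) (tBinv N : {poly C}).
Proof.
move=> nN.
have nN1 : (n.+1 <= N.+1)%N by [].
have h1 := eqXMl (tBinv n) (eqX_sym (eqX_le nN1 (@tBinvP N))).
rewrite mulr1 in h1; apply: eqX_trans h1 _.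
have h2 := eqXMl (tBinv n * tBinv N) (eqX_sym (tB_le nN)).
have h3 := eqXMr (tBinv N) (@tBinvP n).
rewrite mul1r in h3; apply: eqX_trans h3.
by move=> i hi; have := h2 i hi; rewrite mulrA mulrAC [in RHS]mulrAC.
Qed.

(** With B = (e^u - 1)/u and I = 1/B one has e^u = (u B)', so that
m e^u I^(m+1) = m I^m - u (I^m)'.  This is the formal residue computation behind Lagrange
inversion for e^u - 1. *)
Lemma residue_rec N m i : (i < N)%N ->
  (texp N 1 * tBinv N ^+ m.+1)`_i *+ m = (tBinv N ^+ m)`_i * (m%:R - i%:R) :> C.
Proof.
move=> iN; set I : {poly C} := tBinv N; pose B : {poly C} := tB N.
have IB : eqX N.+1 (I * B) 1 by exact: tBinvP.
have IBN := eqX_le (leqnSn N) IB.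
have E1 : eqX N (texp N 1) (B + 'X * B^`()).
  have h := eqX_deriv (@texp_tB N).
  have : eqX N (texp N 1)^`() (texp N (1 : C)).
    move=> j hj; rewrite coef_deriv !coef_poly !ltnS (ltnW hj) hj !expr1n factS natrM.
    by rewrite !div1r -[LHS]mulr_natr invfM mulrAC mulVf ?mul1r // pnatr_eq0.
  move=> /eqX_sym /eqX_trans; apply; move: h.
  by rewrite derivD derivM derivX mul1r -polyC1 derivC add0r.
clearbody I B.
have dI : eqX N (I^`() * B) (- (I * B^`())).
  have := eqX_deriv IB; rewrite derivM -polyC1 derivC => h j hj.
  by have := h j hj; rewrite coefD coef0 coefN => /eqP; rewrite addr_eq0 => /eqP.
have key : eqX N ((texp N 1 * I ^+ m.+1) *+ m) (I ^+ m *+ m - 'X * (I ^+ m)^`()).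
  case: m => [|m].
    have -> : (I ^+ 0)^`() = 0 by rewrite expr0 -polyC1 derivC.
    by rewrite mulr0 subr0 => j _; rewrite !mulr0n.
  rewrite deriv_exp /=.
  have h1 := eqXMr (I ^+ m.+2) E1.
  have h2 : eqX N ((B + 'X * B^`()) * I ^+ m.+2) (I ^+ m.+1 - 'X * (I^`() * I ^+ m)).
    have a1 := eqXMr (I ^+ m.+1) IBN; rewrite mul1r in a1.
    have a2 := eqXMl 'X (eqXMr (I ^+ m) dI).
    have a3 := eqXMl ('X * B^`() * I ^+ m.+1) IBN.
    have a4 := eqXMr ('X * I^`() * I ^+ m) IBN.
    have e1 : (B + 'X * B^`()) * I ^+ m.+2
       = I * B * I ^+ m.+1 + 'X * (I * B^`() * I ^+ m) * I by rewrite !exprS; ring.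
    rewrite e1; apply: eqXD => //.
    have a5 : eqX N ('X * (I * B^`() * I ^+ m) * I) (- ('X * (I^`() * B * I ^+ m)) * I).
      have := eqXMr I (eqXN a2) => /eqX_sym; apply: eqX_trans.
      by move=> j hj; apply: coef_congr; ring.
    apply: eqX_trans a5 _.
    have a6 := eqXN a4; move=> j hj; have := a6 j hj.
    have -> : - ('X * (I^`() * B * I ^+ m)) * I = - (I * B * ('X * I^`() * I ^+ m)) by ring.
    by move=> ->; apply: coef_congr; ring.
  have h3 := eqX_trans h1 h2.
  move=> j hj; rewrite coefMn (h3 j hj) -coefMn; apply: coef_congr.
  by rewrite mulrnBl mulrnAr.
have := key i iN; rewrite coefMn coefB coefMn coefXM coef_deriv => ->.
have -> : (if i == 0%N then 0 else (I ^+ m)`_i.-1.+1 *+ i.-1.+1) = (I ^+ m)`_i *+ i by case: (i).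
by rewrite mulrBr !mulr_natr.
Qed.

(** At i = m the right-hand side of [residue_rec] vanishes, which relates consecutive m. *)
Lemma residue_val N m : (m < N)%N -> (tBinv N ^+ m.+1)`_m = (-1) ^+ m :> C.
Proof.
elim: m => [|m IH] mN.
  have := @tBinvP N 0%N isT; rewrite coef0M tB0 mulr1 coef1 => h.
  by rewrite expr1 h expr0.
have IH' := IH (ltnW mN).
have := @residue_rec N m.+1 m.+1 mN; rewrite subrr mulr0 => /eqP.
rewrite mulrn_eq0 /= => /eqP.
have := eqXMr (tBinv N ^+ m.+2) (@texp_tB N) => /(_ m.+1 (ltnW mN)).
rewrite mulrDl mul1r coefD -mulrA coefXM /= => -> /eqP; rewrite addr_eq0 => /eqP ->.
have := eqXMl (tBinv N ^+ m.+1) (@tBinvP N) => /(_ m (ltnW (ltnW mN))).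
rewrite mulr1 mulrA -exprSr mulrC => ->.
by rewrite IH' exprS mulN1r.
Qed.

Lemma sqcoefE h (m n : int) : n <= m ->
  sqcoef h m n = (texp `|m - n|%N h * tBpow `|m - n|%N (- m - 1))`_(`|m - n|%N).
Proof. by rewrite /sqcoef => ->. Qed.

Lemma sqcoef0 h (m n : int) : ~~ (n <= m) -> sqcoef h m n = 0.
Proof. by rewrite /sqcoef => /negPf ->. Qed.

(** J has weight 1, and J[1] = sum_m (-1)^(m-1)/m J(m). *)
Lemma sqcoef_J m : sqcoef 1 m.+1%:Z 1 = logcoef m.+1 :> C.
Proof.
rewrite sqcoefE; last by lia.
have -> : `|(m.+1%:Z - 1)%R|%N = m by lia.
have -> : - m.+1%:Z - 1 = Negz m.+1 by lia.
rewrite /tBpow /logcoef.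
have L := eqXM (texp_le 1 (leq_addr 2 m)) (eqXX m.+2 (tBinv_le (leq_addr 2 m))).
rewrite (L m (ltnSn m)).
have := @residue_rec (m + 2) m.+1 m; rewrite addn2 => /(_ (leqnSn m.+1)).
rewrite residue_val ?(leqnSn m.+1) // -natrB // subSnn mulr1 => <-.
by rewrite -[X in _ = X / _]mulr_natr mulfK // pnatr_eq0.
Qed.

(** The coefficient of psi(-j) in psi[-k] for a vector psi of weight 1/2. *)
Definition psicoef (k j : nat) : C := sqcoef 2%:R^-1 (- j%:Z) (- k%:Z).

Lemma psicoef_gt k j : (k < j)%N -> psicoef k j = 0.
Proof. by move=> h; rewrite /psicoef sqcoef0 //; lia. Qed.

Lemma tvarX_shift N n p : eqX N.+1 (p * tvar N ^+ n) ('X^n * (p * tB N ^+ n)).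
Proof.
have := eqXMl p (eqXX n (@tvarE K N)).
by move=> h i hi; rewrite (h i hi); apply: coef_congr; rewrite exprMn; ring.
Qed.

(** A residue in u: psi(-j) pairs with (e^u - 1)^(j-1). *)
Lemma psicoefS N k j : (k <= N)%N -> psicoef k.+1 j.+1 = (texp N 2%:R^-1 * tvar N ^+ j)`_k.
Proof.
move=> kN; rewrite (tvarX_shift _ _ kN) coefXnM.
have [kj|jk] := ltnP k j; first by rewrite psicoef_gt.
rewrite /psicoef sqcoefE; last by lia.
have -> : `|(- j.+1%:Z - (- k.+1%:Z))%R|%N = (k - j)%N by lia.
have -> : - (- j.+1%:Z) - 1 = j%:Z by lia.
have h : (k - j <= N)%N by lia.
by rewrite (eqXM (texp_le _ h) (eqXX j (tB_le h)) (ltnSn _)).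
Qed.

Lemma psicoef0 N k : (k <= N)%N -> psicoef k 0 = (texp N 2%:R^-1 * tBinv N)`_k.
Proof.
move=> kN; rewrite /psicoef sqcoefE; last by lia.
have -> : `|(- 0%:Z - (- k%:Z))%R|%N = k by lia.
by rewrite /= expr1 (eqXM (texp_le _ kN) (tBinv_le kN) (ltnSn _)).
Qed.

Lemma tBinv_tvar N j : eqX N.+1 (tBinv N * tvar N ^+ j.+1) ('X * tvar N ^+ j : {poly C}).
Proof.
have h1 := eqXMl (tBinv N * tvar N ^+ j) (@tvarE K N).
have h2 := eqXMl ('X * tvar N ^+ j) (@tBinvP N); rewrite mulr1 in h2.
move=> i hi; rewrite exprSr mulrA (h1 i hi) -(h2 i hi).
apply: coef_congr; ring.
Qed.

(** One degree higher, where j = 0 is allowed as well. *)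
Lemma psicoefS0 N k j : (k < N)%N ->
  psicoef k.+1 j = (texp N 2%:R^-1 * (tBinv N * tvar N ^+ j))`_k.+1.
Proof.
move=> kN; case: j => [|j]; first by rewrite (@psicoef0 N) // expr0 mulr1.
have h := eqXMl (texp N 2%:R^-1) (@tBinv_tvar N j).
rewrite (h k.+1 kN) mulrCA coefXM /=; apply: psicoefS; exact: ltnW.
Qed.

(** The coefficients after the action of Delta, which is (1 + D)^(1/2) in the shift D of the index. *)
Definition deltacoef (k i : nat) : C := \sum_(m < k.+1) gbin 2%:R^-1 m * psicoef k (m + i)%N.

(** The factor (1 + t)^(1/2) = e^(u/2) raises the weight factor e^(u/2) to e^u. *)
Lemma deltacoefE N k i : (k < N)%N ->
  deltacoef k.+1 i = (texp N 1 * (tBinv N * tvar N ^+ i))`_k.+1.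
Proof.
move=> kN; have h := @texpD K N 2%:R^-1 2%:R^-1.
have e1 : 2%:R^-1 + 2%:R^-1 = 1 :> C by field.
rewrite e1 in h.
have h2 := eqXMr (tBinv N * tvar N ^+ i)
   (eqX_trans (eqXMl (texp N 2%:R^-1) (@gbin_series K N 2%:R^-1)) h).
rewrite -(h2 k.+1 kN) mulr_sumr mulr_suml coef_sum /deltacoef.
transitivity (\sum_(m < N.+1) gbin 2%:R^-1 m * psicoef k.+1 (m + i)).
  have kN1 : (k.+2 <= N.+1)%N by [].
  rewrite -(subnKC kN1) big_split_ord /= [X in _ = _ + X]big1 ?addr0 // => m _.
  by rewrite psicoef_gt ?mulr0 //; lia.
apply: eq_bigr => m _; rewrite (psicoefS0 _ kN) -coefZ; apply: coef_congr.
by rewrite -scalerAr -scalerAl exprD; congr (_ *: _); ring.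
Qed.

(** The constant term is the coefficient of e^u u / (e^u - 1). *)
Lemma deltacoef0 k : deltacoef k.+1 0 = bern k.+1.
Proof.
have kN : (k < k.+1)%N by [].
rewrite (deltacoefE 0 kN) expr0 mulr1.
pose b := \poly_(i < k.+2) (bern i : C).
have h : eqX k.+2 (b * tB k.+1) (texp k.+1 1).
  move=> i hi; rewrite texp_coef // /expterm expr1n mul1r -bern_conv coefM.
  apply: eq_bigr => j _; rewrite !coef_poly.
  by rewrite ifT ?ifT //; have := ltn_ord j; lia.
have h1 := eqXMr (tBinv k.+1) h.
have h2 := eqXMl b (@tBinvP k.+1); rewrite mulr1 in h2.
have kk : (k.+1 < k.+2)%N by [].
rewrite -(h1 k.+1 kk) -mulrA [tB _ * _]mulrC (h2 k.+1 kk) coef_poly ltnSn //.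
Qed.

(** The terms with i >= 1 are the coefficients of e^u t^(i-1), and sum_i binom(a, i) t^i = e^(a u). *)
Lemma deltacoef_sum k a : \sum_(i < k.+1) deltacoef k.+1 i.+1 * gbin a i = expterm (a + 1) k.
Proof.
have kN : (k < k.+1)%N by [].
have h := eqXMl (texp k.+1 1) (@gbin_series K k.+1 a).
have h2 := @texpD K k.+1 1 a; rewrite addrC in h2.
have kk : (k < k.+2)%N by lia.
rewrite -(texp_coef (N := k.+1)) ?leqnSn // -(eqX_trans h h2 kk) mulr_sumr coef_sum.
rewrite [RHS]big_ord_recr /= -scalerAr coefZ.
have -> : (texp k.+1 1 * tvar k.+1 ^+ k.+1)`_k = 0 :> C.
  by rewrite (eqXMl _ (eqX_expr0 (tvar0 (K := K) k.+1) (leqnn k.+1)) (ltnSn k)) mulr0 coef0.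
rewrite mulr0 addr0; apply: eq_bigr => i _.
rewrite (deltacoefE _ kN) -scalerAr coefZ mulrC; congr (_ * _).
have h3 := eqXMl (texp k.+1 1) (@tBinv_tvar k.+1 i).
by rewrite (h3 k.+1 (ltnSn k.+1)) mulrCA coefXM.
Qed.

(** Multiplication by log(1 + t) = u lowers the degree by one. *)
Lemma logcoef_psicoef k j : \sum_(m < k.+3) logcoef m * psicoef k.+2 (m + j) = psicoef k.+1 j.
Proof.
(* the degree k + 2 is the one in which the factor u is split off *)
pose N := k.+2.
have h := eqXMl (texp N 2%:R^-1 * (tBinv N * tvar N ^+ j)) (@logcoef_series K N).
have := h k.+2 (ltnSn N); rewrite mulr_sumr coef_sum coefMX /= => e.
rewrite [RHS](@psicoefS0 N) // -e; apply: eq_bigr => m _.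
rewrite -scalerAr coefZ (@psicoefS0 N) //.
congr (_ * _); apply: coef_congr; rewrite exprD; ring.
Qed.

Lemma logcoef_psicoef1 : logcoef 1 * psicoef 1 1 = 1.
Proof.
rewrite /logcoef expr0 divr1 mul1r (@psicoefS 0) // expr0 mulr1 texp_coef //.
by rewrite /expterm expr0 fact0 divr1.
Qed.

End SquareBracketCoefficients.

(** * Diagonalizable operators and traces *)

Section FiniteSupportSums.
Context {U : zmodType}.

Lemma iota0E N : iota 0 N = index_iota 0 N.
Proof. by rewrite /index_iota subn0. Qed.

Lemma fsum_seq (T : choiceType) (r : seq T) (F : T -> U) : uniq r ->
  (forall i, i \notin r -> F i = 0) -> \sum_(i \in [set: T]) F i = \sum_(i <- r) F i.
Proof.
move=> ur h; rewrite (@fsbigE _ _ _ _ _ r) //; last by move=> i _; exact: h.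
by apply: eq_bigl => i; rewrite in_setT.
Qed.

Lemma fsum_one (T : choiceType) (a : T) (F : T -> U) :
  (forall i, i != a -> F i = 0) -> \sum_(i \in [set: T]) F i = F a.
Proof.
by move=> h; rewrite (@fsum_seq _ [:: a]) ?big_seq1 // => i; rewrite inE; exact: h.
Qed.

Lemma fsum_nat N (F : nat -> U) : (forall i, (N <= i)%N -> F i = 0) ->
  \sum_(i \in [set: nat]) F i = \sum_(i < N) F i.
Proof.
move=> h; rewrite (@fsum_seq _ (iota 0 N)) ?iota_uniq //.
  by rewrite iota0E big_mkord.
by move=> i; rewrite mem_iota add0n /= -leqNgt; exact: h.
Qed.

Lemma fsum_pos N (F : nat -> U) : (forall i, (N < i)%N -> F i = 0) ->
  \sum_(i \in [set n : nat | (0 < n)%N]) F i = \sum_(i < N) F i.+1.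
Proof.
move=> h; rewrite (@fsbigE _ _ _ _ _ (iota 1 N)) ?iota_uniq //.
- rewrite big_mkcond big_seq_cond /=.
  transitivity (\sum_(i <- iota 1 N) F i).
    rewrite [RHS]big_seq_cond; apply: eq_bigr => i; rewrite andbT mem_iota => /andP[i0 _].
    by rewrite ifT // inE.
  have -> : iota 1 N = index_iota 1 N.+1 by rewrite /index_iota subSS subn0.
  by rewrite big_add1 /= big_mkord.
- by move=> i /=; rewrite mem_iota => /andP[].
move=> i /= i0; rewrite mem_iota add1n i0 /= -leqNgt => hi; exact: h.
Qed.

Lemma fsum_int (a : int) N (F : int -> U) :
  (forall n, ~~ ((a <= n) && (n < a + N%:Z)) -> F n = 0) ->
  \sum_(i \in [set: int]) F i = \sum_(i < N) F (a + i%:Z).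
Proof.
move=> h; rewrite (@fsum_seq _ [seq a + i%:Z | i <- iota 0 N]).
- by rewrite big_map iota0E big_mkord.
- by rewrite map_inj_uniq ?iota_uniq // => i j /addrI [].
move=> n hn; apply: h; apply: contra hn => /andP[h1 h2].
apply/mapP; exists `|(n - a)%R|%N; last by lia.
by rewrite mem_iota; lia.
Qed.

Lemma fsum_half (a : int) N (F : int -> U) :
  (forall j : nat, (N <= j)%N -> F (a + j%:Z) = 0) ->
  \sum_(i \in [set m : int | a <= m]) F i = \sum_(i < N) F (a + i%:Z).
Proof.
move=> h; rewrite (@fsbigE _ _ _ _ _ ([seq a + i%:Z | i <- iota 0 N])).
- rewrite big_map big_mkcond iota0E big_mkord.
  by apply: eq_bigr => i _; rewrite ifT // inE /=; lia.
- by rewrite map_inj_uniq ?iota_uniq // => i j /addrI [].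
- by move=> i /= /mapP[j _ ->]; lia.
move=> n /= an hn.
have -> : n = a + `|(n - a)%R|%N%:Z by lia.
apply: h; rewrite leqNgt; apply: contra hn => h1.
by apply/mapP; exists `|(n - a)%R|%N; [rewrite mem_iota; lia | lia].
Qed.

End FiniteSupportSums.

Section DiagonalizableOperators.
Context {K : realType}.
Local Notation C := K[i].
Context {V : lmodType C}.
Implicit Types (A : V -> V) (u v w : V) (d : C -> V) (l : V -> C).

(** Linearity as a plain predicate: the operators at hand are functions given by modes and choices. *)
Definition islin A := forall (a : C) u v, A (a *: u + v) = a *: A u + A v.
Definition islinf l := forall (a : C) u v, l (a *: u + v) = a * l u + l v.

Lemma islinD A : islin A -> forall u v, A (u + v) = A u + A v.
Proof. by move=> h u v; have := h 1 u v; rewrite !scale1r. Qed.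
Lemma islin0 A : islin A -> A 0 = 0.
Proof.
move=> h; have := islinD h 0 0; rewrite addr0 => /eqP.
by rewrite -subr_eq subrr eq_sym => /eqP.
Qed.
Lemma islinZ A : islin A -> forall a u, A (a *: u) = a *: A u.
Proof. by move=> h a u; have := h a u 0; rewrite !addr0 islin0 // addr0. Qed.
Lemma islinN A : islin A -> forall u, A (- u) = - A u.
Proof. by move=> h u; rewrite -scaleN1r islinZ // scaleN1r. Qed.
Lemma islinB A : islin A -> forall u v, A (u - v) = A u - A v.
Proof. by move=> h u v; rewrite islinD // islinN. Qed.
Lemma islin_sum A : islin A -> forall (I : Type) (r : seq I) (P : pred I) (F : I -> V),
  A (\sum_(i <- r | P i) F i) = \sum_(i <- r | P i) A (F i).
Proof. by move=> h I r P F; apply: (big_morph A (islinD h) (islin0 h)). Qed.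
Lemma islin_comp A B : islin A -> islin B -> islin (A \o B).
Proof. by move=> hA hB a u v /=; rewrite hB hA. Qed.
Lemma islin_iter A k : islin A -> islin (iter k A).
Proof. by move=> h; elim: k => [|k IH] a u v //=; rewrite IH h. Qed.

Lemma islinfD l : islinf l -> forall u v, l (u + v) = l u + l v.
Proof. by move=> h u v; have := h 1 u v; rewrite !scale1r mul1r. Qed.
Lemma islinf0 l : islinf l -> l 0 = 0.
Proof.
move=> h; have := islinfD h 0 0; rewrite addr0 => /eqP.
by rewrite -subr_eq subrr eq_sym => /eqP.
Qed.
Lemma islinfZ l : islinf l -> forall a u, l (a *: u) = a * l u.
Proof. by move=> h a u; have := h a u 0; rewrite !addr0 islinf0 // addr0. Qed.
Lemma islinfN l : islinf l -> forall u, l (- u) = - l u.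
Proof. by move=> h u; rewrite -scaleN1r islinfZ // mulN1r. Qed.
Lemma islinf_sum l : islinf l -> forall (I : Type) (r : seq I) (P : pred I) (F : I -> V),
  l (\sum_(i <- r | P i) F i) = \sum_(i <- r | P i) l (F i).
Proof. by move=> h I r P F; apply: (big_morph l (islinfD h) (islinf0 h)). Qed.

(** Apply A - a for the first eigenvalue a. *)
Lemma eigen_free A (r : seq C) (w : C -> V) : islin A -> uniq r ->
  (forall a, a \in r -> A (w a) = a *: w a) -> \sum_(a <- r) w a = 0 ->
  forall a, a \in r -> w a = 0.
Proof.
move=> hA; elim: r w => // b r IH w /= /andP[br ur] hw.
rewrite big_cons => s0.
have w0 a : a \in r -> w a = 0.
  move=> ar; have ab : a - b != 0.
    by rewrite subr_eq0; apply: contraNneq br => <-.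
  have: (a - b) *: w a = 0.
    apply: (IH (fun a => (a - b) *: w a)) => // [c cr|].
      by rewrite islinZ // hw ?inE ?cr ?orbT // !scalerA mulrC.
    have := congr1 A s0; rewrite islinD // islin0 // hw ?inE ?eqxx // islin_sum //.
    have := congr1 (fun x => b *: x) s0; rewrite /= scaler0 scalerDr => e1 e2.
    have : \sum_(i <- r) A (w i) - b *: \sum_(j <- r) w j = 0.
      move: e1 e2 => /eqP; rewrite addrC addr_eq0 => /eqP -> /eqP.
      by rewrite addrC addr_eq0 => /eqP ->; rewrite subrr.
    rewrite scaler_sumr -sumrB => e; rewrite -[RHS]e !big_seq.
    by apply: eq_bigr => c cr; rewrite scalerBl hw // inE cr orbT.
  by move/eqP; rewrite scaler_eq0 (negPf ab) => /eqP.
move=> a; rewrite inE => /predU1P[->|]; last exact: w0.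
by move: s0; rewrite big_seq big1 ?addr0.
Qed.

(** The vector is a finite sum of eigenvectors, so that [eigcomp] and [opfun] are meaningful on it. *)
Definition hasdec A v := exists d, eigdecomp A v d.

Lemma eigdecomp_seq A v d : eigdecomp A v d ->
  exists2 r : seq C, uniq r & (forall a, a \notin r -> d a = 0).
Proof.
move=> [/finite_seqP [s hs] _ _]; exists (undup s); first exact: undup_uniq.
move=> a; rewrite mem_undup => /negP h; apply: contrapT => da; apply: h.
by have : [set` s] a by rewrite -hs.
Qed.

Lemma eigdecomp_sum A v d (r : seq C) : eigdecomp A v d -> uniq r ->
  (forall a, a \notin r -> d a = 0) -> v = \sum_(a <- r) d a.
Proof. by move=> [_ _ {1}->] ur h; exact: fsum_seq. Qed.

Lemma eigdecompI A v d (r : seq C) : uniq r -> (forall a, a \notin r -> d a = 0) ->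
  (forall a, A (d a) = a *: d a) -> v = \sum_(a <- r) d a -> eigdecomp A v d.
Proof.
move=> ur h hA ->; split=> //; last by rewrite (fsum_seq ur).
apply: (@sub_finite_set _ _ [set` r]); last exact: finite_seq.
by move=> a /= da; apply: contrapT => /negP /h.
Qed.

Lemma two_supports A u v d d' : eigdecomp A u d -> eigdecomp A v d' ->
  exists2 r : seq C, uniq r &
    (forall a, a \notin r -> d a = 0) /\ (forall a, a \notin r -> d' a = 0).
Proof.
move=> /eigdecomp_seq [r1 _ h1] /eigdecomp_seq [r2 _ h2].
exists (undup (r1 ++ r2)); first exact: undup_uniq.
by split=> a; rewrite mem_undup mem_cat negb_or => /andP[a1 a2]; [apply: h1|apply: h2].
Qed.

Lemma eigdecomp_uniq A v d d' : islin A -> eigdecomp A v d -> eigdecomp A v d' -> d = d'.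
Proof.
move=> hA h h'; have [r ur [z z']] := two_supports h h'.
apply/funext => a; have [ar|ar] := boolP (a \in r); last by rewrite z // z'.
apply/eqP; rewrite -subr_eq0; apply/eqP.
apply: (eigen_free (w := fun a => d a - d' a) hA ur) => // [b _|].
  by have [_ e _] := h; have [_ e' _] := h'; rewrite islinB // e e' scalerBr.
by rewrite sumrB -(eigdecomp_sum h ur z) -(eigdecomp_sum h' ur z') subrr.
Qed.

Lemma eigcompP A v : hasdec A v -> eigdecomp A v (eigcomp A v).
Proof. by move=> h; exact: (xgetPex (fun=> 0) h). Qed.

Lemma eigcompE A v d : islin A -> eigdecomp A v d -> eigcomp A v = d.
Proof.
move=> hA h; apply: (eigdecomp_uniq hA _ h); apply: eigcompP; by exists d.
Qed.

Lemma eigdecomp_lin A (c : C) u v d d' : islin A -> eigdecomp A u d -> eigdecomp A v d' ->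
  eigdecomp A (c *: u + v) (fun a => c *: d a + d' a).
Proof.
move=> hA h h'; have [r ur [z z']] := two_supports h h'.
apply: (eigdecompI ur) => [a ar|a|].
- by rewrite z // z' // scaler0 addr0.
- have [_ e _] := h; have [_ e' _] := h'.
  by rewrite islinD // islinZ // e e' scalerDr !scalerA mulrC.
- by rewrite big_split /= -scaler_sumr -(eigdecomp_sum h ur z) -(eigdecomp_sum h' ur z').
Qed.

Lemma hasdec_lin A (c : C) u v : islin A -> hasdec A u -> hasdec A v -> hasdec A (c *: u + v).
Proof. by move=> hA [d h] [d' h']; eexists; exact: eigdecomp_lin h h'. Qed.

Lemma eigdecomp_eigen A v (a : C) : islin A -> A v = a *: v ->
  eigdecomp A v (fun b => if b == a then v else 0).
Proof.
move=> hA h; apply: (@eigdecompI _ _ _ [:: a]) => // [b|b|].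
- by rewrite inE => /negPf ->.
- by case: eqP => [->|_] //; rewrite islin0 // scaler0.
- by rewrite big_seq1 eqxx.
Qed.

Lemma hasdec_eigen A v (a : C) : islin A -> A v = a *: v -> hasdec A v.
Proof. by move=> hA h; eexists; exact: eigdecomp_eigen h. Qed.

Lemma hasdec0 A : islin A -> hasdec A 0.
Proof. by move=> hA; apply: (@hasdec_eigen _ _ 0) => //; rewrite islin0 // scaler0. Qed.

Lemma hasdec_sum A (I : Type) (r : seq I) (P : pred I) (F : I -> V) : islin A ->
  (forall i, P i -> hasdec A (F i)) -> hasdec A (\sum_(i <- r | P i) F i).
Proof.
move=> hA h; elim/big_rec : _ => [|i v Pi hv]; first exact: hasdec0.
by rewrite -[F i]scale1r; apply: hasdec_lin => //; exact: h.
Qed.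

Lemma eigcomp_lin A (c : C) u v a : islin A -> hasdec A u -> hasdec A v ->
  eigcomp A (c *: u + v) a = c *: eigcomp A u a + eigcomp A v a.
Proof.
move=> hA hu hv.
by rewrite (eigcompE hA (eigdecomp_lin c hA (eigcompP hu) (eigcompP hv))).
Qed.

Lemma eigcomp_eigen A v a b : islin A -> A v = a *: v ->
  eigcomp A v b = if b == a then v else 0.
Proof. by move=> hA h; rewrite (eigcompE hA (eigdecomp_eigen hA h)). Qed.

Lemma eigcomp_espace A v a : hasdec A v -> A (eigcomp A v a) = a *: eigcomp A v a.
Proof. by move=> /eigcompP [_ h _]; exact: h. Qed.

Lemma opfun_seq (f : C -> C) A v d (r : seq C) : islin A -> eigdecomp A v d -> uniq r ->
  (forall a, a \notin r -> d a = 0) -> opfun f A v = \sum_(a <- r) f a *: d a.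
Proof.
move=> hA h ur z; rewrite /opfun (eigcompE hA h); apply: fsum_seq => // a ar.
by rewrite z // scaler0.
Qed.

Lemma opfun_lin (f : C -> C) A (c : C) u v : islin A -> hasdec A u -> hasdec A v ->
  opfun f A (c *: u + v) = c *: opfun f A u + opfun f A v.
Proof.
move=> hA [d h] [d' h']; have [r ur [z z']] := two_supports h h'.
rewrite (opfun_seq f hA h ur z) (opfun_seq f hA h' ur z').
rewrite (opfun_seq f hA (eigdecomp_lin c hA h h') ur) => [|a ar]; last first.
  by rewrite z // z' // scaler0 addr0.
rewrite scaler_sumr -big_split /=; apply: eq_bigr => a _.
by rewrite scalerDr !scalerA mulrC.
Qed.

Lemma opfun_eigen (f : C -> C) A v a : islin A -> A v = a *: v -> opfun f A v = f a *: v.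
Proof.
move=> hA h; rewrite (@opfun_seq f A v _ [:: a] hA (eigdecomp_eigen hA h)) ?big_seq1 ?eqxx //.
by move=> b; rewrite inE => /negPf ->.
Qed.

(** A left eigenvector annihilates the other right eigenspaces. *)
Lemma left_eigen_comp A l v a b : islin A -> islinf l -> (forall u, l (A u) = a * l u) ->
  hasdec A v -> l (eigcomp A v b) = if b == a then l v else 0.
Proof.
move=> hA hl h hv.
have z c : c != a -> l (eigcomp A v c) = 0.
  move=> ca; have := h (eigcomp A v c).
  rewrite eigcomp_espace // islinfZ // => /eqP; rewrite -subr_eq0 -mulrBl mulf_eq0.
  by rewrite subr_eq0 (negPf ca) => /eqP.
have [ba|/z //] := eqVneq b a; rewrite {}ba.
have hd := eigcompP hv; have [r ur zr] := eigdecomp_seq hd.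
rewrite [in RHS](eigdecomp_sum hd ur zr) islinf_sum //.
have [ar|ar] := boolP (a \in r).
  rewrite (bigD1_seq a) //= big1 ?addr0 // => c ca; exact: z.
rewrite zr // islinf0 // big_seq big1 // => c cr; apply: z.
by apply: contraNneq ar => <-.
Qed.

Lemma left_eigen_opfun (f : C -> C) A l v a : islin A -> islinf l ->
  (forall u, l (A u) = a * l u) -> hasdec A v -> l (opfun f A v) = f a * l v.
Proof.
move=> hA hl h hv.
have hd := eigcompP hv; have [r ur zr] := eigdecomp_seq hd.
rewrite (opfun_seq f hA hd ur zr) islinf_sum //.
rewrite [in RHS](eigdecomp_sum hd ur zr) islinf_sum // mulr_sumr; apply: eq_bigr => b _.
rewrite islinfZ // (left_eigen_comp _ hA hl h hv).
by case: eqP => [->|]; rewrite ?mulr0.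
Qed.

Lemma iter_lin0 A k m v : islin A -> (k <= m)%N -> iter k A v = 0 -> iter m A v = 0.
Proof.
move=> hA km h; rewrite -(subnK km) iterD h.
by rewrite (islin0 (islin_iter _ hA)).
Qed.

Lemma expnilE A v N : islin A -> iter N A v = 0 ->
  expnil A v = \sum_(k < N) (k`!%:R)^-1 *: iter k A v.
Proof.
move=> hA h; rewrite /expnil (@fsum_nat _ N) // => i Ni.
by rewrite (iter_lin0 hA Ni h) scaler0.
Qed.

Lemma expnil_lin A (c : C) u v N M : islin A -> iter N A u = 0 -> iter M A v = 0 ->
  expnil A (c *: u + v) = c *: expnil A u + expnil A v.
Proof.
move=> hA hu hv.
have hu' : iter (N + M) A u = 0 by apply: iter_lin0 hu => //; exact: leq_addr.
have hv' : iter (N + M) A v = 0 by apply: iter_lin0 hv => //; exact: leq_addl.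
rewrite (expnilE hA hu') (expnilE hA hv') (@expnilE A _ (N + M)) //; last first.
  by rewrite (islin_iter _ hA) hu' hv' scaler0 addr0.
rewrite scaler_sumr -big_split /=; apply: eq_bigr => k _.
by rewrite (islin_iter _ hA) scalerDr !scalerA mulrC.
Qed.

Lemma lspan_sub n (b : 'I_n -> V) i : lspan b (b i).
Proof.
exists (fun j => (j == i)%:R); rewrite (bigD1 i) //= eqxx scale1r big1 ?addr0 // => j /negPf ->.
by rewrite scale0r.
Qed.

(** tr(Q M P) = tr(M) when the change-of-basis matrices P and Q are inverse to each other. *)
Lemma ftrace_basis_change n n' (b : 'I_n -> V) (b' : 'I_n' -> V) (M : 'M[C]_n) (M' : 'M[C]_n')
    (T : V -> V) :
  lfree b -> lfree b' -> lspan b = lspan b' ->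
  (forall c : 'I_n -> C, T (\sum_i c i *: b i) = \sum_i c i *: T (b i)) ->
  (forall j, T (b j) = \sum_i M i j *: b i) ->
  (forall j, T (b' j) = \sum_i M' i j *: b' i) -> \tr M = \tr M'.
Proof.
move=> fb fb' bb' linT hM hM'.
have /choice [p hp] : forall j, exists c : 'I_n -> C, b' j = \sum_i c i *: b i.
  by move=> j; have := lspan_sub b' j; rewrite -bb'.
have /choice [q hq] : forall j, exists c : 'I_n' -> C, b j = \sum_i c i *: b' i.
  by move=> j; have := lspan_sub b j; rewrite bb'.
pose P := \matrix_(i, j) p j i : 'M[C]_(n, n'); pose Q := \matrix_(i, j) q j i : 'M[C]_(n', n).
have hP j : b' j = \sum_i P i j *: b i by rewrite hp; apply: eq_bigr => i _; rewrite mxE.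
have hQ j : b j = \sum_i Q i j *: b' i by rewrite hq; apply: eq_bigr => i _; rewrite mxE.
have free_eq m (e : 'I_m -> V) (c c' : 'I_m -> C) : lfree e ->
    \sum_i c i *: e i = \sum_i c' i *: e i -> forall i, c i = c' i.
  move=> fe /eqP; rewrite -subr_eq0 -sumrB => /eqP h i.
  apply/eqP; rewrite -subr_eq0; apply/eqP; apply: (fe (fun i => c i - c' i)).
  by rewrite -[RHS]h; apply: eq_bigr => j _; rewrite scalerBl.
have comp m m' m'' (e : 'I_m'' -> V) (X : 'M[C]_(m'', m')) (Y : 'M[C]_(m', m)) j :
    \sum_i Y i j *: \sum_k X k i *: e k = \sum_k (X *m Y) k j *: e k.
  under eq_bigr do rewrite scaler_sumr.
  rewrite exchange_big /=; apply: eq_bigr => k _; rewrite mxE scaler_suml.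
  by apply: eq_bigr => i _; rewrite scalerA mulrC.
have QP : Q *m P = 1%:M.
  apply/matrixP => i j; apply: (free_eq _ _ (fun i => (Q *m P) i j) (fun i => (1%:M : 'M[C]_n') i j) fb').
  rewrite -comp; under eq_bigr do rewrite -hQ.
  rewrite -hP (bigD1 j) //= mxE eqxx scale1r big1 ?addr0 // => k /negPf kj.
  by rewrite mxE kj scale0r.
have MP : M *m P = P *m M'.
  apply/matrixP => i j; apply: (free_eq _ _ (fun i => (M *m P) i j) (fun i => (P *m M') i j) fb).
  rewrite -!comp; under [RHS]eq_bigr do rewrite -hP.
  rewrite -hM' hP linT; apply: eq_bigr => k _; by rewrite -hM.
have -> : M' = Q *m (M *m P) by rewrite MP mulmxA QP mul1mx.
rewrite mxtrace_mulC -mulmxA.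
have -> : P *m Q = 1%:M.
  apply/matrixP => i j; apply: (free_eq _ _ (fun i => (P *m Q) i j) (fun i => (1%:M : 'M[C]_n) i j) fb).
  rewrite -comp; under eq_bigr do rewrite -hP.
  rewrite -hQ (bigD1 j) //= mxE eqxx scale1r big1 ?addr0 // => k /negPf kj.
  by rewrite mxE kj scale0r.
by rewrite mulmx1.
Qed.

Lemma ftraceE n (b : 'I_n -> V) (M : 'M[C]_n) (W : set V) (T : V -> V) :
  lfree b -> W = lspan b ->
  (forall (c : 'I_n -> C), T (\sum_i c i *: b i) = \sum_i c i *: T (b i)) ->
  (forall j, T (b j) = \sum_i M i j *: b i) -> ftrace W T = \tr M.
Proof.
move=> fb Wb linT hM; rewrite /ftrace.
set S := [set t | _]; have : S (xget 0 S) by apply: (xgetPex 0); exists (\tr M), n, b, M.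
move=> [n' [b' [M' [fb' Wb' hM' ->]]]]; apply/esym.
by apply: (ftrace_basis_change fb fb' _ linT hM hM'); rewrite -Wb.
Qed.

(** The trace is a sum of diagonal entries, read off by dual functionals without writing a matrix. *)
Lemma ftrace_dual (I : finType) (P : pred I) (b : I -> V) (l : I -> V -> C) (W : set V)
    (T : V -> V) :
  (forall i, islinf (l i)) ->
  (forall i j, P i -> P j -> l i (b j) = (i == j)%:R) ->
  (forall v, W v <-> exists c : I -> C, v = \sum_(i | P i) c i *: b i) ->
  (forall c : I -> C, T (\sum_(i | P i) c i *: b i) = \sum_(i | P i) c i *: T (b i)) ->
  (forall i, P i -> W (T (b i))) ->
  ftrace W T = \sum_(i | P i) l i (T (b i)).
Proof.
move=> hl lb hW linT hT.
have reE (U : zmodType) (F : I -> U) :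
    \sum_(i | P i) F i = \sum_(k < #|P|) F (enum_val k).
  exact: (big_enum_val (A := P) F).
pose e (k : 'I_#|P|) := b (enum_val k).
have Pe (k : 'I_#|P|) : P (enum_val k) by have := enum_valP k.
have le i (c : I -> C) : P i -> l i (\sum_(j | P j) c j *: b j) = c i.
  move=> Pi; rewrite islinf_sum // (bigD1 i) //= islinfZ // lb // eqxx mulr1.
  rewrite big1 ?addr0 // => j /andP[Pj /negPf ji]; rewrite islinfZ // lb // eq_sym ji mulr0 //.
pose ext (c : 'I_#|P| -> C) (i : I) : C :=
  \sum_(k < #|P| | enum_val k == i) c k.
have extE c k : ext c (enum_val k) = c k.
  by rewrite /ext (big_pred1 k) // => j; rewrite /= (inj_eq enum_val_inj).
have sumE c : \sum_k c k *: e k = \sum_(i | P i) ext c i *: b i.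
  by rewrite reE; apply: eq_bigr => k _; rewrite extE.
pose M : 'M[C]_#|P| := \matrix_(k, m) l (enum_val k) (T (e m)).
rewrite reE (@ftraceE _ e M).
- by rewrite /mxtrace; apply: eq_bigr => k _; rewrite mxE.
- move=> c; rewrite sumE => h k.
  by have := le (enum_val k) (ext c) (Pe k); rewrite h islinf0 // extE.
- apply/seteqP; split => v.
    by move=> /hW [c ->]; exists (fun k => c (enum_val k)); rewrite reE.
  by move=> [c ->]; apply/hW; exists (ext c); exact: sumE.
- move=> c; rewrite sumE linT reE; apply: eq_bigr => k _; by rewrite extE.
move=> m; have /hW [c hc] := hT _ (Pe m).
rewrite {1}/e hc reE; apply: eq_bigr => k _; congr (_ *: _).
by rewrite mxE /e hc le.
Qed.

End DiagonalizableOperators.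

(** * Mode calculus *)

Section ModeCalculus.
Context {K : realType} {V : vosa K}.
Local Notation C := K[i].
Implicit Types (u v w : V) (m n l : int) (p : bool).
Let HV := vosaP V.

Lemma vmode_lin u n : islin (vmode u n).
Proof. by move=> a v w; exact: (vosa_linr HV). Qed.
Lemma vmode_linl n w : islin (fun u => vmode u n w).
Proof. by move=> a u v; exact: (vosa_linl HV). Qed.
Lemma L0_lin : islin (@L0 K V). Proof. exact: vmode_lin. Qed.

Lemma vmode0 u n : vmode u n 0 = 0 :> V. Proof. exact: islin0 (vmode_lin u n). Qed.
Lemma vmode0l n w : vmode 0 n w = 0 :> V. Proof. exact: islin0 (vmode_linl n w). Qed.

Lemma par0 p : vpar p (0 : V).
Proof.
have [v0 [v1 [h0 h1 _]]] := vosa_par_dec HV 0.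
case: p; [have := vosa_par_lin HV (-1) h1 h1 | have := vosa_par_lin HV (-1) h0 h0];
  by rewrite scaleN1r addNr.
Qed.
Lemma par_lin p (a : C) u v : vpar p u -> vpar p v -> vpar p (a *: u + v).
Proof. exact: (vosa_par_lin HV). Qed.
Lemma parD p u v : vpar p u -> vpar p v -> vpar p (u + v).
Proof. by move=> hu hv; rewrite -[u]scale1r; exact: par_lin. Qed.
Lemma parZ p (a : C) u : vpar p u -> vpar p (a *: u).
Proof. by move=> hu; rewrite -[_ *: _]addr0; apply: par_lin => //; exact: par0. Qed.
Lemma par_sum p (I : Type) (r : seq I) (P : pred I) (F : I -> V) :
  (forall i, P i -> vpar p (F i)) -> vpar p (\sum_(i <- r | P i) F i).
Proof.
by move=> h; elim/big_rec : _ => [|i v Pi hv]; [exact: par0 | apply: parD => //; exact: h].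
Qed.
Lemma par_mode p p' u v n : vpar p u -> vpar p' v -> vpar (p (+) p') (vmode u n v).
Proof. exact: (vosa_par_mode HV). Qed.

Lemma trunc_from u v (a : int) : exists N : nat, forall j : nat, (N <= j)%N ->
  vmode u (a + j%:Z) v = 0.
Proof.
have [N hN] := vosa_trunc HV u v; exists (`|N| + `|a|)%N => j hj; apply: hN; lia.
Qed.

Lemma gbin_nat_gt (n j : nat) : (n < j)%N -> @gbin K n%:R j = 0.
Proof. by move=> h; rewrite gbin_nat bin_small. Qed.

(** The Jacobi identity with l = 0. *)
Lemma commutator_formula p p' u v m n w N : vpar p u -> vpar p' v ->
  (forall j, (N <= j)%N -> @gbin K m%:~R j *: vmode (vmode u j%:Z v) (m + n - j%:Z) w = 0) ->
  vmode u m (vmode v n w) - ((-1) ^+ (p && p')) *: vmode v n (vmode u m w)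
  = \sum_(j < N) @gbin K m%:~R j *: vmode (vmode u j%:Z v) (m + n - j%:Z) w.
Proof.
move=> pu pv h; have := vosa_borcherds HV 0 m n w pu pv.
rewrite (fsum_nat (N := N)); last by move=> j hj; rewrite binzE add0r h.
rewrite (fsum_nat (N := 1)); last first.
  move=> j hj; rewrite binzE (_ : 0%:~R = 0%:R :> C) // gbin_nat_gt // mulr0 scale0r //.
rewrite big_ord1 binzE gbin0 expr0 mulr1 scale1r expr0z mul1r.
rewrite (_ : m + 0 - _ = m); last by rewrite /=; lia.
rewrite (_ : n + 0 - _ = n); last by rewrite /=; lia.
rewrite (_ : n + (ord0 : 'I_1)%:Z = n); last by rewrite /=; lia.
rewrite (_ : m + (ord0 : 'I_1)%:Z = m); last by rewrite /=; lia.
move=> <-.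
by apply: eq_bigr => j _; rewrite add0r.
Qed.

(** The Jacobi identity with m = 0. *)
Lemma iterate_formula p p' u v l n w N : vpar p u -> vpar p' v ->
  (forall j : nat, (N <= j)%N -> vmode v (n + j%:Z) w = 0) ->
  (forall j : nat, (N <= j)%N -> vmode u j%:Z w = 0) ->
  vmode (vmode u l v) n w = \sum_(j < N) ((-1) ^+ j * @gbin K l%:~R j) *:
     (vmode u (l - j%:Z) (vmode v (n + j%:Z) w)
      - ((-1) ^ l * (-1) ^+ (p && p')) *: vmode v (n + l - j%:Z) (vmode u j%:Z w)).
Proof.
move=> pu pv h1 h2; have := vosa_borcherds HV l 0 n w pu pv.
rewrite (fsum_nat (N := 1)); last first.
  move=> j hj; rewrite binzE (_ : 0%:~R = 0%:R :> C) // gbin_nat_gt // scale0r //.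
rewrite big_ord1 binzE gbin0 scale1r addr0 add0r subr0 => ->.
rewrite (fsum_nat (N := N)); last first.
  by move=> j hj; rewrite h1 // add0r h2 // !vmode0 scaler0 subr0 scaler0.
by apply: eq_bigr => j _; rewrite !add0r.
Qed.

(** The commutator formula with omega, where omega(0) is the translation operator. *)
Lemma L0_mode p u (a : C) n w : vpar p u -> L0 u = a *: u ->
  L0 (vmode u n w) = vmode u n (L0 w) + (a - n%:~R - 1) *: vmode u n w.
Proof.
move=> pu hu.
have := @commutator_formula false p omega u 1 n w 2 (vosa_par_om HV) pu.
rewrite scale1r => /(_ _)/eqP; rewrite subr_eq => e; rewrite [LHS]/L0 (eqP (e _)).
  have sum2 (F : nat -> V) : \sum_(j < 2) F j = F 0%N + F 1%N.
    by rewrite big_ord_recl big_ord1.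
  rewrite addrC (sum2 (fun j => @gbin K 1%:~R j *: vmode (vmode omega j%:Z u) (1 + n - j%:Z) w)).
  congr (_ + _); rewrite gbinS gbin0 subr0 mul1r divr1 !scale1r.
  rewrite (vosa_translation HV) -/(L0 u) hu (islinZ (vmode_linl _ _)).
  have en : 1 + n - 1 = n by lia.
  rewrite -[1%N%:Z]/(1 : int) en scalerA.
  by rewrite -scalerDl; congr (_ *: _); rewrite rmorphN rmorphD /=; ring.
by move=> j hj; rewrite (_ : 1%:~R = 1%:R :> C) // gbin_nat_gt // scale0r.
Qed.

Lemma hasdec_L0 v : hasdec (@L0 K V) v.
Proof. by have [d [h _]] := vosa_grading HV v; exists d. Qed.

Lemma L0_vac : L0 (vac : V) = 0.
Proof. by have [_ h] := vosa_creation HV (omega : V); exact: h. Qed.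

End ModeCalculus.

(** * The fermionic Fock space *)

Section FockSpace.
Context {K : realType} {V : vosa K}.
Local Notation C := K[i].
Variable R : nat.
Variable psi : bool -> 'I_R -> V.
Hypothesis ff : free_fermions psi.
Let HV := vosaP V.
Implicit Types (u v w : V) (e : bool) (r s : 'I_R) (n : int).

Definition psim e r n : V -> V := vmode (psi e r) n.

Lemma psim_lin e r n : islin (psim e r n). Proof. exact: vmode_lin. Qed.

Lemma psim_anti e r e' s (m n : int) w :
  psim e r m (psim e' s n w) + psim e' s n (psim e r m w)
  = if [&& e != e', r == s & m == - n - 1] then w else 0.
Proof.
rewrite /psim; case: e e' => [] [] /=; rewrite ?(ff_same ff) //.
  by rewrite (ff_pm ff).
rewrite addrC (ff_pm ff) eq_sym; congr (if _ && _ then _ else _).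
by apply/eqP/eqP; lia.
Qed.

Lemma psim_vac e r n : 0 <= n -> psim e r n vac = 0.
Proof. by move=> h; have [_ H] := vosa_creation HV (psi e r); exact: H. Qed.

Lemma psi_creation e r : psim e r (-1) vac = psi e r.
Proof. by have [] := vosa_creation HV (psi e r). Qed.

(** The span of the words in the fermion modes on the vacuum, with the parity recorded: the
iterate formula is available for vectors of definite parity. *)
Inductive fock_span : bool -> V -> Prop :=
| fock_span_zero p : fock_span p 0
| fock_span_vac : fock_span false vac
| fock_span_psi e r n p v : fock_span p v -> fock_span (~~ p) (psim e r n v)
| fock_span_lin p a u v : fock_span p u -> fock_span p v -> fock_span p (a *: u + v).

Lemma fock_span_par p v : fock_span p v -> vpar p v.
Proof.
elim=> {p v} [p||e r n p v _ IH|p a u v _ hu _ hv].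
- exact: par0.
- exact: (vosa_par_vac HV).
- by have := par_mode n (ff_odd ff e r) IH; rewrite addTb.
- exact: par_lin.
Qed.

Lemma fock_spanD p u v : fock_span p u -> fock_span p v -> fock_span p (u + v).
Proof. by move=> hu hv; rewrite -[u]scale1r; exact: fock_span_lin. Qed.
Lemma fock_spanZ p (a : C) u : fock_span p u -> fock_span p (a *: u).
Proof. by move=> hu; rewrite -[_ *: _]addr0; apply: fock_span_lin => //; exact: fock_span_zero. Qed.
Lemma fock_span_sum p (I : Type) (l : seq I) (P : pred I) (F : I -> V) :
  (forall i, P i -> fock_span p (F i)) -> fock_span p (\sum_(i <- l | P i) F i).
Proof.
by move=> h; elim/big_rec : _ => [|i v Pi hv]; [exact: fock_span_zero | apply: fock_spanD => //; exact: h].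
Qed.

(** The iterate formula rewrites the modes of psi(n)u by modes of psi and of u. *)
Lemma fock_span_mode p u : fock_span p u -> forall p' v n, fock_span p' v -> fock_span (p (+) p') (vmode u n v).
Proof.
elim=> {p u} [p||e r m p u hu IH|p a u v _ hu _ hv] p' w n hw.
- by rewrite vmode0l; exact: fock_span_zero.
- by move: hw => h; rewrite (vosa_vac HV); case: ifP => _ //; exact: fock_span_zero.
- have [N1 h1] := trunc_from u w n; have [N2 h2] := trunc_from (psi e r) w 0.
  rewrite (@iterate_formula _ _ true p _ _ _ _ _ (maxn N1 N2) (ff_odd ff e r) (fock_span_par hu)).
  + apply: fock_span_sum => j _; apply: fock_spanZ; apply: fock_spanD.
      rewrite -addTb -addbA addTb; apply: fock_span_psi; exact: IH.
    rewrite -scaleN1r; do 2 apply: fock_spanZ.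
    rewrite addNb -addbN; apply: IH; exact: fock_span_psi.
  + by move=> j; rewrite geq_max => /andP[hj _]; exact: h1.
  + by move=> j; rewrite geq_max => /andP[_ hj]; rewrite -[j%:Z]add0r; exact: h2.
- rewrite (vmode_linl n w a u v); apply: fock_span_lin; [exact: hu | exact: hv].
Qed.

(** The generating property only speaks of all modes of all vectors; [fock_span_mode] shows that
words in the modes of the generators are enough. *)
Lemma fock_ind (P : V -> Prop) : P vac ->
  (forall a u v, P u -> P v -> P (a *: u + v)) ->
  (forall e r n v, P v -> P (psim e r n v)) -> forall v, P v.
Proof.
move=> Pvac Plin Ppsi.
have P0 : P 0 by rewrite -[0](addNr vac) -scaleN1r; exact: Plin.
have FP p v : fock_span p v -> P v.
  by elim=> {p v} // [e r n p v _ IH|p a u v _ hu _ hv]; [exact: Ppsi | exact: Plin].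
suff H v : exists u0 u1, [/\ fock_span false u0, fock_span true u1 & v = u0 + u1].
  move=> v; have [u0 [u1 [h0 h1 ->]]] := H v.
  by rewrite -[u0]scale1r; apply: Plin; [exact: FP h0 | exact: FP h1].
apply: (ff_gen ff (U := [set v | exists u0 u1, [/\ fock_span false u0, fock_span true u1 & v = u0 + u1]])).
- by exists vac, 0; rewrite addr0; split=> //; [exact: fock_span_vac | exact: fock_span_zero].
- move=> _ /= [e [r ->]]; exists 0, (psi e r); rewrite add0r; split=> //; first exact: fock_span_zero.
  by rewrite -psi_creation; apply: (@fock_span_psi _ _ _ false); exact: fock_span_vac.
- move=> a u u' /= [u0 [u1 [h0 h1 ->]]] [u0' [u1' [h0' h1' ->]]].
  exists (a *: u0 + u0'), (a *: u1 + u1'); split; [exact: fock_span_lin|exact: fock_span_lin|].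
  by rewrite scalerDr addrACA.
- move=> u n u' /= [u0 [u1 [h0 h1 ->]]] [u0' [u1' [h0' h1' ->]]].
  exists (vmode u0 n u0' + vmode u1 n u1'), (vmode u0 n u1' + vmode u1 n u0'); split.
  + by apply: fock_spanD; [exact: (fock_span_mode h0 n h0') | exact: (fock_span_mode h1 n h1')].
  + by apply: fock_spanD; [exact: (fock_span_mode h0 n h1') | exact: (fock_span_mode h1 n h0')].
  have E x y : vmode (u0 + u1) n (x + y) = vmode u0 n x + vmode u0 n y + (vmode u1 n x + vmode u1 n y).
    rewrite (islinD (vmode_linl n (x + y))).
    by rewrite !(islinD (vmode_lin _ _)).
  by rewrite E [vmode u1 n u0' + _]addrC addrACA.
Qed.

(** The triple (e, r, j) stands for the creation operator psi_r^e(-j-1), with e = true for the sign +. *)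
Definition mode := (bool * 'I_R * nat)%type.
Implicit Types (m : mode) (l : seq mode).
Definition cr m : V -> V := psim m.1.1 m.1.2 (- (m.2.+1)%:Z).
Definition an m : V -> V := psim (~~ m.1.1) m.1.2 m.2%:Z.

Lemma cr_lin m : islin (cr m). Proof. exact: psim_lin. Qed.
Lemma an_lin m : islin (an m). Proof. exact: psim_lin. Qed.

Lemma cr_cr m m' w : cr m (cr m' w) = - cr m' (cr m w).
Proof.
apply/eqP; rewrite -addr_eq0 /cr psim_anti; case: ifP => // /and3P[_ _ /eqP h].
exfalso; lia.
Qed.
Lemma an_an m m' w : an m (an m' w) = - an m' (an m w).
Proof.
apply/eqP; rewrite -addr_eq0 /an psim_anti; case: ifP => // /and3P[_ _ /eqP h].
exfalso; lia.
Qed.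
Lemma an_cr m m' w : an m (cr m' w) = (if m == m' then w else 0) - cr m' (an m w).
Proof.
apply/eqP; rewrite -subr_eq opprK /an /cr psim_anti.
case: m m' => [[e r] j] [[e' r'] j'] /=; rewrite !xpair_eqE.
have -> : (~~ e != e') = (e == e') by case: e e' => [] [].
have -> : (j%:Z == - - j'.+1%:Z - 1) = (j == j') by apply/eqP/eqP; lia.
by rewrite -andbA eqxx.
Qed.

Lemma eq_opp_eq0 (v : V) : v = - v -> v = 0.
Proof.
move=> h; have : 2%:R *: v = 0 by rewrite scaler_nat mulr2n {1}h addNr.
by move/eqP; rewrite scaler_eq0 pnatr_eq0 => /eqP.
Qed.
Lemma cr_cr0 m w : cr m (cr m w) = 0. Proof. apply: eq_opp_eq0; exact: cr_cr. Qed.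
Lemma an_an0 m w : an m (an m w) = 0. Proof. apply: eq_opp_eq0; exact: an_an. Qed.
Lemma an_vac m : an m vac = 0. Proof. exact: psim_vac. Qed.

Lemma psim_cr_an e r n : exists m, psim e r n = cr m \/ psim e r n = an m.
Proof.
case: n => n; first by exists (~~ e, r, n); right; rewrite /an /= negbK.
by exists (e, r, n); left.
Qed.

Lemma crE m : cr m = psim m.1.1 m.1.2 (- (m.2.+1)%:Z).
Proof. by []. Qed.
Lemma anE m : an m = psim (~~ m.1.1) m.1.2 m.2%:Z.
Proof. by []. Qed.

Definition mono l : V := foldr cr vac l.

Definition num m w := cr m (an m w).
Lemma numE m w : num m w = cr m (an m w).
Proof. by []. Qed.

Lemma num_cr m m' w : m != m' -> num m (cr m' w) = cr m' (num m w).
Proof.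
move=> /negPf h; rewrite /num an_cr h sub0r islinN; last exact: cr_lin.
by rewrite cr_cr opprK.
Qed.
Lemma an_num m m' w : m != m' -> an m' (num m w) = num m (an m' w).
Proof.
rewrite eq_sym => /negPf h; rewrite /num an_cr h sub0r -islinN; last exact: cr_lin.
by rewrite -an_an.
Qed.
Lemma an_num_id m w : an m (num m w) = an m w.
Proof. by rewrite /num an_cr eqxx an_an0 (islin0 (cr_lin _)) subr0. Qed.

Lemma an_notin m l : m \notin l -> an m (mono l) = 0.
Proof.
elim: l => [|m' l IH] /=; first by rewrite an_vac.
rewrite inE negb_or => /andP[/negPf h hl].
by rewrite an_cr h IH // (islin0 (cr_lin _)) subr0.
Qed.

Lemma num_mono m l : uniq l -> num m (mono l) = if m \in l then mono l else 0.
Proof.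
elim: l => [|m' l IH] /= ; first by rewrite /num an_vac (islin0 (cr_lin _)).
move=> /andP[ml ul]; rewrite inE; have [->|h] := eqVneq m m'.
  by rewrite /num an_cr eqxx an_notin // (islin0 (cr_lin _)) subr0.
by rewrite num_cr // IH //=; case: ifP => // _; rewrite (islin0 (cr_lin _)).
Qed.

(** Moving a creation operator to the front costs a sign. *)
Lemma mono_rem m l : m \in l -> exists b : bool, mono l = (-1) ^+ b *: mono (m :: rem m l).
Proof.
elim: l => // m' l IH; rewrite inE /=; have [->|h] := eqVneq m m'.
  by exists false; rewrite expr0 scale1r ?eqxx.
move=> /= /IH [b hb]; exists (~~ b); rewrite hb /=.
rewrite (islinZ (cr_lin _)) cr_cr scalerN; case: b {hb}; rewrite /= ?expr0 ?expr1 ?scaleN1r ?opprK ?scale1r //.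
Qed.

Lemma mono_nuniq l : ~~ uniq l -> mono l = 0.
Proof.
elim: l => //= m l IH; rewrite negb_and negbK => /orP[ml|/IH ->]; last by rewrite (islin0 (cr_lin _)).
have [b ->] := mono_rem ml.
by rewrite (islinZ (cr_lin _)) /= cr_cr0 scaler0.
Qed.

Lemma mono_perm l l' : perm_eq l l' -> exists b : bool, mono l = (-1) ^+ b *: mono l'.
Proof.
elim: l' l => [|m l' IH] l hp.
  have /nilP -> : nilp l by rewrite /nilp (perm_size hp).
  by exists false; rewrite expr0 scale1r.
have ml : m \in l by rewrite (perm_mem hp) inE eqxx.
have [b ->] := mono_rem ml.
have := perm_to_rem ml; rewrite perm_sym => /perm_trans /(_ hp); rewrite perm_cons => /IH [b' h].
exists (b (+) b') => /=; rewrite h (islinZ (cr_lin _)) scalerA signr_addb //.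
Qed.

(** By the anticommutation relations an annihilation operator sends a monomial to a sum of monomials. *)
Lemma span_mono v : exists t : seq (C * seq mode), v = \sum_(x <- t) x.1 *: mono x.2.
Proof.
pose P w := exists t : seq (C * seq mode), w = \sum_(x <- t) x.1 *: mono x.2.
have Pm l : P (mono l) by exists [:: (1, l)]; rewrite big_seq1 scale1r.
have Plin (a : C) u w : P u -> P w -> P (a *: u + w).
  move=> [t ->] [t' ->]; exists ([seq (a * x.1, x.2) | x <- t] ++ t').
  rewrite big_cat big_map /= scaler_sumr; congr (_ + _).
  by apply: eq_bigr => x _; rewrite scalerA.
have P0 : P 0 by exists [::]; rewrite big_nil.
have Psum (I : Type) (t : seq I) (F : I -> V) : (forall i, P (F i)) -> P (\sum_(i <- t) F i).
  move=> h; elim/big_rec : _ => // i w _ hw; rewrite -[F i]scale1r; exact: Plin.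
have PZ (a : C) u : P u -> P (a *: u).
  by move=> h; rewrite -[_ *: _]addr0; exact: Plin.
have ext (A : V -> V) : islin A -> (forall l, P (A (mono l))) -> forall w, P w -> P (A w).
  move=> hA h w [t ->]; rewrite islin_sum //; apply: Psum => x.
  by rewrite islinZ //; exact: PZ.
have Pcr m w : P w -> P (cr m w).
  by apply: ext; [exact: cr_lin | move=> l; exact: (Pm (m :: l))].
have Pan m w : P w -> P (an m w).
  apply: ext; first exact: an_lin.
  elim=> [|m' l IH]; first by rewrite an_vac.
  rewrite /= an_cr -scaleN1r addrC; apply: Plin; first exact: Pcr.
  by case: ifP.
suff H : P v by exact: H.
apply: fock_ind v => // [|e r n v hv]; first exact: (Pm [::]).
by have [m [->|->]] := psim_cr_an e r n; [exact: Pcr | exact: Pan].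
Qed.

(** Twice the L(0)-weight, which is an odd natural number. *)
Definition w2 m : nat := (m.2.*2.+1)%N.
Definition wt2 l : nat := sumn (map w2 l).

Lemma L0_psim e r n w :
  L0 (psim e r n w) = psim e r n (L0 w) + (- n%:~R - 2%:R^-1) *: psim e r n w.
Proof.
rewrite (L0_mode n w (ff_odd ff e r) (ff_weight ff e r)); congr (_ + _ *: _).
by field.
Qed.

Lemma w2E m : (w2 m)%:R / 2%:R = m.2%:R + 2%:R^-1 :> C.
Proof. by rewrite /w2 -natr1 -muln2 natrM; field. Qed.

Lemma L0_cr m w : L0 (cr m w) = cr m (L0 w) + ((w2 m)%:R / 2%:R) *: cr m w.
Proof.
rewrite /cr L0_psim w2E; congr (_ + _ *: _).
by rewrite rmorphN /= opprK -pmulrn -natr1; field.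
Qed.
Lemma L0_an m w : L0 (an m w) = an m (L0 w) - ((w2 m)%:R / 2%:R) *: an m w.
Proof. by rewrite /an L0_psim w2E -scaleNr opprD -pmulrn. Qed.

Lemma L0_mono l : L0 (mono l) = ((wt2 l)%:R / 2%:R) *: mono l.
Proof.
elim: l => [|m l IH]; first by rewrite L0_vac mul0r scale0r.
rewrite /= L0_cr IH (islinZ (cr_lin _)) -scalerDl /wt2 /= natrD; congr (_ *: _); ring.
Qed.

Lemma eigcomp_mono l (a : C) :
  eigcomp L0 (mono l) a = if a == (wt2 l)%:R / 2%:R then mono l else 0.
Proof. exact: (eigcomp_eigen _ L0_lin (L0_mono l)). Qed.

Lemma eigcomp_sum (T : Type) (t : seq T) (c : T -> C) (F : T -> V) (a : C) :
  eigcomp L0 (\sum_(x <- t) c x *: F x) a = \sum_(x <- t) c x *: eigcomp L0 (F x) a.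
Proof.
elim: t => [|x t IH]; last first.
  by rewrite !big_cons eigcomp_lin ?IH //; [exact: L0_lin | exact: hasdec_L0 | exact: hasdec_L0].
rewrite !big_nil (@eigcomp_eigen _ _ L0 0 0) ?if_same //; first exact: L0_lin.
by rewrite scaler0 (islin0 L0_lin).
Qed.

(** All nontrivial monomials have positive weight. *)
Lemma vac_coef v : exists c : C, eigcomp L0 v 0 = c *: vac.
Proof.
have [t ->] := span_mono v; rewrite eigcomp_sum.
exists (\sum_(x <- t) x.1 * (x.2 == [::])%:R); rewrite scaler_suml.
apply: eq_bigr => x _; rewrite -scalerA eigcomp_mono.
case: (x.2) => [|m l]; first by rewrite /= mul0r eqxx scale1r.
rewrite eq_sym (_ : _ == 0 = false) ?scale0r //.
by apply/negbTE; rewrite mulf_neq0 ?invr_eq0 ?pnatr_eq0 //.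
Qed.

Definition vaccoef v : C := xget 0 [set c | eigcomp L0 v 0 = c *: vac].

Lemma vaccoefP v : eigcomp L0 v 0 = vaccoef v *: vac.
Proof.
by have h : [set c | eigcomp L0 v 0 = c *: vac] (vaccoef v) by apply: (xgetPex 0); exact: vac_coef.
Qed.

Lemma vac_inj (a b : C) : a *: (vac : V) = b *: vac -> a = b.
Proof.
move=> /eqP; rewrite -subr_eq0 -scalerBl scaler_eq0 subr_eq0 => /orP[/eqP //|/eqP h].
by case: (vosa_vac_neq0 HV).
Qed.

Lemma vaccoef_linf : islinf vaccoef.
Proof.
move=> a u v; apply: vac_inj; rewrite -vaccoefP eigcomp_lin; last exact: hasdec_L0.
- by rewrite !vaccoefP scalerDl scalerA.
- exact: L0_lin.
- exact: hasdec_L0.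
Qed.

Lemma vaccoef_vac : vaccoef vac = 1.
Proof. by apply: vac_inj; rewrite -vaccoefP (eigcomp_mono [::]) mul0r eqxx scale1r. Qed.

Lemma vaccoef_cr m v : vaccoef (cr m v) = 0.
Proof.
have [t ->] := span_mono v; rewrite islin_sum; last exact: cr_lin.
rewrite islinf_sum; last exact: vaccoef_linf.
apply: big1 => x _; rewrite (islinZ (cr_lin _)) (islinfZ vaccoef_linf).
apply/eqP; rewrite mulf_eq0; apply/orP; right; apply/eqP/vac_inj.
rewrite -vaccoefP -[cr m _]/(mono (m :: x.2)) eigcomp_mono scale0r eq_sym.
by rewrite (_ : _ == 0 = false) //; apply/negbTE; rewrite mulf_neq0 ?invr_eq0 ?pnatr_eq0.
Qed.

Lemma vaccoef_L0 v : vaccoef (L0 v) = 0.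
Proof.
have [t ->] := span_mono v; rewrite islin_sum; last exact: L0_lin.
rewrite islinf_sum; last exact: vaccoef_linf.
apply: big1 => x _; rewrite (islinZ L0_lin) (islinfZ vaccoef_linf).
case: (x.2) => [|m l]; first by rewrite L0_vac (islinf0 vaccoef_linf) mulr0.
by rewrite L0_mono (islinfZ vaccoef_linf) /= vaccoef_cr !mulr0.
Qed.

(** Annihilate the modes of l one after the other and take the coefficient of the vacuum. *)
Definition dual l v : C := vaccoef (foldl (fun w m => an m w) v l).

Lemma dual_linf l : islinf (dual l).
Proof.
rewrite /dual => a u v; elim: l u v => [|m l IH] u v /=; first exact: vaccoef_linf.
by rewrite an_lin IH.
Qed.

Lemma dual_mono_id l : uniq l -> dual l (mono l) = 1.
Proof.
rewrite /dual; elim: l => [|m l IH] /=; first by rewrite vaccoef_vac.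
by move=> /andP[ml ul]; rewrite an_cr eqxx an_notin // (islin0 (cr_lin _)) subr0 IH.
Qed.

(** Number operators commute with the other annihilation operators, and an (cr an) = an on the same
mode. *)
Lemma dual_num m l v : dual l (num m v) = if m \in l then dual l v else 0.
Proof.
rewrite /dual; elim: l v => [|m' l IH] v /=; first by rewrite vaccoef_cr.
rewrite inE; have [->|h] := eqVneq m m'; first by rewrite an_num_id.
by rewrite an_num.
Qed.

(** The number operator of m has different eigenvalues on the two sides. *)
Lemma dual_mono_neq m l l' : uniq l' -> (m \in l) != (m \in l') -> dual l (mono l') = 0.
Proof.
move=> ul' h; have := dual_num m l (mono l'); rewrite num_mono //.
move: h; case: (m \in l) (m \in l') => [] [] //= _; first by rewrite (islinf0 (dual_linf l)).
Qed.

Lemma dual_L0 l v : dual l (L0 v) = (wt2 l)%:R / 2%:R * dual l v.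
Proof.
rewrite /dual; elim: l v => [|m l IH] v /=; first by rewrite vaccoef_L0 !mul0r.
have -> : an m (L0 v) = ((w2 m)%:R / 2%:R) *: an m v + L0 (an m v).
  by rewrite L0_an addrCA subrr addr0.
have := dual_linf l ((w2 m)%:R / 2%:R) (an m v) (L0 (an m v)); rewrite /dual => ->.
by rewrite IH -mulrDl /wt2 /= natrD; ring.
Qed.

End FockSpace.

(** * The current J and the Fock vectors *)

Section CurrentAction.
Context {K : realType} {V : vosa K}.
Local Notation C := K[i].
Variable R : nat.
Variable psi : bool -> 'I_R -> V.
Hypothesis ff : free_fermions psi.
Let HV := vosaP V.
Implicit Types (u v w : V) (e : bool) (r s : 'I_R) (n : int) (p : {poly C}).
Local Notation psim := (@psim K V R psi).
Local Notation cr := (@cr K V R psi).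
Local Notation an := (@an K V R psi).
Local Notation mono := (@mono K V R psi).
Local Notation J := (@Defs.J K V R psi).

Definition csgn e : C := if e then 1 else -1.

Lemma par_J : vpar false J.
Proof.
apply: par_sum => r _.
by have := par_mode (-1) (ff_odd ff true r) (ff_odd ff false r).
Qed.

Lemma gbinN1 j : (-1) ^+ j * @gbin K (-1)%:~R j = 1.
Proof.
have -> : (-1)%:~R = -1 :> C by rewrite rmorphN.
elim: j => [|j IH]; first by rewrite gbin0 expr0 mulr1.
rewrite gbinS exprS -[RHS]IH; field.
by rewrite natS_neq0C.
Qed.

Lemma sgn_int1 : (-1) ^ (-1 : int) * (-1) ^+ (true && true) = 1 :> C.
Proof. by rewrite -[(-1) ^ _]/((-1)^-1) invrN1 mulrNN mulr1. Qed.

Lemma psim_psi e r s e' (n : int) : 0 <= n ->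
  psim e r n (psi e' s) = if [&& e != e', r == s & n == 0] then vac else 0.
Proof.
move=> n0; rewrite -psi_creation.
have /eqP := psim_anti ff e r e' s n (-1) vac.
rewrite (psim_vac psi e r n0) (islin0 (psim_lin _ _ _ _)) addr0 => /eqP ->.
by congr (if [&& _, _ & _] then _ else _); apply/eqP/eqP; lia.
Qed.

Lemma J_mode_psi (j : nat) e s : vmode J j%:Z (psi e s) = if j == 0%N then csgn e *: psi e s else 0.
Proof.
rewrite /J (islin_sum (vmode_linl _ _)).
have E r : vmode (vmode (psi true r) (-1) (psi false r)) j%:Z (psi e s)
   = if (r == s) && (j == 0%N) then csgn e *: psi e s else 0.
  have [N1 h1] := trunc_from (psi false r) (psi e s) j%:Z.
  have [N2 h2] := trunc_from (psi true r) (psi e s) 0.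
  rewrite (@iterate_formula _ _ true true _ _ _ _ _ (maxn N1 N2).+1 (ff_odd ff _ _) (ff_odd ff _ _)).
  - rewrite big_ord_recl big1 ?addr0 => [|i _].
      rewrite gbin0 expr0 mulr1 scale1r sgn_int1 scale1r.
      rewrite -![vmode (psi _ _) _ _]/(psim _ _ _ _) psim_psi // psim_psi //.
      clear h1 h2; case: e => /=.
        rewrite (islin0 (psim_lin _ _ _ _)) subr0.
        case: (r =P s) => [->|_] /=; last by rewrite (islin0 (psim_lin _ _ _ _)).
        case: j => [|j] /=; last by rewrite (islin0 (psim_lin _ _ _ _)).
        by rewrite psi_creation scale1r.
      rewrite (islin0 (psim_lin _ _ _ _)) sub0r.
      case: (r =P s) => [->|_] /=; last by rewrite (islin0 (psim_lin _ _ _ _)) oppr0.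
      case: j => [|j] /=; last by rewrite psim_vac ?oppr0 //; lia.
      by rewrite psi_creation scaleN1r.
    rewrite -![vmode (psi _ _) _ _]/(psim _ _ _ _) psim_psi // psim_psi //.
    rewrite !ifF ?(islin0 (psim_lin _ _ _ _)) ?scaler0 ?subr0 ?scaler0 //.
      by apply/negbTE/negP => /and3P[_ _ /eqP]; rewrite /= /bump; lia.
    by apply/negbTE/negP => /and3P[_ _ /eqP]; rewrite /= /bump; lia.
  - by move=> i hi; apply: h1; lia.
  - by move=> i hi; rewrite -[i%:Z]add0r; apply: h2; lia.
under eq_bigr do rewrite E.
rewrite (bigD1 s) //= eqxx /= big1 ?addr0 // => r /negPf -> //.
Qed.

(** J(n) for n >= 0 is a derivation, and the only nonzero nonnegative mode of J on psi^e is J(0). *)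
Lemma J_comm (n : nat) e s (k : int) w :
  vmode J n%:Z (psim e s k w) = psim e s k (vmode J n%:Z w) + csgn e *: psim e s (n%:Z + k) w.
Proof.
have := @commutator_formula _ _ false true J (psi e s) n%:Z k w 1 par_J (ff_odd ff e s).
rewrite expr0 scale1r big_ord1 gbin0 scale1r => h.
apply/eqP; rewrite addrC -subr_eq; apply/eqP; rewrite [LHS]h.
  by rewrite J_mode_psi /= (islinZ (vmode_linl _ _)) subr0.
by case=> // j _; rewrite J_mode_psi vmode0l scaler0.
Qed.

Lemma J_vac (n : nat) : vmode J n%:Z (vac : V) = 0.
Proof. by have [_ h] := vosa_creation HV J; exact: h. Qed.

Lemma J0_lin : islin (@J0 K V R psi). Proof. exact: vmode_lin. Qed.

Lemma J0_psim e s k w : J0 psi (psim e s k w) = psim e s k (J0 psi w) + csgn e *: psim e s k w.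
Proof. by have := J_comm 0 e s k w; rewrite add0r. Qed.

Lemma hasdec_J0 v : hasdec (@J0 K V R psi) v.
Proof.
apply: (fock_ind ff) v => [|a u v hu hv|e r n v hv].
- by apply: (@hasdec_eigen _ _ _ _ 0 J0_lin); rewrite scale0r; exact: J_vac.
- by apply: hasdec_lin => //; exact: J0_lin.
have [t ut ht] := eigdecomp_seq (eigcompP hv).
rewrite (eigdecomp_sum (eigcompP hv) ut ht) (islin_sum (psim_lin _ _ _ _)).
apply: hasdec_sum => [|a _]; first exact: J0_lin.
apply: (@hasdec_eigen _ _ _ _ (a + csgn e) J0_lin).
by rewrite J0_psim (eigcomp_espace _ hv) (islinZ (psim_lin _ _ _ _)) scalerDl.
Qed.

Definition chg (l : seq (mode R)) : C := \sum_(m <- l) csgn m.1.1.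

Lemma J0_cr m w : J0 psi (cr m w) = cr m (J0 psi w) + csgn m.1.1 *: cr m w.
Proof. exact: J0_psim. Qed.
Lemma J0_an m w : J0 psi (an m w) = an m (J0 psi w) - csgn m.1.1 *: an m w.
Proof.
rewrite /an J0_psim -scaleNr; congr (_ + _ *: _).
by case: (m.1.1); rewrite /csgn /= ?opprK.
Qed.

Lemma J0_mono l : J0 psi (mono l) = chg l *: mono l.
Proof.
elim: l => [|m l IH]; first by rewrite /chg big_nil scale0r; exact: J_vac.
by rewrite /= J0_cr IH (islinZ (cr_lin _ _)) -scalerDl /chg big_cons addrC.
Qed.

Lemma vaccoef_J0 v : vaccoef (J0 psi v) = 0.
Proof.
have [t ->] := span_mono ff v; rewrite islin_sum; last exact: J0_lin.
rewrite islinf_sum; last exact: (vaccoef_linf ff).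
apply: big1 => x _; rewrite (islinZ J0_lin) (islinfZ (vaccoef_linf ff)).
case: (x.2) => [|m l]; first by rewrite /= [J0 _ _]J_vac (islinf0 (vaccoef_linf ff)) mulr0.
by rewrite J0_mono (islinfZ (vaccoef_linf ff)) /= (vaccoef_cr ff) !mulr0.
Qed.

Lemma dual_J0 l v : dual psi l (J0 psi v) = chg l * dual psi l v.
Proof.
rewrite /dual; elim: l v => [|m l IH] v /=.
  by rewrite vaccoef_J0 /chg big_nil mul0r.
have -> : an m (J0 psi v) = csgn m.1.1 *: an m v + J0 psi (an m v).
  by rewrite J0_an addrCA subrr addr0.
have := dual_linf ff l (csgn m.1.1) (an m v) (J0 psi (an m v)); rewrite /dual => ->.
by rewrite IH -mulrDl /chg big_cons.
Qed.

(** Vectors on which the r-th pair of fermions is still in its vacuum.  On them a bilinear operator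
of the r-th pair can be inserted without contractions. *)
Definition rvac r w := forall e n, 0 <= n -> psim e r n w = 0.

Lemma rvac_vac r : rvac r vac.
Proof. by move=> e n n0; exact: psim_vac. Qed.

Lemma rvac_lin r (a : C) u v : rvac r u -> rvac r v -> rvac r (a *: u + v).
Proof. by move=> hu hv e n n0; rewrite psim_lin hu // hv // scaler0 addr0. Qed.

Lemma rvac0 r : rvac r 0.
Proof. by move=> e n n0; rewrite (islin0 (psim_lin _ _ _ _)). Qed.

Lemma rvac_psim r s e k w : r != s -> rvac r w -> rvac r (psim e s k w).
Proof.
move=> /negPf rs hw e' n n0; have := psim_anti ff e' r e s n k w.
by rewrite rs andbF (hw e' n n0) (islin0 (psim_lin _ _ _ _)) addr0.
Qed.

Lemma rvac_J r (n : nat) w : rvac r w -> rvac r (vmode J n%:Z w).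
Proof.
move=> hw e k k0; have := J_comm n e r k w.
rewrite !hw; try lia; rewrite scaler0 addr0 => <-; exact: vmode0.
Qed.

Lemma rvac_sum r (I : Type) (t : seq I) (P : pred I) (F : I -> V) :
  (forall i, P i -> rvac r (F i)) -> rvac r (\sum_(i <- t | P i) F i).
Proof.
move=> h; elim/big_rec : _ => [|i v Pi hv]; first exact: rvac0.
by rewrite -[F i]scale1r; apply: rvac_lin => //; exact: h.
Qed.

Definition pair_op r (i : nat) w : V := cr (true, r, i) (cr (false, r, 0%N) w).

(** The operator p_0 + sum_i p_(i+1) psi_r^+(-i-1) psi_r^-(-1): exactly the operators that occur as
Fock factors, before and after Delta. *)
Definition Bop r p w : V := p`_0 *: w + \sum_(i < size p) p`_i.+1 *: pair_op r i w.
Lemma Bop_def r p w : Bop r p w = p`_0 *: w + \sum_(i < size p) p`_i.+1 *: pair_op r i w.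
Proof. by []. Qed.

Lemma pair_op_lin r i : islin (pair_op r i).
Proof. by apply: islin_comp; exact: cr_lin. Qed.

Lemma BopE r p w N : (size p <= N.+1)%N ->
  Bop r p w = p`_0 *: w + \sum_(i < N) p`_i.+1 *: pair_op r i w.
Proof.
move=> hN; congr (_ + _).
have E M : (size p <= M.+1)%N ->
  \sum_(i < M) p`_i.+1 *: pair_op r i w = \sum_(i < (size p).-1) p`_i.+1 *: pair_op r i w.
  move=> hM; have h : ((size p).-1 <= M)%N by lia.
  rewrite -(subnKC h) big_split_ord /= [X in _ + X]big1 ?addr0 // => i _.
  by rewrite nth_default ?scale0r //; lia.
by rewrite !E //; lia.
Qed.

Lemma Bop_lin r p : islin (Bop r p).
Proof.
move=> a u v; rewrite /Bop [in RHS]scalerDr addrACA.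
congr (_ + _); first by rewrite scalerDr !scalerA mulrC.
rewrite scaler_sumr -big_split /=; apply: eq_bigr => i _.
by rewrite pair_op_lin scalerDr !scalerA mulrC.
Qed.

Lemma Bop_linp r w (a : C) p p' : Bop r (a *: p + p') w = a *: Bop r p w + Bop r p' w.
Proof.
pose N := maxn (size (a *: p + p')) (maxn (size p) (size p')).
have h1 : (size (a *: p + p')%R <= N.+1)%N by rewrite ltnW // ltnS leq_maxl.
have h2 : (size p <= N.+1)%N by rewrite ltnW // ltnS /N !leq_max leqnn orbT.
have h3 : (size p' <= N.+1)%N by rewrite ltnW // ltnS /N !leq_max leqnn !orbT.
rewrite (BopE _ _ h1) (BopE _ _ h2) (BopE _ _ h3).
rewrite [in RHS]scalerDr addrACA; congr (_ + _).
  by rewrite coefD coefZ scalerDl scalerA.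
rewrite scaler_sumr -big_split /=; apply: eq_bigr => i _.
by rewrite coefD coefZ scalerDl scalerA.
Qed.

Lemma Bop0 r w : Bop r 0 w = 0.
Proof. by rewrite /Bop size_poly0 big_ord0 coef0 scale0r addr0. Qed.
Lemma Bop1 r w : Bop r 1 w = w.
Proof. by rewrite (@BopE r 1 w 0) ?size_poly1 // big_ord0 coef1 scale1r addr0. Qed.
Lemma BopD r w p p' : Bop r (p + p') w = Bop r p w + Bop r p' w.
Proof. by have := Bop_linp r w 1 p p'; rewrite !scale1r. Qed.
Lemma BopZ r w (a : C) p : Bop r (a *: p) w = a *: Bop r p w.
Proof. by have := Bop_linp r w a p 0; rewrite !addr0 Bop0 addr0. Qed.
Lemma Bop_sum r w (I : Type) (t : seq I) (P : pred I) (F : I -> {poly C}) :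
  Bop r (\sum_(i <- t | P i) F i) w = \sum_(i <- t | P i) Bop r (F i) w.
Proof. by apply: (big_morph (fun p => Bop r p w)) => [p p'|]; [exact: BopD | exact: Bop0]. Qed.

Lemma rvac_Bop r s p w : r != s -> rvac r w -> rvac r (Bop s p w).
Proof.
move=> rs hw; rewrite /Bop; apply: rvac_lin => //; apply: rvac_sum => i _.
rewrite -[_ *: _]addr0; apply: rvac_lin; last exact: rvac0.
by do 2 apply: rvac_psim => //.
Qed.

Lemma par_Bop r p w : vpar false w -> vpar false (Bop r p w).
Proof.
move=> hw; apply: parD; first exact: parZ.
apply: par_sum => i _; apply: parZ.
by have := par_mode (- i.+1%:Z) (ff_odd ff true r) (par_mode (- 1%N%:Z) (ff_odd ff false r) hw).
Qed.

(** J(n) moves psi_r^+(-i-1) to psi_r^+(n-i-1), which is an annihilation operator contracting with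
psi_r^-(-1) when i = n - 1; the term with psi_r^-(n-1) vanishes. *)
Lemma J_Bop (n : nat) r p w : rvac r w ->
  vmode J n.+1%:Z (Bop r p w) = Bop r (drop_poly n.+1 p) w + Bop r p (vmode J n.+1%:Z w).
Proof.
move=> hw; pose N := size p.
have sd : (size (drop_poly n.+1 p) <= N.+1)%N by rewrite size_drop_poly; lia.
rewrite (@BopE r p _ (n.+1 + N)); last by rewrite /N; lia.
rewrite [in RHS](@BopE r p _ (n.+1 + N)); last by rewrite /N; lia.
rewrite (@BopE r _ _ N sd).
rewrite (islinD (vmode_lin _ _)) (islinZ (vmode_lin _ _)) addrCA; congr (_ + _).
rewrite (islin_sum (vmode_lin _ _)).
have E i : vmode J n.+1%:Z (pair_op r i w) = pair_op r i (vmode J n.+1%:Z w)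
   + (if (i < n)%N then 0 else if i == n then w else pair_op r (i - n.+1) w).
  rewrite /pair_op !crE /= !J_comm /csgn scale1r scaleN1r.
  rewrite (islinB (psim_lin _ _ _ _)) [psim false r (_ + _) w]hw ?(islin0 (psim_lin _ _ _ _)); last by lia.
  rewrite subr0; congr (_ + _).
  case: ltnP => ni.
    have /eqP := psim_anti ff true r false r (n.+1%:Z - i.+1%:Z) (- 1%N%:Z) w.
    rewrite (hw true (n.+1%:Z - i.+1%:Z)); last by lia.
    rewrite (islin0 (psim_lin _ _ _ _)) addr0 => /eqP ->; rewrite ifF //.
    by apply/negbTE/negP => /and3P[_ _ /eqP]; lia.
  case: eqP => [->|/eqP ine].
    have /eqP := psim_anti ff true r false r (n.+1%:Z - n.+1%:Z) (- 1%N%:Z) w.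
    rewrite (hw true (n.+1%:Z - n.+1%:Z)); last by lia.
    rewrite (islin0 (psim_lin _ _ _ _)) addr0 => /eqP ->; rewrite ifT //.
    by apply/and3P; split=> //; apply/eqP; lia.
  by congr (psim _ _ _ _); lia.
under eq_bigr do rewrite (islinZ (vmode_lin _ _)) E scalerDr.
rewrite big_split /= addrC; congr (_ + _).
rewrite big_split_ord /= big_ord_recr /= big1 ?add0r => [|i _]; last first.
  by rewrite ltn_ord scaler0.
rewrite ltnn eqxx coef_drop_poly add0n; congr (_ + _); apply: eq_bigr => i _.
rewrite coef_drop_poly ifF; last by apply/negbTE; lia.
rewrite ifF; last by apply/negbTE; lia.
by congr (_ *: pair_op _ _ _); [congr (p`_ _); lia | lia].
Qed.

Lemma J0_Bop r p w : J0 psi (Bop r p w) = Bop r p (J0 psi w).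
Proof.
rewrite /Bop (islinD J0_lin) (islinZ J0_lin) (islin_sum J0_lin); congr (_ + _).
apply: eq_bigr => i _; rewrite (islinZ J0_lin) /pair_op !J0_cr /csgn /= scale1r scaleN1r.
by rewrite (islinB (cr_lin _ _)) subrK.
Qed.

Definition phi (f : 'I_R -> {poly C}) (l : seq 'I_R) : V :=
  foldr (fun r v => Bop r (f r) v) vac l.

Lemma rvac_phi (f : 'I_R -> {poly C}) l r : r \notin l -> rvac r (phi f l).
Proof.
elim: l => [|s l IH] /=; first by move=> _; exact: rvac_vac.
by rewrite inE negb_or => /andP[rs rl]; apply: rvac_Bop => //; exact: IH.
Qed.

Lemma par_phi (f : 'I_R -> {poly C}) l : vpar false (phi f l).
Proof. by elim: l => [|s l IH] /=; [exact: (vosa_par_vac HV) | exact: par_Bop]. Qed.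

Lemma J0_phi (f : 'I_R -> {poly C}) l : J0 psi (phi f l) = 0.
Proof.
elim: l => [|s l IH] /=; first exact: J_vac.
by rewrite J0_Bop IH (islin0 (Bop_lin _ _)).
Qed.

(** The polynomial of the Fock factor psi_r^+[-k] psi_r^-[-1]. *)
Definition bpoly (k : nat) : {poly C} := if k == 0%N then 1 else \poly_(j < k.+1) psicoef k j.

Lemma size_bpoly k : (size (bpoly k) <= k.+1)%N.
Proof. by rewrite /bpoly; case: eqP => [->|_]; rewrite ?size_poly1 // size_poly. Qed.

Lemma sqmode_eigen (v : V) (a : C) (n : int) w N : L0 v = a *: v ->
  (forall j : nat, (N <= j)%N -> vmode v (n + j%:Z) w = 0) ->
  sqmode v n w = \sum_(j < N) sqcoef a (n + j%:Z) n *: vmode v (n + j%:Z) w.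
Proof.
move=> hv h; rewrite /sqmode (fsum_one (a := a)).
  rewrite (eigcomp_eigen _ L0_lin hv) eqxx.
  by rewrite (fsum_half (N := N)) // => j hj; rewrite h // scaler0.
move=> b /negPf ba; rewrite (eigcomp_eigen _ L0_lin hv) ba.
by rewrite fsbig1 // => m _; rewrite vmode0l scaler0.
Qed.

(** psi^-[-1] acts as psi^-(-1) and the modes psi^-(j), j >= 0, which vanish on w; psi^+[-k] also has
a term psi^+(0), which contracts with psi^-(-1) and yields the constant coefficient. *)
Lemma bop_Bop r k w : rvac r w -> bop psi r k w = Bop r (bpoly k) w.
Proof.
move=> hw; rewrite /bop /bpoly; case: eqP => [_|/eqP k0]; first by rewrite Bop1.
have -> : sqmode (psi false r) (-1) w = psim false r (-1) w.
  rewrite (sqmode_eigen (N := 1) (ff_weight ff false r)) => [|j hj].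
    rewrite big_ord1 addr0 -[sqcoef _ _ _]/(@psicoef K 1 1) (@psicoefS _ 0) // expr0 mulr1 texp_coef //.
    by rewrite /expterm expr0 fact0 divr1 scale1r.
  by apply: (hw false); lia.
have key (n : int) : 0 <= n -> psim true r n (psim false r (-1) w) = if n == 0 then w else 0.
  move=> n0; have /eqP := psim_anti ff true r false r n (-1) w.
  rewrite (hw true n n0) (islin0 (psim_lin _ _ _ _)) addr0 eqxx /= => /eqP ->.
  by rewrite (_ : (n == - -1 - 1) = (n == 0)) //; apply/eqP/eqP; lia.
rewrite (sqmode_eigen (N := k.+1) (ff_weight ff true r)) => [|j hj]; last first.
  rewrite -[vmode _ _ _]/(psim _ _ _ _) key; last lia.
  by rewrite ifF //; apply/negbTE/negP => /eqP; lia.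
rewrite (reindex_inj rev_ord_inj) /= (@BopE r _ w k) ?size_poly //.
rewrite big_ord_recl /= coef_poly ltn0Sn; congr (_ *: _ + _).
- by rewrite /psicoef; congr (sqcoef _ _ _); lia.
- rewrite -[vmode _ _ _]/(psim _ _ _ _) key; last lia.
  by rewrite ifT //; apply/eqP; lia.
apply: eq_bigr => i _; have ik := ltn_ord i; rewrite coef_poly ltnS ik /bump /= add1n; congr (_ *: _).
  by rewrite /psicoef; congr (sqcoef _ _ _); lia.
by rewrite /pair_op !crE -[vmode _ _ _]/(psim _ _ _ _) /=; congr (psim _ _ _ _); lia.
Qed.

Lemma bprod_phi (f : 'I_R -> nat) : bprod psi f = phi (fun r => bpoly (f r)) (enum 'I_R).
Proof.
rewrite /bprod; have := enum_uniq 'I_R; elim: (enum _) => //= r l IH /andP[rl ul].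
by rewrite IH // bop_Bop //; exact: rvac_phi.
Qed.

End CurrentAction.

(** * The operator Delta and the mode J[1] on Fock vectors *)

Section TriangularSums.
Variable U : zmodType.

Lemma tri_sum (F : nat -> nat -> U) n :
  \sum_(k < n) \sum_(i < k.+1) F i (k - i)%N = \sum_(i < n) \sum_(j < n - i) F i j.
Proof.
elim: n => [|n IH]; first by rewrite !big_ord0.
rewrite big_ord_recr IH /= !big_ord_recr /= subnn subSnn big_ord1 addrA -big_split /=.
congr (_ + _); apply: eq_bigr => i _.
by rewrite subSn ?(ltnW (ltn_ord i)) // big_ord_recr.
Qed.

Lemma sum_ord_trunc (F : nat -> U) n m : (n <= m)%N ->
  (forall i, (n <= i)%N -> F i = 0) -> \sum_(i < m) F i = \sum_(i < n) F i.
Proof.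
move=> nm h; rewrite -(subnKC nm) big_split_ord /= [X in _ + X]big1 ?addr0 // => i _.
by apply: h; exact: leq_addr.
Qed.

Lemma tri_square (F : nat -> nat -> U) D M :
  (forall i j, (D <= i)%N -> F i j = 0) -> (forall i j, (M <= j)%N -> F i j = 0) ->
  \sum_(k < D + M) \sum_(i < k.+1) F i (k - i)%N = \sum_(i < D) \sum_(j < M) F i j.
Proof.
move=> hD hM; rewrite tri_sum.
rewrite (@sum_ord_trunc (fun i => \sum_(j < D + M - i) F i j) D) ?leq_addr //.
  apply: eq_bigr => i _; apply: sum_ord_trunc; last by move=> j; exact: hM.
  by have := ltn_ord i; lia.
by move=> i Di; rewrite big1 // => j _; exact: hD.
Qed.

End TriangularSums.

Section ShiftActions.
Context {K : realType}.
Local Notation C := K[i].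
Implicit Types (p t : {poly C}) (a b : nat -> C).

(** The power series a(D) applied to p, where D drops the lowest coefficient. *)
Definition act a p : {poly C} := \sum_(m < size p) a m *: drop_poly m p.

Lemma actE a p N : (size p <= N)%N -> act a p = \sum_(m < N) a m *: drop_poly m p.
Proof.
move=> h; apply/esym/(sum_ord_trunc (F := fun m => a m *: drop_poly m p)) => // m hm.
by rewrite drop_poly_eq0 // scaler0.
Qed.

Lemma coef_act a p j N : (size p <= N)%N -> (act a p)`_j = \sum_(m < N) a m * p`_(m + j).
Proof.
move=> h; rewrite (actE a h) coef_sum; apply: eq_bigr => m _.
by rewrite coefZ coef_drop_poly addnC.
Qed.

Lemma size_act a p : (size (act a p) <= size p)%N.
Proof.
apply/leq_sizeP => j hj; rewrite (coef_act _ _ (leqnn _)) big1 // => m _.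
by rewrite nth_default ?mulr0 // (leq_trans hj) // leq_addl.
Qed.

Lemma size_act_pred a p : a 0%N = 0 -> (size (act a p) <= (size p).-1)%N.
Proof.
move=> a0; apply/leq_sizeP => j hj; rewrite (coef_act _ _ (leqnn _)) big1 // => -[[|m] mp] _ /=.
  by rewrite a0 mul0r.
rewrite nth_default ?mulr0 // addSn; apply: leq_trans (leqSpred _) _.
by rewrite ltnS (leq_trans hj) // leq_addl.
Qed.

Lemma eq_act a b p N : (size p <= N)%N -> (forall m, (m < N)%N -> a m = b m) -> act a p = act b p.
Proof.
move=> h e; rewrite !(actE _ h); apply: eq_bigr => m _; by rewrite e.
Qed.

(** Composition of shifts is multiplication of power series. *)
Lemma act_comp (f g : {poly C}) p :
  act (fun m => f`_m) (act (fun m => g`_m) p) = act (fun m => (f * g)`_m) p.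
Proof.
apply/polyP => j; pose N := size p.
have hN : (size (act (fun m => (g`_m)%R) p) <= N)%N by exact: size_act.
rewrite (coef_act _ _ hN) (coef_act _ _ (leqnn N)).
pose F i k := f`_i * g`_k * p`_(i + k + j).
transitivity (\sum_(i < N) \sum_(k < N) F i k).
  apply: eq_bigr => i _; rewrite (coef_act _ _ (leqnn N)) mulr_sumr.
  apply: eq_bigr => k _; rewrite /F mulrA; congr (_ * p`_ _); lia.
transitivity (\sum_(k < N) \sum_(i < k.+1) F i (k - i)%N); last first.
  apply: eq_bigr => k _; rewrite coefM mulr_suml; apply: eq_bigr => i _.
  by rewrite /F; congr (_ * p`_ _); have := ltn_ord i; lia.
rewrite tri_sum; apply: eq_bigr => i _; apply: sum_ord_trunc; first lia.
by move=> k hk; rewrite /F [p`_ _]nth_default ?mulr0 // -/N; lia.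
Qed.

Lemma act1 p : act (fun m => (1 : {poly C})`_m) p = p.
Proof.
apply/polyP => j; rewrite (@coef_act _ p j (size p).+1) // big_ord_recl coef1 mul1r.
by rewrite big1 ?addr0 // => i _; rewrite coef1 mul0r.
Qed.

Lemma act_lin a : forall (c : C) p t, act a (c *: p + t) = c *: act a p + act a t.
Proof.
move=> c p t; apply/polyP => j.
pose N := maxn (size (c *: p + t)%R) (maxn (size p) (size t)).
rewrite coefD coefZ.
rewrite (@coef_act a _ j N) ?leq_maxl // (@coef_act a p j N) ?(@coef_act a t j N) ?leq_max ?leqnn ?orbT //.
rewrite mulr_sumr -big_split /=; apply: eq_bigr => m _.
by rewrite coefD coefZ; ring.
Qed.

Lemma actZ a (c : C) p : act a (c *: p) = c *: act a p.
Proof.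
have := act_lin a c p 0; rewrite !addr0 => ->.
by rewrite /act size_poly0 big_ord0 addr0.
Qed.

Lemma size_iter_act a p j : a 0%N = 0 -> (size (iter j (act a) p) <= size p - j)%N.
Proof.
move=> a0; elim: j => [|j IH]; first by rewrite subn0.
by rewrite iterS; apply: leq_trans (size_act_pred _ a0) _; lia.
Qed.

Lemma iter_act0 a p j : a 0%N = 0 -> (size p <= j)%N -> iter j (act a) p = 0.
Proof.
move=> a0 h; apply/eqP; rewrite -size_poly_leq0.
by apply: leq_trans (size_iter_act _ _ a0) _; lia.
Qed.

Lemma iter_act_poly (f : {poly C}) p j :
  iter j (act (fun m => f`_m)) p = act (fun m => (f ^+ j)`_m) p.
Proof.
elim: j => [|j IH]; first by rewrite expr0 act1.
by rewrite iterS IH act_comp exprS.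
Qed.

(** The exponential of a(D); the sum is finite when a 0 = 0, as a(D) then lowers the size. *)
Definition eact a p : {poly C} := \sum_(j < size p) (j`!%:R)^-1 *: iter j (act a) p.

Lemma scaleX_coef (c : C) p i : (p \Po (c *: 'X))`_i = p`_i * c ^+ i.
Proof.
rewrite comp_polyE coef_sum.
have E (j : nat) : (p`_j *: (c *: 'X) ^+ j)`_i = if j == i then p`_i * c ^+ i else 0.
  rewrite exprZn !coefZ coefXn; case: eqVneq => [->|ji]; first by rewrite mulr1.
  by rewrite !mulr0.
under eq_bigr do rewrite E.
have [ip|pi] := ltnP i (size p); last first.
  rewrite big1 => [|j _]; first by rewrite nth_default // mul0r.
  by rewrite ltn_eqF // (leq_trans (ltn_ord j)).
rewrite (bigD1 (Ordinal ip)) //= eqxx big1 ?addr0 // => j ji.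
by rewrite ifF //; apply/negbTE.
Qed.

(** The coefficient of J(n) in the exponent of Delta(sigma, z) at z = y. *)
Definition dcoef (y : C) (n : nat) : C := - 2%:R^-1 * (n%:R^-1 * (- y) ^- n).

(** The exponent is 1/2 log(1 + D/y). *)
Lemma dcoefE (y : C) n : y != 0 -> dcoef y n = 2%:R^-1 * logcoef n * (y^-1) ^+ n.
Proof.
move=> y0; rewrite /dcoef; case: n => [|n]; first by rewrite invr0 /logcoef; ring.
rewrite /logcoef -exprVn invrN [(- _) ^+ n.+1]exprNn [(-1) ^+ n.+1]exprS; ring.
Qed.

Lemma dcoef0 (y : C) : dcoef y 0 = 0.
Proof. by rewrite /dcoef invr0; ring. Qed.

(** exp(1/2 log(1 + D/y)) = (1 + D/y)^(1/2). *)
Lemma eact_dcoef (y : C) p : y != 0 ->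
  eact (dcoef y) p = act (fun m => gbin 2%:R^-1 m * (y^-1) ^+ m) p.
Proof.
move=> y0; pose N := size p; pose f := (2%:R^-1 *: logser N) \Po (y^-1 *: 'X) : {poly C}.
have E j : iter j (act (dcoef y)) p = act (fun m => (f ^+ j)`_m) p.
  rewrite -iter_act_poly.
  have h t : (size t <= N)%N -> act (dcoef y) t = act (fun m => f`_m) t.
    move=> hs; apply: (eq_act hs) => m mN; rewrite dcoefE // /f scaleX_coef coefZ coef_poly.
    by rewrite ltnW.
  elim: j => //= j ->; apply: h; rewrite iter_act_poly; exact: size_act.
rewrite /eact.
have -> : \sum_(j < size p) (j`!%:R)^-1 *: iter j (act (dcoef y)) p
   = \sum_(j < N.+1) (j`!%:R)^-1 *: act (fun m => (f ^+ j)`_m) p.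
  apply/esym; rewrite (@sum_ord_trunc _ (fun j => (j`!%:R)^-1 *: act (fun m => (f ^+ j)`_m) p) N) //.
    by apply: eq_bigr => j _; rewrite E.
  by move=> j hj; rewrite -E (iter_act0 (dcoef0 y)) // scaler0.
apply/polyP => i; rewrite coef_sum (coef_act _ _ (leqnn N)).
transitivity (\sum_(m < N) (\sum_(j < N.+1) (j`!%:R)^-1 *: f ^+ j)`_m * p`_(m + i)).
  under eq_bigr do rewrite coefZ (coef_act _ _ (leqnn N)) mulr_sumr.
  rewrite exchange_big /=; apply: eq_bigr => m _; rewrite coef_sum mulr_suml.
  by apply: eq_bigr => j _; rewrite coefZ mulrA.
apply: eq_bigr => m _; congr (_ * _).
have -> : \sum_(j < N.+1) (j`!%:R)^-1 *: f ^+ j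
  = (\sum_(k < N.+1) (2%:R^-1 ^+ k / k`!%:R) *: logser N ^+ k) \Po (y^-1 *: 'X).
  rewrite raddf_sum /=; apply: eq_bigr => j _.
  by rewrite /f comp_polyZ exprZn comp_polyZ rmorphXn /= scalerA mulrC.
have mN : (m < N.+1)%N by rewrite ltnW // ltnS ltn_ord.
by rewrite scaleX_coef (exp_logser _ mN) coef_poly mN.
Qed.

(** The polynomial of a Fock factor after the action of Delta, at y = 1. *)
Definition dpoly (k : nat) : {poly C} := if k == 0%N then 1 else \poly_(i < k.+1) deltacoef k i.

(** The factors y^(-m) from Delta and y^(m+i) from the grading combine to y^i. *)
Lemma act_bpoly (y : C) k : y != 0 ->
  act (fun m => gbin 2%:R^-1 m * (y^-1) ^+ m) (bpoly k \Po (y *: 'X)) = dpoly k \Po (y *: 'X).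
Proof.
move=> y0; apply/polyP => i.
have hs : (size (bpoly k \Po (y *: 'X) : {poly C}) <= k.+1)%N.
  by apply/leq_sizeP => j hj; rewrite scaleX_coef nth_default ?mul0r // (leq_trans (size_bpoly k)).
rewrite (coef_act _ _ hs) scaleX_coef /bpoly /dpoly; case: (k =P 0%N) => [->|_].
  rewrite big_ord1 scaleX_coef gbin0 expr0 mulr1 mul1r add0n //.
have E (m : nat) : gbin 2%:R^-1 m * y^-1 ^+ m * (\poly_(j < k.+1) psicoef k j \Po (y *: 'X))`_(m + i)
  = (gbin 2%:R^-1 m * psicoef k (m + i)) * y ^+ i.
  rewrite scaleX_coef coef_poly exprD exprVn; case: ltnP => h; last by rewrite psicoef_gt //; ring.
  by field; rewrite expf_neq0.
under eq_bigr do rewrite E.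
rewrite -mulr_suml; congr (_ * _); rewrite coef_poly; case: ltnP => // h.
by rewrite big1 // => m _; rewrite psicoef_gt ?mulr0 //; lia.
Qed.

(** The series log(1 + D) lowers the label, because it is division by u in the generating series. *)
Lemma act_logcoef_bpoly k : act logcoef (bpoly k.+1) = bpoly k :> {poly C}.
Proof.
apply/polyP => i; rewrite (coef_act _ _ (size_bpoly k.+1)) /bpoly /=.
case: k => [|k] /=.
  rewrite big_ord_recl mul0r add0r big_ord1 coef_poly coef1.
  case: i => [|i] /=; first by rewrite (@logcoef_psicoef1 K).
  by rewrite mulr0.
rewrite coef_poly -logcoef_psicoef.
have -> : \sum_(m < k.+3) logcoef m * (\poly_(j < k.+3) psicoef k.+2 j)`_(m + i)
  = \sum_(m < k.+3) logcoef m * psicoef k.+2 (m + i) :> C.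
  apply: eq_bigr => m _; rewrite coef_poly; case: ltnP => // h.
  by rewrite psicoef_gt //; lia.
by case: ltnP => // h; rewrite logcoef_psicoef psicoef_gt //; lia.
Qed.

Lemma act_logcoef1 : act logcoef (1 : {poly C}) = 0.
Proof. by rewrite /act size_poly1 big_ord1 scale0r. Qed.

End ShiftActions.

Section ExponentialsOnFock.
Context {K : realType} {V : vosa K}.
Local Notation C := K[i].
Variable R : nat.
Variable psi : bool -> 'I_R -> V.
Hypothesis ff : free_fermions psi.
Let HV := vosaP V.
Implicit Types (u v w : V) (r s : 'I_R) (p : {poly C}) (a : nat -> C).
Local Notation J := (@Defs.J K V R psi).
Local Notation Bop := (@Bop K V R psi).
Local Notation phi := (@phi K V R psi).
Local Notation rvac := (@rvac K V R psi).

(** The operator sum_(n >= 1) a_n J(n), which acts on polynomials as the series a in the shift D. *)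
Definition Jser a u : V := \sum_(n \in [set n : nat | (0 < n)%N]) a n *: vmode J n%:Z u.

Lemma J_trunc u : exists N : nat, forall n : nat, (N < n)%N -> vmode J n%:Z u = 0.
Proof.
have [N hN] := trunc_from J u 0; exists N => n hn; rewrite -[n%:Z]add0r; apply: hN; lia.
Qed.

Lemma JserE a u N : (forall n : nat, (N < n)%N -> vmode J n%:Z u = 0) ->
  Jser a u = \sum_(i < N) a i.+1 *: vmode J i.+1%:Z u.
Proof. by move=> h; rewrite /Jser (fsum_pos (N := N)) // => i hi; rewrite h // scaler0. Qed.

Lemma Jser_lin a : islin (Jser a).
Proof.
move=> c u v; have [N1 h1] := J_trunc u; have [N2 h2] := J_trunc v.
have l1 n : (maxn N1 N2 < n)%N -> vmode J n%:Z u = 0 by move=> hn; apply: h1; lia.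
have l2 n : (maxn N1 N2 < n)%N -> vmode J n%:Z v = 0 by move=> hn; apply: h2; lia.
rewrite (JserE a l1) (JserE a l2) (@JserE a _ (maxn N1 N2)); last first.
  by move=> n hn; rewrite vmode_lin l1 // l2 // scaler0 addr0.
rewrite scaler_sumr -big_split /=; apply: eq_bigr => i _.
by rewrite vmode_lin scalerDr !scalerA mulrC.
Qed.

Lemma Jser_vac a : Jser a vac = 0.
Proof.
rewrite (@JserE a _ 0) ?big_ord0 // => n _; exact: J_vac.
Qed.

Lemma rvac_Jser a r w : rvac r w -> rvac r (Jser a w).
Proof.
move=> hw; have [N hN] := J_trunc w; rewrite (JserE a hN); apply: rvac_sum => i _.
rewrite -[_ *: _]addr0; apply: rvac_lin; last exact: rvac0.
exact: (rvac_J ff).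
Qed.

Lemma Jser_Bop a r p w : a 0%N = 0 -> rvac r w ->
  Jser a (Bop r p w) = Bop r (act a p) w + Bop r p (Jser a w).
Proof.
move=> a0 hw; have [N1 h1] := J_trunc w; pose N := maxn N1 (size p).
have l1 n : (N < n)%N -> vmode J n%:Z w = 0 by move=> hn; apply: h1; lia.
rewrite (JserE a l1) (@JserE a _ N); last first.
  case=> // n hn; rewrite (J_Bop ff n p hw) l1 // (islin0 (Bop_lin _ _ _)) addr0.
  by rewrite drop_poly_eq0 ?Bop0 //; rewrite /N in hn; lia.
have -> : act a p = \sum_(i < N) a i.+1 *: drop_poly i.+1 p.
  rewrite (@actE _ a p N.+1); last by rewrite /N; lia.
  by rewrite big_ord_recl a0 scale0r add0r.
rewrite Bop_sum (islin_sum (Bop_lin _ _ _)) -big_split /=; apply: eq_bigr => i _.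
by rewrite (J_Bop ff i p hw) scalerDr BopZ (islinZ (Bop_lin _ _ _)).
Qed.

Lemma rvac_iter a r w j : rvac r w -> rvac r (iter j (Jser a) w).
Proof. by move=> hw; elim: j => //= j IH; exact: rvac_Jser. Qed.

(** Leibniz rule with divided powers for the derivation [Jser a]. *)
Lemma Jser_leibniz a r p w k : a 0%N = 0 -> rvac r w ->
  (k`!%:R)^-1 *: iter k (Jser a) (Bop r p w)
  = \sum_(j < k.+1) Bop r ((j`!%:R)^-1 *: iter j (act a) p)
                     (((k - j)`!%:R)^-1 *: iter (k - j) (Jser a) w).
Proof.
move=> a0 hw.
pose d j := (j`!%:R)^-1 *: iter j (act a) p; pose e j := (j`!%:R)^-1 *: iter j (Jser a) w.
rewrite -/(\sum_(j < k.+1) Bop r (d j) (e (k - j)%N)).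
have dS j : act a (d j) = j.+1%:R *: d j.+1.
  by rewrite /d actZ scalerA factS natrM invfM mulrA divff ?pnatr_eq0 // mul1r.
have eS j : Jser a (e j) = j.+1%:R *: e j.+1.
  by rewrite /e (islinZ (Jser_lin _)) scalerA factS natrM invfM mulrA divff ?pnatr_eq0 // mul1r.
have re j : rvac r (e j).
  by rewrite /e -[_ *: _]addr0; apply: rvac_lin; [exact: rvac_iter | exact: rvac0].
elim: k => [|k IH].
  by rewrite big_ord1 /d /e /= fact0 invr1 !scale1r.
pose T j := Bop r (d j) (e (k.+1 - j)%N).
rewrite iterS factS natrM invfM -scalerA -(islinZ (Jser_lin a)) IH (islin_sum (Jser_lin a)).
have -> : \sum_(j < k.+1) Jser a (Bop r (d j) (e (k - j)%N))
  = \sum_(j < k.+1) j.+1%:R *: T j.+1 + \sum_(j < k.+1) (k.+1 - j)%:R *: T j.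
  rewrite -big_split /=; apply: eq_bigr => j _; have jk := ltn_ord j.
  rewrite Jser_Bop // dS eS BopZ (islinZ (Bop_lin psi r (d j)) (k - j).+1%:R) /T subSS.
  have jk' : (j <= k)%N by rewrite -ltnS.
  by rewrite (subSn jk').
have -> : \sum_(j < k.+1) j.+1%:R *: T j.+1 = \sum_(j < k.+2) j%:R *: T j.
  by rewrite [RHS]big_ord_recl scale0r add0r.
have -> : \sum_(j < k.+1) (k.+1 - j)%:R *: T j = \sum_(j < k.+2) (k.+1 - j)%:R *: T j.
  by rewrite [RHS]big_ord_recr /= subnn scale0r addr0.
rewrite -big_split /= scaler_sumr; apply: eq_bigr => j _.
have jk : (j <= k.+1)%N by rewrite -ltnS.
by rewrite -scalerDl -natrD subnKC // scalerA mulVf ?pnatr_eq0 // scale1r.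
Qed.

Lemma iter_Bop_nil a r p w M : a 0%N = 0 -> rvac r w -> iter M (Jser a) w = 0 ->
  iter (size p + M) (Jser a) (Bop r p w) = 0.
Proof.
move=> a0 hw hM; set k := (_ + M)%N.
have k0 : k`!%:R != 0 :> C by exact: factC_neq0.
suff h : (k`!%:R)^-1 *: iter k (Jser a) (Bop r p w) = 0.
  by move/eqP: h; rewrite scaler_eq0 invr_eq0 (negPf k0) => /eqP.
rewrite Jser_leibniz // big1 // => j _.
have [hj|hj] := leqP (size p) j; first by rewrite iter_act0 // scaler0 Bop0.
rewrite (@iter_lin0 _ _ _ M (k - j)%N w (Jser_lin a)) //; last by rewrite /k -addnBAC ?(ltnW hj) // leq_addl.
by rewrite scaler0 (islin0 (Bop_lin _ _ _)).
Qed.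

(** The exponential of a derivation is multiplicative: a Cauchy product of the two exponentials. *)
Lemma expnil_Bop a r p w M : a 0%N = 0 -> rvac r w -> iter M (Jser a) w = 0 ->
  expnil (Jser a) (Bop r p w) = Bop r (eact a p) (expnil (Jser a) w).
Proof.
move=> a0 hw hM.
rewrite (expnilE (Jser_lin a) (iter_Bop_nil p a0 hw hM)) (expnilE (Jser_lin a) hM).
pose F j i := Bop r ((j`!%:R)^-1 *: iter j (act a) p) ((i`!%:R)^-1 *: iter i (Jser a) w).
have FE k : (k`!%:R)^-1 *: iter k (Jser a) (Bop r p w) = \sum_(j < k.+1) F j (k - j)%N.
  exact: Jser_leibniz.
under eq_bigr do rewrite FE.
rewrite tri_square.
- rewrite /eact Bop_sum; apply: eq_bigr => j _.
  by rewrite (islin_sum (Bop_lin _ _ _)).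
- by move=> j i hj; rewrite /F iter_act0 // scaler0 Bop0.
- by move=> j i hi; rewrite /F (iter_lin0 (Jser_lin a) hi hM) scaler0 (islin0 (Bop_lin _ _ _)).
Qed.

Lemma exp_phi a (f : 'I_R -> {poly C}) l : a 0%N = 0 -> uniq l ->
  (exists M, iter M (Jser a) (phi f l) = 0) /\
  expnil (Jser a) (phi f l) = phi (fun r => eact a (f r)) l.
Proof.
move=> a0; elim: l => [|r l IH] /=.
  move=> _; have h : iter 1 (Jser a) vac = 0 by exact: Jser_vac.
  split; first by exists 1%N.
  by rewrite (expnilE (Jser_lin a) h) big_ord1 fact0 invr1 scale1r.
move=> /andP[rl ul]; have [[M hM] E] := IH ul.
have hr : rvac r (phi f l) by exact: (rvac_phi ff).
split; last by rewrite (expnil_Bop _ a0 hr hM) E.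
by exists (size (f r) + M)%N; exact: iter_Bop_nil.
Qed.

Definition exL (x : C) (v : V) : V := opfun (fun h => cexp (x * h)) L0 v.

Lemma exL_lin x : islin (exL x).
Proof. by move=> c u v; rewrite /exL opfun_lin //; [exact: L0_lin|exact: hasdec_L0|exact: hasdec_L0]. Qed.

Lemma exL_cr x m w : exL x (cr psi m w) = cexp (x * ((w2 m)%:R / 2%:R)) *: cr psi m (exL x w).
Proof.
have [r ur hr] := eigdecomp_seq (eigcompP (hasdec_L0 w)).
have E := eigdecomp_sum (eigcompP (hasdec_L0 w)) ur hr.
rewrite [in LHS]E {2}/exL (opfun_seq _ L0_lin (eigcompP (hasdec_L0 w)) ur hr).
rewrite !(islin_sum (cr_lin _ _)) (islin_sum (exL_lin x)) scaler_sumr; apply: eq_bigr => b _.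
rewrite /exL (@opfun_eigen _ _ _ _ _ (b + (w2 m)%:R / 2%:R)); last first.
- by rewrite (L0_cr ff) (eigcomp_espace _ (hasdec_L0 w)) (islinZ (cr_lin _ _)) scalerDl.
- exact: L0_lin.
by rewrite (islinZ (cr_lin _ _)) scalerA mulrDr cexpD mulrC.
Qed.

Lemma exL_Bop x r p w : exL x (Bop r p w) = Bop r (p \Po (cexp x *: 'X)) (exL x w).
Proof.
rewrite (@BopE _ _ _ _ r (_ \Po _) _ (size p)); last first.
  by apply/leq_sizeP => j hj; rewrite scaleX_coef nth_default ?mul0r // ltnW.
rewrite {1}Bop_def (islinD (exL_lin x)) (islinZ (exL_lin x)) (islin_sum (exL_lin x)).
rewrite scaleX_coef expr0 mulr1; congr (_ + _); apply: eq_bigr => i _.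
rewrite (islinZ (exL_lin x)) /pair_op !exL_cr (islinZ (cr_lin _ _)) !scalerA scaleX_coef.
rewrite -mulrA; congr ((_ * _) *: _); rewrite -cexpD -cexpMn; congr cexp.
rewrite -mulrDr; congr (_ * _); rewrite /w2 /= -mulrDl -natrD.
have -> : ((i : nat).*2.+1 + 0.*2.+1 = i.+1 * 2)%N by lia.
by rewrite natrM mulfK // pnatr_eq0.
Qed.

Lemma exL_phi x (f : 'I_R -> {poly C}) l :
  exL x (phi f l) = phi (fun r => f r \Po (cexp x *: 'X)) l.
Proof.
elim: l => [|r l IH] /=; last by rewrite exL_Bop IH.
by rewrite /exL (@opfun_eigen _ _ _ _ _ 0) ?mulr0 ?cexp0 ?scale1r ?scale0r //;
  [exact: L0_lin | exact: L0_vac].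
Qed.

Lemma DeltaE x v : Delta psi x v =
  opfun (fun b => cexp (x * (2%:R^-1 * b))) (J0 psi) (expnil (Jser (dcoef (cexp x))) v).
Proof.
have E : (fun u : V => - 2%:R^-1 *: \sum_(n \in [set n : nat | (0 < n)%N])
    (n%:R^-1 * (- cexp x) ^- n) *: vmode J n%:Z u) = Jser (dcoef (cexp x)).
  apply/funext => u.
  have [N hN] := J_trunc u; rewrite (JserE _ hN) (fsum_pos (N := N)) => [|i hi]; last first.
    by rewrite hN // scaler0.
  by rewrite scaler_sumr; apply: eq_bigr => i _; rewrite scalerA.
by rewrite /Delta E.
Qed.

(** Delta e^(xL(0)) v = v', together with the local nilpotency that makes the exponential in Delta
linear. *)
Definition DeltaQ x v v' :=
  (exists M, iter M (Jser (dcoef (cexp x))) (exL x v) = 0) /\ Delta psi x (exL x v) = v'.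

Lemma DeltaQ_lin x (c : C) u u' v v' :
  DeltaQ x u u' -> DeltaQ x v v' -> DeltaQ x (c *: u + v) (c *: u' + v').
Proof.
move=> [[M hM] <-] [[N hN] <-]; split.
  exists (M + N)%N; rewrite exL_lin (islin_iter _ (Jser_lin _)).
  rewrite (iter_lin0 (Jser_lin _) (leq_addr N M) hM) (iter_lin0 (Jser_lin _) (leq_addl M N) hN).
  by rewrite scaler0 addr0.
rewrite exL_lin !DeltaE (expnil_lin c (Jser_lin _) hM hN).
by apply: opfun_lin; [exact: J0_lin | exact: (hasdec_J0 ff) | exact: (hasdec_J0 ff)].
Qed.

Lemma DeltaQ0 x : DeltaQ x 0 0.
Proof.
have e0 : exL x 0 = 0 by exact: islin0 (exL_lin x).
split; first by exists 0%N.
rewrite e0 DeltaE (@expnilE _ _ _ _ 0 (Jser_lin _)) // big_ord0.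
by rewrite (@opfun_eigen _ _ _ _ _ 0) ?scaler0 ?scale0r //; [exact: J0_lin | exact: islin0 (J0_lin psi)].
Qed.

Lemma DeltaQ_sum x (I : Type) (t : seq I) (P : pred I) (c : I -> C) (F F' : I -> V) :
  (forall i, P i -> DeltaQ x (F i) (F' i)) ->
  DeltaQ x (\sum_(i <- t | P i) c i *: F i) (\sum_(i <- t | P i) c i *: F' i).
Proof.
move=> h; elim: t => [|i t IH]; first by rewrite !big_nil; exact: DeltaQ0.
by rewrite !big_cons; case: ifP => // Pi; apply: DeltaQ_lin => //; exact: h.
Qed.

(** The charge of a Fock vector is 0, so the factor z^(J(0)/2) of Delta is trivial on it. *)
Lemma DeltaQ_bprod x (f : 'I_R -> nat) :
  DeltaQ x (bprod psi f) (phi (fun r => dpoly (f r) \Po (cexp x *: 'X)) (enum 'I_R)).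
Proof.
have x0 := cexp_neq0 x.
have [[M hM] E] := exp_phi (fun r => bpoly (f r) \Po (cexp x *: 'X)) (dcoef0 (cexp x)) (enum_uniq 'I_R).
split; first by exists M; rewrite (bprod_phi ff) exL_phi.
rewrite (bprod_phi ff) exL_phi DeltaE E (@opfun_eigen _ _ _ _ _ 0).
- rewrite !mulr0 cexp0 scale1r; congr (phi _ _); apply/funext => r.
  by rewrite eact_dcoef // act_bpoly.
- exact: J0_lin.
by rewrite scale0r (J0_phi ff).
Qed.

Lemma L0_J : L0 J = J.
Proof.
rewrite /Defs.J (islin_sum L0_lin); apply: eq_bigr => r _.
rewrite (L0_mode (-1) (psi false r) (ff_odd ff true r) (ff_weight ff true r)) (ff_weight ff).
rewrite (islinZ (vmode_lin _ _)) -scalerDl rmorphN /= opprK.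
by rewrite (_ : _ + _ = 1) ?scale1r //; field.
Qed.

Lemma sqmode_J w : sqmode J 1 w = Jser logcoef w.
Proof.
have [N hN] := J_trunc w.
rewrite (@sqmode_eigen _ _ J 1 1 w N) ?scale1r ?L0_J // => [|j hj].
  rewrite (JserE _ hN); apply: eq_bigr => i _.
  have -> : 1 + i%:Z = i.+1%:Z by lia.
  by rewrite sqcoef_J.
have -> : 1 + j%:Z = j.+1%:Z by lia.
exact: hN.
Qed.

(** J[1] is a derivation that acts on one factor at a time, by [act_logcoef_bpoly]. *)
Lemma sqJ_bprod (f : 'I_R -> nat) :
  sqmode J 1 (bprod psi f)
  = \sum_(s | f s != 0%N) bprod psi (fun r => if r == s then (f s).-1 else f r).
Proof.
rewrite sqmode_J (bprod_phi ff).
have lamb0 : @logcoef K 0 = 0 by [].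
have E l : uniq l -> Jser logcoef (phi (fun r => bpoly (f r)) l)
   = \sum_(s <- l) phi (fun r => if r == s then act logcoef (bpoly (f s)) else bpoly (f r)) l.
  elim: l => [|r l IH] /=; first by rewrite big_nil Jser_vac.
  move=> /andP[rl ul]; rewrite Jser_Bop //; last exact: (rvac_phi ff).
  rewrite IH // big_cons eqxx (islin_sum (Bop_lin _ _ _)).
  have ph (s : seq 'I_R) (f1 f2 : 'I_R -> {poly C}) : (forall r', r' \in s -> f1 r' = f2 r') -> phi f1 s = phi f2 s.
    elim: s => //= r' s IHs h; rewrite h ?inE ?eqxx // IHs // => t ts.
    by apply: h; rewrite inE ts orbT.
  congr (_ + _).
    congr (Bop _ _ _); apply: ph => r' hr'; rewrite ifF //.
    by apply/negbTE; apply: contraNneq rl => <-.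
  rewrite big_seq [RHS]big_seq; apply: eq_bigr => s sl; rewrite ifF //.
  by apply/negbTE; apply: contraNneq rl => ->.
rewrite E ?enum_uniq // big_enum /= [RHS]big_mkcond; apply: eq_bigr => s _.
case: eqP => [fs0|/eqP fs0] /=.
  have fs0' : 1 = bpoly (f s) :> {poly C} by rewrite fs0.
  have z l : s \in l -> phi (fun r => if r == s then act logcoef (bpoly (f s)) else bpoly (f r)) l = 0.
    elim: l => //= r l IH; rewrite inE; have [sr|rs] /= := eqVneq s r.
      by rewrite -?sr ?eqxx -fs0' act_logcoef1 Bop0.
    by move=> /IH ->; rewrite (islin0 (Bop_lin _ _ _)).
  by apply: z; rewrite mem_enum.
rewrite (bprod_phi ff); congr (phi _ _); apply/funext => r; case: eqP => // _.
by rewrite -[in LHS](prednK (n := f s)) ?lt0n // act_logcoef_bpoly.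
Qed.

End ExponentialsOnFock.

(** * Diagonal matrix entries of Fock vectors *)

Section DiagonalEntries.
Context {K : realType} {V : vosa K}.
Local Notation C := K[i].
Variable R : nat.
Variable psi : bool -> 'I_R -> V.
Hypothesis ff : free_fermions psi.
Let HV := vosaP V.
Variable S : seq (mode R).
Hypothesis uS : uniq S.
Implicit Types (u v w : V) (e : bool) (r s : 'I_R) (n a b : int) (p : {poly C}).
Local Notation psim := (@psim K V R psi).
Local Notation cr := (@cr K V R psi).
Local Notation an := (@an K V R psi).
Local Notation num := (@num K V R psi).
Local Notation mono := (@mono K V R psi).
Local Notation dual := (@dual K V R psi).
Local Notation rvac := (@rvac K V R psi).

Lemma psim_psim0 e r a w : psim e r a (psim e r a w) = 0.
Proof. by apply: eq_opp_eq0; apply/eqP; rewrite -addr_eq0 (psim_anti ff) eqxx. Qed.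

Lemma psim_conj e r a w :
  psim (~~ e) r (- a - 1) (psim e r a w) = w - psim e r a (psim (~~ e) r (- a - 1) w).
Proof.
apply/eqP; rewrite eq_sym subr_eq eq_sym addrC addrC (psim_anti ff) ifT //.
apply/and3P; split; [by case: e | exact: eqxx | apply/eqP; lia].
Qed.

(** The idempotent psi_a psi_a^*, where psi_a = psi_r^e(a): a number operator or its complement,
hence diagonal on monomials. *)
Definition proj e r a w : V := psim e r a (psim (~~ e) r (- a - 1) w).

(** The eigenvalue of [proj] on the monomial of S. *)
Definition occ e r a : bool :=
  match a with Negz i => (e, r, i) \in S | Posz j => (~~ e, r, j) \notin S end.

Lemma projE e r a : (exists m, proj e r a =1 num m /\ occ e r a = (m \in S)) \/
  (exists m, (forall w, proj e r a w = w - num m w) /\ occ e r a = (m \notin S)).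
Proof.
case: a => j; [right; exists (~~ e, r, j) | left; exists (e, r, j)]; split=> // w.
  have E : psim e r j = an (~~ e, r, j) by rewrite !anE /= negbK.
  rewrite /proj; rewrite E (_ : psim (~~ e) r _ = cr (~~ e, r, j)).
    by rewrite (an_cr ff) eqxx.
  by rewrite !crE /=; congr (psim _ _ _); lia.
by rewrite /proj numE !crE !anE /=; congr (psim _ _ _ (psim _ _ _ _)); lia.
Qed.

Lemma dual_proj e r a w : dual S (proj e r a w) = (occ e r a)%:R * dual S w.
Proof.
case: (projE e r a) => -[m [h ->]]; rewrite h.
  by rewrite (dual_num ff); case: ifP => _; rewrite ?mul1r ?mul0r.
rewrite (islinfD (dual_linf ff S)) (islinfN (dual_linf ff S)) (dual_num ff).
by case: ifP => _; rewrite /= ?mul1r ?mul0r ?subr0 ?subrr.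
Qed.

Lemma proj_mono e r a : proj e r a (mono S) = (occ e r a)%:R *: mono S.
Proof.
case: (projE e r a) => -[m [h ->]]; rewrite h (num_mono ff) //;
  by case: ifP => _; rewrite /= ?scale1r ?scale0r ?subr0 ?subrr.
Qed.

(** Only matching modes contribute.  With the idempotent P = psi_a psi_a^* one has psi_a = P psi_a, so the
entry is multiplied by the eigenvalue of P.  If b is not the partner of a, then P commutes with
everything to the right of psi_a and takes the same eigenvalue on the monomial, but psi_a P = 0. *)
Lemma dual_pair e r a b (Z : V -> V) : islin Z ->
  (forall e' n u, psim e' r n (Z u) = Z (psim e' r n u)) ->
  dual S (psim e r a (psim (~~ e) r b (Z (mono S)))) =
  if b == - a - 1 then (occ e r a)%:R * dual S (Z (mono S)) else 0.
Proof.
move=> linZ comm; case: eqP => [->|/eqP ba]; first exact: dual_proj.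
set Y := psim (~~ e) r b (Z (mono S)).
have h1 : dual S (psim e r a Y) = (occ e r a)%:R * dual S (psim e r a Y).
  rewrite -dual_proj /proj psim_conj (islinB (psim_lin _ _ _ _)) psim_psim0 subr0 //.
(* here P = proj e r a acts as a number on the monomial and passes through Z *)
have h2 : (occ e r a)%:R * dual S (psim e r a Y) = 0.
  rewrite -(islinfZ (dual_linf ff S)) -(islinZ (psim_lin _ _ _ _)).
  have -> : (occ e r a)%:R *: Y = proj e r a Y.
    rewrite /Y -(islinZ (psim_lin _ _ _ _)) -(islinZ linZ) -proj_mono /proj -!comm.
    have e1 u : psim (~~ e) r b (psim e r a u) = - psim e r a (psim (~~ e) r b u).
      apply/eqP; rewrite -addr_eq0 (psim_anti ff) ifF //.
      by apply/negbTE; rewrite !negb_and ba !orbT.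
    have e2 c u : psim (~~ e) r b (psim (~~ e) r c u) = - psim (~~ e) r c (psim (~~ e) r b u).
      by apply/eqP; rewrite -addr_eq0 (psim_anti ff) eqxx.
    by rewrite e1 e2 (islinN (psim_lin _ _ _ _)) opprK.
  by rewrite /proj psim_psim0 (islinf0 (dual_linf ff S)).
by rewrite h1 h2.
Qed.

(** All nonnegative modes of psi_r on w vanish, so the commutator is zero. *)
Lemma rvac_comm e r a w n u : rvac r w -> vpar false w ->
  psim e r a (vmode w n u) = vmode w n (psim e r a u).
Proof.
move=> hw pw.
have := @commutator_formula _ _ true false (psi e r) w a n u 0 (ff_odd ff e r) pw.
rewrite big_ord0 expr0 scale1r => h; apply/eqP; rewrite -subr_eq0; apply/eqP/h => j _.
by rewrite -[vmode (psi e r) _ w]/(psim e r j%:Z w) hw // vmode0l scaler0.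
Qed.

Definition diag w n : C := dual S (vmode w n (mono S)).

Lemma diag_lin n (c : C) u v : diag (c *: u + v) n = c * diag u n + diag v n.
Proof. by rewrite /diag vmode_linl (dual_linf ff S). Qed.
Lemma diag0 n : diag 0 n = 0.
Proof. by rewrite /diag vmode0l (islinf0 (dual_linf ff S)). Qed.
Lemma diagD n u v : diag (u + v) n = diag u n + diag v n.
Proof. by have := diag_lin n 1 u v; rewrite scale1r mul1r. Qed.
Lemma diagZ n (c : C) u : diag (c *: u) n = c * diag u n.
Proof. by have := diag_lin n c u 0; rewrite !addr0 diag0 addr0. Qed.
Lemma diag_sum n (I : Type) (t : seq I) (P : pred I) (F : I -> V) :
  diag (\sum_(i <- t | P i) F i) n = \sum_(i <- t | P i) diag (F i) n.
Proof. by apply: (big_morph (fun v => diag v n)) => [u v|]; [exact: diagD | exact: diag0]. Qed.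

(** The iterate formula, in which the nonnegative modes of psi_r^- can be moved to the left of w. *)
Lemma mode_single r w n u : rvac r w -> vpar false w -> exists N0 : nat, forall N, (N0 <= N)%N ->
  vmode (cr (false, r, 0%N) w) n u
  = \sum_(j < N) (psim false r (-1 - j%:Z) (vmode w (n + j%:Z) u)
                 + psim false r j%:Z (vmode w (n - 1 - j%:Z) u)).
Proof.
move=> hw pw.
have [N1 h1] := trunc_from w u n; have [N2 h2] := trunc_from (psi false r) u 0.
exists (maxn N1 N2) => N; rewrite geq_max => /andP[hN1 hN2].
rewrite (@iterate_formula _ _ true false (psi false r) w (- 1%N%:Z) n u N (ff_odd ff false r) pw).
- apply: eq_bigr => j _; rewrite gbinN1 scale1r; congr (_ + _).
  rewrite expr0 mulr1 -[(-1) ^ _]/((-1)^-1 : C) invrN1 scaleN1r opprK.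
  by rewrite (rvac_comm false j%:Z _ _ hw pw).
- by move=> j hj; apply: h1; lia.
- by move=> j hj; rewrite -[j%:Z]add0r; apply: h2; lia.
Qed.

Lemma comm_lin r w n : rvac r w -> vpar false w ->
  forall e' m u, psim e' r m (vmode w n u) = vmode w n (psim e' r m u).
Proof. by move=> hw pw e' m u; exact: rvac_comm. Qed.

(** The eigenvalue of the zero mode of psi_r^+(-i-1) psi_r^-(-1), as it comes from the two halves of
the normally ordered product. *)
Definition pairev (N : nat) r (i : nat) : C :=
  \sum_(j < N) ((-1) ^+ j * @gbin K (- i.+1%:Z)%:~R j) *
     (((true, r, (i + j)%N) \in S)%:R + (-1) ^+ i.+1 * ((false, r, j : nat) \in S)%:R).

(** Both halves of the normally ordered product have the form of [dual_pair]. *)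
Lemma diag_pair r i w n N : rvac r w -> vpar false w ->
  (forall m, m \in S -> (m.2 < N)%N) ->
  diag (pair_op psi r i w) n = pairev N r i * diag w (n - i.+1%:Z).
Proof.
move=> hw pw hN.
set w' := cr (false, r, 0%N) w.
have pw' : vpar true w' by have := par_mode (- 1%N%:Z) (ff_odd ff false r) pw.
have [N1 h1] := trunc_from w' (mono S) n; have [N2 h2] := trunc_from (psi true r) (mono S) 0.
(* beyond M all terms of the iterate formula vanish, and so do the occupation numbers *)
pose M := maxn N (maxn N1 N2).
rewrite /diag /pair_op -/w' {1}crE /=.
rewrite (@iterate_formula _ _ true true (psi true r) w' (- i.+1%:Z) n (mono S) M (ff_odd ff true r) pw'); last first.
- by move=> j hj; rewrite -[j%:Z]add0r; apply: h2; rewrite /M in hj; lia.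
- by move=> j hj; apply: h1; rewrite /M in hj; lia.
rewrite (islinf_sum (dual_linf ff S)).
have X1 (j : nat) : dual S (psim true r (- i.+1%:Z - j%:Z) (vmode w' (n + j%:Z) (mono S)))
   = ((true, r, (i + j)%N) \in S)%:R * diag w (n - i.+1%:Z).
  have [N0 h] := mode_single (n + j%:Z) (mono S) hw pw.
  rewrite (h (maxn N0 (i + j).+1)) ?leq_maxl //.
  rewrite (islin_sum (psim_lin _ _ _ _)) (islinf_sum (dual_linf ff S)).
  have ij : (i + j < maxn N0 (i + j).+1)%N by rewrite leq_max leqnn orbT.
  rewrite (bigD1 (Ordinal ij)) //= big1 ?addr0 => [|k ki].
    rewrite (islinD (psim_lin _ _ _ _)) (islinfD (dual_linf ff S)).
    rewrite (@dual_pair true r _ _ _ (vmode_lin w _) (comm_lin _ hw pw)) ifF; last first.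
      by apply/negbTE/negP => /eqP; lia.
    rewrite add0r (@dual_pair true r _ _ _ (vmode_lin w _) (comm_lin _ hw pw)) ifT; last first.
      by apply/eqP; lia.
    have -> : - i.+1%:Z - j%:Z = Negz (i + j) by lia.
    rewrite /occ /diag; congr (_ * dual S (vmode w _ _)); lia.
  rewrite (islinD (psim_lin _ _ _ _)) (islinfD (dual_linf ff S)).
  rewrite (@dual_pair true r _ _ _ (vmode_lin w _) (comm_lin _ hw pw)) ifF; last first.
    by apply/negbTE/negP => /eqP; lia.
  rewrite add0r (@dual_pair true r _ _ _ (vmode_lin w _) (comm_lin _ hw pw)) ifF //.
  apply/negbTE/negP => /eqP h'; move/negP: ki; apply; apply/eqP/val_inj => /=; lia.
have X2 (j : nat) : dual S (vmode w' (n + - i.+1%:Z - j%:Z) (psim true r j%:Z (mono S)))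
   = ((false, r, j) \in S)%:R * diag w (n - i.+1%:Z).
  have [N0 h] := mode_single (n + - i.+1%:Z - j%:Z) (psim true r j%:Z (mono S)) hw pw.
  rewrite (h (maxn N0 j.+1)) ?leq_maxl //.
  rewrite (islinf_sum (dual_linf ff S)).
  have ij : (j < maxn N0 j.+1)%N by rewrite leq_max leqnn orbT.
  rewrite (bigD1 (Ordinal ij)) //= big1 ?addr0 => [|k ki].
    rewrite (islinfD (dual_linf ff S)) -!(rvac_comm true _ _ _ hw pw).
    rewrite (@dual_pair false r _ _ _ (vmode_lin w _) (comm_lin _ hw pw)) ifT; last first.
      by apply/eqP; lia.
    rewrite (@dual_pair false r _ _ _ (vmode_lin w _) (comm_lin _ hw pw)) ifF; last first.
      by apply/negbTE/negP => /eqP; lia.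
    have -> : -1 - j%:Z = Negz j by lia.
    rewrite addr0 /occ /diag; congr (_ * dual S (vmode w _ _)); lia.
  rewrite (islinfD (dual_linf ff S)) -!(rvac_comm true _ _ _ hw pw).
  rewrite (@dual_pair false r _ _ _ (vmode_lin w _) (comm_lin _ hw pw)) ifF; last first.
    apply/negbTE/negP => /eqP h'; move/negP: ki; apply; apply/eqP/val_inj => /=; lia.
  rewrite (@dual_pair false r _ _ _ (vmode_lin w _) (comm_lin _ hw pw)) ifF ?addr0 //.
  by apply/negbTE/negP => /eqP; lia.
pose cf j : C := ((-1) ^+ j * @gbin K (- i.+1%:Z)%:~R j) *
     (((true, r, (i + j)%N) \in S)%:R + (-1) ^+ i.+1 * ((false, r, j : nat) \in S)%:R).
have -> : pairev N r i = \sum_(j < M) cf j.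
  apply/esym; apply: sum_ord_trunc; first exact: leq_maxl.
  move=> j hj; rewrite /cf.
  have -> : ((true, r, (i + j)%N) \in S) = false.
    by apply/negbTE/negP => /hN /=; lia.
  have -> : ((false, r, j) \in S) = false by apply/negbTE/negP => /hN /=; lia.
  by rewrite mulr0 addr0 mulr0.
rewrite mulr_suml; apply: eq_bigr => j _.
rewrite (islinfZ (dual_linf ff S)) (islinfD (dual_linf ff S)).
rewrite (islinfN (dual_linf ff S)) (islinfZ (dual_linf ff S)) X1 X2 -exprnN.
have sg : ((-1) ^+ i.+1)^-1 = (-1) ^+ i.+1 :> C.
  by rewrite -exprVn invrN1.
rewrite sg /= expr1 /cf /diag; ring.
Qed.

Lemma gbin_neg (i j : nat) : (-1) ^+ j * @gbin K (- i.+1%:Z)%:~R j = 'C(i + j, j)%:R.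
Proof.
elim: j => [|j IH]; first by rewrite gbin0 bin0 expr0 mulr1.
apply: (mulIf (x := j.+1%:R)); first by rewrite pnatr_eq0.
rewrite gbinS -natrM addnS [('C(_, _) * _)%N]mulnC -mul_bin_diag natrM -IH exprS.
rewrite mulrA divfK ?pnatr_eq0 //.
have -> : (- i.+1%:Z)%:~R = - i.+1%:R :> C by rewrite rmorphN /= -pmulrn.
rewrite -(natr1 (i + j)) -(natr1 i) natrD; ring.
Qed.

(** The negation rule for binomial coefficients turns the two halves into the values of one
polynomial binom(a, i) at a = j and at a = -j-1. *)
Lemma pairevE N r i : (forall m, m \in S -> (m.2 < N)%N) ->
  pairev N r i = \sum_(j < N) ((true, r, j : nat) \in S)%:R * @gbin K j%:R i
               - \sum_(j < N) ((false, r, j : nat) \in S)%:R * @gbin K (- j.+1%:R) i.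
Proof.
move=> hN; rewrite /pairev; under eq_bigr do rewrite gbin_neg mulrDr.
rewrite big_split /=; congr (_ + _).
  have E (m : nat) : @gbin K m%:R i = if (m < i)%N then 0 else 'C(m, m - i)%:R.
    by rewrite gbin_nat; case: ltnP => h; [rewrite bin_small | rewrite bin_sub].
  pose F m := ((true, r, m) \in S)%:R * @gbin K m%:R i.
  rewrite -[RHS](@sum_ord_trunc _ F N (i + N)) ?leq_addl //; last first.
    move=> m hm; rewrite /F (_ : _ \in S = false) ?mul0r //.
    by apply/negbTE/negP => /hN /=; lia.
  rewrite big_split_ord /= [X in _ = X + _]big1 ?add0r => [|j _]; last first.
    by rewrite /F E ltn_ord mulr0.
  apply: eq_bigr => j _; rewrite /F E ltnNge leq_addr /= addKn mulrC //.
rewrite -sumrN; apply: eq_bigr => j _.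
have -> : - j.+1%:R = (- j.+1%:Z)%:~R :> C by rewrite rmorphN /= -pmulrn.
have := gbin_neg j i; rewrite addnC => h.
have e : 'C(i + j, j) = 'C(i + j, i) by rewrite -bin_sub ?leq_addl // addnK.
rewrite e -h exprS; have s2 : (-1) ^+ i * (-1) ^+ i = 1 :> C by rewrite -expr2 sqrr_sign.
move: s2; set x := (-1) ^+ i; set g := gbin _ _; set b := (_ \in S)%:R => s2.
have -> : x * g * (-1 * x * b) = - (x * x) * (b * g) by ring.
by rewrite s2 mulN1r.
Qed.

Variable N : nat.
Hypothesis hN : forall m, m \in S -> (m.2 < N)%N.

Definition coefev r (i : nat) : C :=
  if i is j.+1 then pairev N r j else 1.

Lemma diag_Bop r p w n : rvac r w -> vpar false w ->
  diag (Bop psi r p w) n = \sum_(i < (size p).+1) p`_i * coefev r i * diag w (n - i%:Z).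
Proof.
move=> hw pw; rewrite /Bop diagD diagZ diag_sum [RHS]big_ord_recl mulr1 subr0; congr (_ + _).
apply: eq_bigr => i _; rewrite diagZ (@diag_pair r i w n N hw pw hN) lift0 /=; ring.
Qed.

(** The modes n of a diagonal entry are counted by the degree, so that entries of products become
coefficients of products of polynomials. *)
Definition evpoly r p : {poly C} := \poly_(i < size p) (p`_i * coefev r i).

Lemma coef_evpoly r p i : (evpoly r p)`_i = p`_i * coefev r i.
Proof.
rewrite coef_poly; case: ltnP => // h; by rewrite nth_default // mul0r.
Qed.

Lemma diag_phi (f : 'I_R -> {poly C}) (l : seq 'I_R) : uniq l ->
  (forall m : nat, diag (phi psi f l) (m%:Z - 1) = (\prod_(r <- l) evpoly r (f r))`_m) /\
  (forall n, n < -1 -> diag (phi psi f l) n = 0).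
Proof.
elim: l => [_|r l IH /= /andP[rl ul]] /=.
  split=> [m|n hn]; rewrite /diag (vosa_vac HV).
    rewrite big_nil coef1; case: m => [|m].
      by rewrite sub0r eqxx (dual_mono_id ff).
    have -> : (m.+1%:Z - 1 == -1) = false by apply/negbTE/negP => /eqP; lia.
    exact: (islinf0 (dual_linf ff S)).
  have -> : (n == -1) = false by apply/negbTE/negP => /eqP; lia.
  exact: (islinf0 (dual_linf ff S)).
have [h1 h2] := IH ul.
have hr : rvac r (phi psi f l) by exact: (rvac_phi ff).
have pr : vpar false (phi psi f l) by exact: (par_phi ff).
split=> [m|n hn]; rewrite (diag_Bop _ _ hr pr).
  rewrite big_cons coefM.
  pose F i := (evpoly r (f r))`_i * (if (i <= m)%N then (\prod_(r <- l) evpoly r (f r))`_(m - i) else 0).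
  transitivity (\sum_(i < (size (f r)).+1 + m.+1) F i).
    rewrite (@sum_ord_trunc _ F (size (f r)).+1) ?leq_addr //; last first.
      by move=> i hi; rewrite /F coef_evpoly nth_default ?mul0r // ltnW.
    apply: eq_bigr => i _; rewrite /F coef_evpoly; congr (_ * _); case: leqP => im.
      by rewrite -h1; congr (diag _ _); lia.
    by apply: h2; lia.
  rewrite (@sum_ord_trunc _ F m.+1) ?leq_addl //; last first.
    by move=> i hi; rewrite /F leqNgt hi mulr0.
  by apply: eq_bigr => i _; rewrite /F -ltnS ltn_ord.
by rewrite big1 // => i _; rewrite h2 ?mulr0 //; lia.
Qed.

Definition labelev k r : C :=
  if k is k'.+1 then
    bern k + (\sum_(j < N) ((true, r, j : nat) \in S)%:R * expterm (j.+1%:R) k'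
              - \sum_(j < N) ((false, r, j : nat) \in S)%:R * expterm (- j%:R) k')
  else 1.

(** The constant term of the transformed Fock factor is B_k, and each occupied mode contributes
through [deltacoef_sum], at a = j for the sign + and a = -j-1 for the sign -. *)
Lemma labelevE (y : C) k r : y != 0 ->
  (evpoly r (dpoly k \Po (y *: 'X))).[y^-1] = labelev k r.
Proof.
move=> y0; set p := dpoly k \Po _.
have hs : (size p <= k.+1)%N.
  apply/leq_sizeP => j hj; rewrite scaleX_coef nth_default ?mul0r // (leq_trans _ hj) //.
  by rewrite /dpoly; case: eqP => [->|_]; rewrite ?size_poly1 // size_poly.
have hs2 : (size (evpoly r p) <= k.+1)%N by rewrite (leq_trans (size_poly _ _)).
rewrite (horner_coef_wide _ hs2).
have E (i : nat) : (evpoly r p)`_i * y^-1 ^+ i = (dpoly k)`_i * coefev r i.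
  rewrite coef_evpoly scaleX_coef exprVn; field; by rewrite expf_neq0.
under eq_bigr do rewrite E.
case: k {p hs hs2 E} => [|k]; first by rewrite big_ord1 coef1 mulr1.
rewrite big_ord_recl /= mulr1 coef_poly ltn0Sn deltacoef0; congr (_ + _).
transitivity (\sum_(i < k.+1) deltacoef k.+1 i.+1 *
   (\sum_(j < N) ((true, r, j : nat) \in S)%:R * @gbin K j%:R i
    - \sum_(j < N) ((false, r, j : nat) \in S)%:R * @gbin K (- j.+1%:R) i)).
  apply: eq_bigr => i _; rewrite /= (pairevE _ _ hN) coef_poly; congr (_ * _).
  by rewrite ifT //= /bump /= add1n ltnS ltn_ord.
pose A i : C := \sum_(j < N) ((true, r, j : nat) \in S)%:R * @gbin K j%:R i.
pose B i : C := \sum_(j < N) ((false, r, j : nat) \in S)%:R * @gbin K (- j.+1%:R) i.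
transitivity (\sum_(i < k.+1) (deltacoef k.+1 i.+1 * A i - deltacoef k.+1 i.+1 * B i)).
  by apply: eq_bigr => i _; rewrite -mulrBr.
rewrite sumrB /A /B; congr (_ - _).
  under [LHS]eq_bigr do rewrite mulr_sumr.
  rewrite exchange_big /=; apply: eq_bigr => j _.
  by rewrite -natr1 -deltacoef_sum mulr_sumr; apply: eq_bigr => i _; rewrite mulrCA.
under [LHS]eq_bigr do rewrite mulr_sumr.
rewrite exchange_big /=; apply: eq_bigr => j _.
have -> : - j%:R = - j.+1%:R + 1 :> C by rewrite -natr1; ring.
by rewrite -deltacoef_sum mulr_sumr; apply: eq_bigr => i _; rewrite mulrCA.
Qed.

End DiagonalEntries.

(** * The graded trace in the monomial basis *)

Section Labels.
Variables (R N : nat).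

(** A Fock state in which only the modes j < N are occupied, sorted by the index r. *)
Definition label := {ffun 'I_R -> {set bool * 'I_N}}.
Implicit Types (S : label) (m : mode R).

Definition lst S : seq (mode R) :=
  [seq (x.1, r, val x.2) | r <- enum 'I_R, x <- enum (S r)].

Lemma lst_bound S m : m \in lst S -> (m.2 < N)%N.
Proof. by move=> /allpairsPdep [r [x [_ _ ->]]] /=. Qed.

Lemma mem_lst S e r (j : 'I_N) : ((e, r, val j) \in lst S) = ((e, j) \in S r).
Proof.
apply/allpairsPdep/idP => [[r' [[e' j'] [_]]]|h].
  by rewrite mem_enum => h [-> -> /val_inj ->].
by exists r, (e, j); rewrite !mem_enum.
Qed.

Lemma uniq_lst S : uniq (lst S).
Proof.
apply: allpairs_uniq_dep => [|r _|]; try exact: enum_uniq.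
by move=> [r [e j]] [r' [e' j']] _ _ /= [-> -> /val_inj ->].
Qed.

Lemma prod_lst (A : comNzRingType) S (F : mode R -> A) :
  \prod_(m <- lst S) F m = \prod_r \prod_(x in S r) F (x.1, r, val x.2).
Proof.
rewrite /lst big_allpairs_dep /= big_enum /=; apply: eq_bigr => r _.
by rewrite big_enum.
Qed.

(** Up to order, and hence up to the sign of its monomial. *)
Lemma lst_surj (l : seq (mode R)) : uniq l -> (forall m, m \in l -> (m.2 < N)%N) ->
  exists S, perm_eq l (lst S).
Proof.
move=> ul hl; exists [ffun r => [set x : bool * 'I_N | (x.1, r, val x.2) \in l]%SET].
apply: uniq_perm => //; first exact: uniq_lst.
move=> [[e r] j]; apply/idP/idP => h.
  have jN := hl _ h; rewrite -[j]/(val (Ordinal jN)) mem_lst ffunE inE //.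
have jN := lst_bound h; move: h; rewrite -[j]/(val (Ordinal jN)) mem_lst ffunE inE //.
Qed.

End Labels.

Section GradedTrace.
Context {K : realType} {V : vosa K}.
Local Notation C := K[i].
Variable R : nat.
Variable psi : bool -> 'I_R -> V.
Hypothesis ff : free_fermions psi.
Let HV := vosaP V.
Implicit Types (u v w : V) (r : 'I_R).
Local Notation mono := (@mono K V R psi).
Local Notation dual := (@dual K V R psi).
Local Notation J0 := (@Defs.J0 K V R psi).

Lemma sum_mono_ind (P : V -> Prop) : (forall (a : C) u v, P u -> P v -> P (a *: u + v)) ->
  (forall l, P (mono l)) -> forall v, P v.
Proof.
move=> Plin Pm v; have [t ->] := span_mono ff v.
have P0 : P 0 by rewrite -[0](addNr (mono [::])) -scaleN1r; exact: Plin.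
by elim: t => [|x t IH]; rewrite ?big_nil // big_cons; exact: Plin.
Qed.

Definition H2 w : V := L0 w + 2%:R^-1 *: J0 w.

Lemma H2_lin : islin H2.
Proof.
move=> a u v; rewrite /H2 L0_lin (J0_lin psi) scalerDr addrACA [in RHS]scalerDr.
by rewrite !scalerA mulrC.
Qed.

Lemma H2_mono l : H2 (mono l) = ((wt2 l)%:R / 2%:R + chg l / 2%:R) *: mono l.
Proof. by rewrite /H2 (L0_mono ff) (J0_mono ff) scalerA -scalerDl mulrC [2%:R^-1 * _]mulrC. Qed.

Lemma hasdec_H2 v : hasdec H2 v.
Proof.
apply: (sum_mono_ind (P := hasdec H2)) => [a u w hu hw|l]; first by apply: hasdec_lin => //; exact: H2_lin.
exact: hasdec_eigen H2_lin (H2_mono l).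
Qed.

Lemma L0_J0 v : L0 (J0 v) = J0 (L0 v).
Proof.
apply: (sum_mono_ind (P := fun v => L0 (J0 v) = J0 (L0 v))) => [a u w hu hw|l].
  by rewrite L0_lin !(J0_lin psi) L0_lin hu hw.
rewrite (J0_mono ff) (L0_mono ff) (islinZ L0_lin) (islinZ (J0_lin psi)) (L0_mono ff) (J0_mono ff).
by rewrite !scalerA mulrC.
Qed.
Lemma L0_H2 v : L0 (H2 v) = H2 (L0 v).
Proof. by rewrite /H2 (islinD L0_lin) (islinZ L0_lin) L0_J0. Qed.

(** An operator commuting with A preserves the eigenspaces of A. *)
Lemma opfun_comm (A B : V -> V) (f : C -> C) : islin A -> islin B -> (forall v, hasdec A v) ->
  (forall v, B (A v) = A (B v)) -> forall v, B (opfun f A v) = opfun f A (B v).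
Proof.
move=> hA hB dA AB v.
have [r ur hr] := eigdecomp_seq (eigcompP (dA v)).
rewrite (opfun_seq f hA (eigcompP (dA v)) ur hr) (islin_sum hB).
have E := eigdecomp_sum (eigcompP (dA v)) ur hr.
have d : eigdecomp A (B v) (fun a => B (eigcomp A v a)).
  apply: (eigdecompI ur) => [a ar|a|]; first by rewrite hr // (islin0 hB).
    by rewrite -AB (eigcomp_espace _ (dA v)) (islinZ hB).
  by rewrite {1}E (islin_sum hB).
rewrite (opfun_seq f hA d ur) => [|a ar]; last by rewrite hr // (islin0 hB).
by apply: eq_bigr => a _; rewrite (islinZ hB).
Qed.

Lemma opfun_islin (f : C -> C) (A : V -> V) : islin A -> (forall v, hasdec A v) -> islin (opfun f A).
Proof. by move=> hA dA a u v; exact: opfun_lin. Qed.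

(** Even vectors of nonnegative integral weight: only finitely many of their modes preserve a given
L(0)-weight. *)
Definition homog v := exists M (h : nat -> V),
  (forall i, vpar false (h i) /\ L0 (h i) = i%:R *: h i) /\ v = \sum_(i < M) h i.

Lemma homog_lin (a : C) u v : homog u -> homog v -> homog (a *: u + v).
Proof.
move=> [M [h [hh ->]]] [M' [h' [hh' ->]]].
pose g i := a *: (if (i < M)%N then h i else 0) + (if (i < M')%N then h' i else 0).
exists (maxn M M'), g; split=> [i|].
  have c1 : vpar false (if (i < M)%N then h i else 0) /\
     L0 (if (i < M)%N then h i else 0) = i%:R *: (if (i < M)%N then h i else 0).
    by case: ifP => _; [exact: hh | split; [exact: par0 | rewrite scaler0; exact: islin0 L0_lin]].
  have c2 : vpar false (if (i < M')%N then h' i else 0) /\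
     L0 (if (i < M')%N then h' i else 0) = i%:R *: (if (i < M')%N then h' i else 0).
    by case: ifP => _; [exact: hh' | split; [exact: par0 | rewrite scaler0; exact: islin0 L0_lin]].
  rewrite /g; move: c1 c2 => [p1 e1] [p2 e2]; split; first exact: par_lin.
  by rewrite L0_lin e1 e2 scalerDr !scalerA mulrC.
rewrite big_split /= -scaler_sumr; congr (_ *: _ + _).
  rewrite (@sum_ord_trunc _ (fun i => if (i < M)%N then h i else 0) M) ?leq_maxl //.
    by apply: eq_bigr => i _; rewrite ltn_ord.
  by move=> i hi; rewrite ltnNge hi.
rewrite (@sum_ord_trunc _ (fun i => if (i < M')%N then h' i else 0) M') ?leq_maxr //.
  by apply: eq_bigr => i _; rewrite ltn_ord.
by move=> i hi; rewrite ltnNge hi.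
Qed.

Lemma homog0 : homog 0.
Proof.
exists 0%N, (fun=> 0); rewrite big_ord0; split=> // i; split; first exact: par0.
by rewrite scaler0; exact: islin0 L0_lin.
Qed.
Lemma homogZ (a : C) u : homog u -> homog (a *: u).
Proof. by move=> h; rewrite -[_ *: _]addr0; apply: homog_lin => //; exact: homog0. Qed.
Lemma homog_sum (I : Type) (t : seq I) (P : pred I) (F : I -> V) :
  (forall i, P i -> homog (F i)) -> homog (\sum_(i <- t | P i) F i).
Proof.
move=> h; elim/big_rec : _ => [|i v Pi hv]; first exact: homog0.
by rewrite -[F i]scale1r; apply: homog_lin => //; exact: h.
Qed.

(** The operator raises the weight by i + 1. *)
Lemma homog_pair r i w : homog w -> homog (pair_op psi r i w).
Proof.
move=> [M [h [hh ->]]].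
exists (i.+1 + M)%N, (fun j => if (i.+1 <= j)%N then pair_op psi r i (h (j - i.+1)%N) else 0); split=> [j|].
  case: ifP => ij; last by split; [exact: par0 | rewrite scaler0; exact: islin0 L0_lin].
  have [p e] := hh (j - i.+1)%N; split.
    exact: (par_mode (- i.+1%:Z) (ff_odd ff true r) (par_mode (- 1%N%:Z) (ff_odd ff false r) p)).
  rewrite /pair_op !(L0_cr ff) e (islinZ (cr_lin _ _)) (islinD (cr_lin _ _)) !(islinZ (cr_lin _ _)).
  rewrite -!scalerDl; congr (_ *: _).
  have -> : j%:R = (j - i.+1)%:R + i.+1%:R :> C by rewrite -natrD subnK.
  rewrite -addrA; congr (_ + _); rewrite /w2 /= -mulrDl -natrD.
  have -> : (0.*2.+1 + (i : nat).*2.+1 = i.+1 * 2)%N by lia.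
  by rewrite natrM mulfK // pnatr_eq0.
rewrite big_split_ord /= [X in _ = X + _]big1 ?add0r => [|j _]; last by rewrite leqNgt ltn_ord.
rewrite (islin_sum (pair_op_lin _ _ _)); apply: eq_bigr => j _.
by rewrite ifT ?addKn ?leq_addr // addSn ltnS leq_addr.
Qed.

Lemma homog_phi (f : 'I_R -> {poly C}) l : homog (phi psi f l).
Proof.
elim: l => [|r l IH] /=.
  exists 1%N, (fun i => if i == 0%N then vac else 0); rewrite big_ord1; split=> // i.
  case: eqP => [->|_].
    by split; [exact: (vosa_par_vac HV) | rewrite scale0r; exact: L0_vac].
  by split; [exact: par0 | rewrite scaler0; exact: islin0 L0_lin].
rewrite /Bop; apply: homog_lin => //; apply: homog_sum => i _; apply: homogZ; exact: homog_pair.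
Qed.

Section FixedVector.
Variables (v' v : V) (x z tau : C).
Hypothesis hv' : homog v'.
Hypothesis Dv : DeltaQ psi x v v'.

Definition sgm : V -> V := opfun (fun a => cexp (pi%:C * 'i%C * a)) J0.

Lemma ZJ_opE n w : ZJ_op psi v z tau x n w =
  sgm (cexp (- (x * (n + 1)%:~R)) *: vmode v' n (weightop psi z tau w)).
Proof. by have [_ <-] := Dv. Qed.

Lemma sgm_lin : islin sgm.
Proof. by apply: opfun_islin; [exact: J0_lin | exact: (hasdec_J0 ff)]. Qed.
Lemma weightop_lin : islin (weightop psi z tau).
Proof.
apply: islin_comp; apply: opfun_islin; [exact: J0_lin | exact: (hasdec_J0 ff) |
  exact: H2_lin | exact: hasdec_H2].
Qed.
Lemma ZJ_op_lin n : islin (ZJ_op psi v z tau x n).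
Proof.
move=> a u w; rewrite !ZJ_opE weightop_lin vmode_lin scalerDr scalerA mulrC -scalerA.
by rewrite sgm_lin.
Qed.

Lemma L0_sgm w : L0 (sgm w) = sgm (L0 w).
Proof.
by apply: opfun_comm; [exact: J0_lin | exact: L0_lin | exact: (hasdec_J0 ff) | exact: L0_J0].
Qed.
Lemma L0_weightop w : L0 (weightop psi z tau w) = weightop psi z tau (L0 w).
Proof.
rewrite /weightop (opfun_comm _ (J0_lin psi) L0_lin (hasdec_J0 ff) L0_J0).
by rewrite (opfun_comm _ H2_lin L0_lin hasdec_H2 L0_H2).
Qed.

(** A mode n of a vector of weight i changes the weight by i - n - 1, and sigma and the weight operator
commute with L(0); diagonal blocks therefore only see n = i - 1. *)
Lemma ZJ_op_support : exists M : nat, forall (h : C) w n, L0 w = h *: w ->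
  ~~ ((-1 <= n) && (n < -1 + M%:Z)) -> eigcomp L0 (ZJ_op psi v z tau x n w) h = 0.
Proof.
have [M [g [hg E]]] := hv'; exists M => h w n hw hn.
have hW : L0 (weightop psi z tau w) = h *: weightop psi z tau w.
  by rewrite L0_weightop hw (islinZ weightop_lin).
rewrite ZJ_opE E (islin_sum (vmode_linl _ _)) scaler_sumr (islin_sum sgm_lin).
have key (i : 'I_M) : eigcomp L0 (sgm (cexp (- (x * (n + 1)%:~R)) *:
     vmode (g i) n (weightop psi z tau w))) h = 0.
  have [pg eg] := hg i.
  set Z := cexp _ *: _.
  have eZ : L0 (sgm Z) = (h + (i%:R - n%:~R - 1)) *: sgm Z.
    rewrite L0_sgm -(islinZ sgm_lin); congr sgm.
    rewrite /Z (islinZ L0_lin) (L0_mode n _ pg eg) hW (islinZ (vmode_lin _ _)) -scalerDl.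
    by rewrite !scalerA mulrC.
  rewrite (eigcomp_eigen _ L0_lin eZ) ifF //.
  apply/negbTE; rewrite -subr_eq0 opprD addNKr oppr_eq0.
  have -> : i%:R - n%:~R - 1 = (i%:Z - n - 1)%:~R :> C.
    by rewrite !rmorphB /= -pmulrn.
  rewrite intr_eq0; apply/negP => /eqP hi; move/negP: hn; apply.
  by have := ltn_ord i; lia.
have s0 : forall (I : Type) (t : seq I) (F : I -> V),
    (forall i, eigcomp L0 (F i) h = 0) -> eigcomp L0 (\sum_(i <- t) F i) h = 0.
  move=> I t F hF; elim: t => [|i t IH].
    rewrite big_nil (@eigcomp_eigen _ _ L0 0 0) ?if_same //; first exact: L0_lin.
    by rewrite scaler0 (islin0 L0_lin).
  rewrite big_cons -[F i]scale1r (eigcomp_lin _ _ L0_lin (hasdec_L0 _) (hasdec_L0 _)).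
  by rewrite hF IH scaler0 addr0.
exact: s0.
Qed.

(** The factor of an occupied mode in sigma zeta^J(0) q^(L(0) + J(0)/2). *)
Definition dmode (m : bool * nat) : C :=
  if m.1 then - (e2pii z * e2pii tau ^+ m.2.+1) else - ((e2pii z)^-1 * e2pii tau ^+ m.2).

(** The contribution of the vacuum shifts R/2 and R/12. *)
Definition prefac : C := e2pii (z * (R%:R / 2%:R)) * e2pii (tau * (R%:R / 12%:R)).

Lemma weightop_mono l : weightop psi z tau (mono l) =
  (e2pii (z * (chg l + R%:R / 2%:R)) *
   e2pii (tau * ((wt2 l)%:R / 2%:R + chg l / 2%:R + R%:R / 12%:R))) *: mono l.
Proof.
rewrite /weightop (opfun_eigen _ H2_lin (H2_mono l)).
by rewrite (islinZ (opfun_islin _ (J0_lin psi) (hasdec_J0 ff))) (opfun_eigen _ (J0_lin psi) (J0_mono ff l))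
  scalerA mulrC.
Qed.

Lemma cexp_ipi : cexp (pi%:C * 'i%C) = -1 :> C.
Proof.
have -> : pi%:C * 'i%C = 0 +i* pi :> C.
  by move: (pi : K) => c; apply/eqP; rewrite eq_complex /=; apply/andP; split; apply/eqP; ring.
rewrite cexpE expR0 cospi sinpi !mul1r.
by apply/eqP; rewrite eq_complex /= oppr0 !eqxx.
Qed.

Lemma dmode_prod (l : seq (mode R)) :
  cexp (pi%:C * 'i%C * chg l) * (e2pii (z * (chg l + R%:R / 2%:R)) *
   e2pii (tau * ((wt2 l)%:R / 2%:R + chg l / 2%:R + R%:R / 12%:R)))
  = prefac * \prod_(m <- l) dmode (m.1.1, m.2).
Proof.
elim: l => [|m l IH].
  by rewrite /chg !big_nil /wt2 /= !mulr0 cexp0 !mul0r !add0r mul1r mulr1.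
rewrite big_cons [RHS]mulrCA -IH /chg big_cons -/(chg l) /wt2 /= -/(wt2 l) natrD.
have w0 : (w2 m)%:R / 2%:R = m.2%:R + 2%:R^-1 :> C by exact: w2E.
case: m w0 => [[e r] j] /= w0; rewrite /dmode /csgn /=.
have E1 (c : C) : cexp (pi%:C * 'i%C * (c + chg l)) = cexp (pi%:C * 'i%C * c) * cexp (pi%:C * 'i%C * chg l).
  by rewrite mulrDr cexpD.
have E2 (c : C) : e2pii (z * (c + chg l + R%:R / 2%:R)) = e2pii (z * c) * e2pii (z * (chg l + R%:R / 2%:R)).
  by rewrite -e2piiD; congr e2pii; ring.
have E3 (c d : C) : e2pii (tau * ((c + (wt2 l)%:R) / 2%:R + (d + chg l) / 2%:R + R%:R / 12%:R))
   = e2pii (tau * (c / 2%:R + d / 2%:R)) * e2pii (tau * ((wt2 l)%:R / 2%:R + chg l / 2%:R + R%:R / 12%:R)).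
  by rewrite -e2piiD; congr e2pii; ring.
rewrite E1 E2 E3 w0; clear w0.
case: e.
  rewrite !mulr1 cexp_ipi.
  have -> : e2pii (tau * (j%:R + 2%:R^-1 + 1 / 2%:R)) = e2pii tau ^+ j.+1.
    by rewrite -e2piiMn -natr1; congr e2pii; field.
  ring.
rewrite !mulrN1 cexpN cexp_ipi invrN1 e2piiN.
have -> : e2pii (tau * (j%:R + 2%:R^-1 + -1 / 2%:R)) = e2pii tau ^+ j.
  by rewrite -e2piiMn; congr e2pii; field.
ring.
Qed.

Lemma dual_ZJ_op l n : dual l (ZJ_op psi v z tau x n (mono l)) =
  prefac * \prod_(m <- l) dmode (m.1.1, m.2) * (cexp (- (x * (n + 1)%:~R)) * diag psi l v' n).
Proof.
rewrite ZJ_opE weightop_mono -dmode_prod (islinZ (vmode_lin _ _)) /sgm.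
set c := cexp (- _); set d := _ * e2pii _.
rewrite (left_eigen_opfun _ (J0_lin psi) (dual_linf ff l) (dual_J0 ff l) (hasdec_J0 ff _)).
rewrite (islinfZ (dual_linf ff l)) (islinfZ (dual_linf ff l)) -/(diag psi l v' n).
by clearbody c d; ring.
Qed.

End FixedVector.

End GradedTrace.

Section TraceTerms.
Context {K : realType} {V : vosa K}.
Local Notation C := K[i].
Variable R : nat.
Variable psi : bool -> 'I_R -> V.
Hypothesis ff : free_fermions psi.
Local Notation mono := (@mono K V R psi).
Local Notation dual := (@dual K V R psi).

Definition lterm (k : nat) (e : bool) (j : nat) : C :=
  if e then expterm (j.+1%:R) k else - expterm (- j%:R) k.

(** [labelev] as a function of the occupied modes of one pair. *)
Definition lev N k (s : {set bool * 'I_N}) : C :=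
  if k is k'.+1 then bern k + \sum_(m in s) lterm k' m.1 m.2 else 1.

Lemma labelev_lst N (S : label R N) k r : labelev (lst S) N k r = lev k (S r).
Proof.
case: k => [|k] //=; congr (_ + _).
transitivity (\sum_(x : bool * 'I_N) (x \in S r)%:R * lterm k x.1 x.2).
  pose F e (j : 'I_N) : C := ((e, j) \in S r)%:R * lterm k e j.
  rewrite (eq_bigr (fun x => F x.1 x.2)) => [|[e j] _ //].
  rewrite -(pair_bigA _ F) /= big_bool /= /F.
  rewrite -sumrN; congr (_ + _); apply: eq_bigr => j _.
    by rewrite -[nat_of_ord j]/(val j) mem_lst.
  by rewrite -[nat_of_ord j]/(val j) mem_lst mulrN.
rewrite [RHS]big_mkcond /=; apply: eq_bigr => m _.
by case: (m \in S r); rewrite ?mul1r ?mul0r.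
Qed.

Lemma dual_mono_lst N (S S' : label R N) : dual (lst S) (mono (lst S')) = (S == S')%:R.
Proof.
have [->|ne] := eqVneq S S'; first by rewrite (dual_mono_id ff) ?uniq_lst.
have [|h] := pselect (exists m, (m \in lst S) != (m \in lst S')).
  by move=> [m hm]; rewrite (dual_mono_neq ff (uniq_lst _) hm).
case/eqP: ne; apply/ffunP => r; apply/setP => -[e j]; rewrite -!mem_lst.
by apply/eqP/negPn/negP => h'; apply: h; exists (e, r, val j).
Qed.

Lemma wt2_perm (l l' : seq (mode R)) : perm_eq l l' -> wt2 l = wt2 l'.
Proof. by move=> h; apply: perm_sumn; exact: perm_map. Qed.

Lemma w2_le_wt2 m (l : seq (mode R)) : m \in l -> (w2 m <= wt2 l)%N.
Proof.
elim: l => // m' l IH; rewrite inE => /orP[/eqP <-|/IH h]; rewrite /wt2 /=; first exact: leq_addr.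
exact: leq_trans h (leq_addl _ _).
Qed.

Lemma half_int_inj (a b : int) : (a%:~R / 2%:R == b%:~R / 2%:R :> C) = (a == b).
Proof.
apply/eqP/eqP => [h|-> //].
have h2 : 2%:R^-1 != 0 :> C by rewrite invr_eq0 pnatr_eq0.
by apply/eqP; rewrite -(eqr_int C); apply/eqP; exact: (mulIf h2).
Qed.

Definition wtP N (k : int) (S : label R N) : bool := (wt2 (lst S))%:Z == k.

(** A state of weight k/2 with k <= N only involves modes j < N. *)
Lemma espace_L0P N (k : int) v : k <= N%:Z ->
  espace L0 (k%:~R / 2%:R : C) v <->
  exists c : label R N -> C, v = \sum_(S | wtP k S) c S *: mono (lst S).
Proof.
move=> kN; split=> [hv|[c ->]]; last first.
  rewrite /espace /= (islin_sum L0_lin) scaler_sumr; apply: eq_bigr => S /eqP <-.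
  by rewrite (islinZ L0_lin) (L0_mono ff) !scalerA mulrC -pmulrn.
pose Q (u : V) := exists c : label R N -> C, u = \sum_(S | wtP k S) c S *: mono (lst S).
rewrite -/(Q v).
have Ql (a : C) u w : Q u -> Q w -> Q (a *: u + w).
  move=> [c ->] [d ->]; exists (fun S => a * c S + d S).
  by rewrite scaler_sumr -big_split; apply: eq_bigr => S _ /=; rewrite scalerA -scalerDl.
have Q0 : Q 0 by exists (fun=> 0); rewrite big1 // => S _; rewrite scale0r.
have QZ a u : Q u -> Q (a *: u) by move=> h; rewrite -[_ *: _]addr0; exact: Ql.
have [t E] := span_mono ff v.
have := eigcomp_eigen (k%:~R / 2%:R) L0_lin hv; rewrite eqxx {1}E eigcomp_sum => <-.
elim: t {E} => [|[a l] t IH]; first by rewrite big_nil.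
rewrite big_cons /=; apply: Ql => //; rewrite (eigcomp_mono ff).
case: eqP => // /eqP; rewrite [(wt2 l)%:R](pmulrn _ (wt2 l)) half_int_inj => /eqP hk.
have [ul|nul] := boolP (uniq l); last by rewrite (mono_nuniq ff nul).
have [|S hS] := @lst_surj R N l ul.
  move=> m /w2_le_wt2; rewrite /w2; move: kN; rewrite hk lez_nat => kN h; lia.
have [b ->] := mono_perm ff hS; apply: QZ.
exists (fun S' => (S' == S)%:R); rewrite (bigD1 S) /=; last by rewrite /wtP -(wt2_perm hS) hk.
rewrite eqxx scale1r big1 ?addr0 // => S' /andP[_ /negPf ->]; exact: scale0r.
Qed.

Section TraceOfVector.
Variables (z tau x : C) (Y : Type) (ys : seq Y) (c : Y -> C) (f : Y -> 'I_R -> nat).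
Let v := \sum_(y <- ys) c y *: bprod psi (f y).
Let phiv y := phi psi (fun r => dpoly (f y r) \Po (cexp x *: 'X)) (enum 'I_R).
Let v' := \sum_(y <- ys) c y *: phiv y.

Lemma Delta_v : DeltaQ psi x v v'.
Proof. by apply: (DeltaQ_sum ff) => y _; exact: (DeltaQ_bprod ff). Qed.

Lemma homog_v' : homog v'.
Proof. by apply: homog_sum => y _; apply: homogZ; exact: (homog_phi ff). Qed.

Lemma size_evpoly_prod N (S : label R N) (g : 'I_R -> {poly C}) :
  (size (\prod_r evpoly (lst S) N r (g r))%R <= (\sum_r size (g r)).+1)%N.
Proof.
elim/big_ind2 : _ => [|p1 n1 p2 n2 h1 h2|r _].
- by rewrite size_poly1.
- by apply: (leq_trans (size_polyMleq _ _)); lia.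
by apply: leq_trans (size_poly _ _) _.
Qed.

(** The sum over the modes n with the powers z^(-n-1) evaluates the polynomial of [diag_phi] at 1/z. *)
Lemma diag_eval : exists M0 : nat, forall M N (S : label R N), (M0 <= M)%N ->
  \sum_(m < M) cexp (- (x * (-1 + m%:Z + 1)%:~R)) * diag psi (lst S) v' (-1 + m%:Z)
  = \sum_(y <- ys) c y * \prod_r lev (f y r) (S r).
Proof.
have one y : exists M0 : nat, forall M N (S : label R N), (M0 <= M)%N ->
   \sum_(m < M) cexp (- (x * (-1 + m%:Z + 1)%:~R)) * diag psi (lst S) (phiv y) (-1 + m%:Z)
   = \prod_r lev (f y r) (S r).
  eexists => M N S hM.
  have hb := @lst_bound R N S; have us := uniq_lst S.
  have [h _] := diag_phi ff us hb (fun r => dpoly (f y r) \Po (cexp x *: 'X)) (enum_uniq 'I_R).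
  have hp := leq_trans (size_evpoly_prod S (fun r => dpoly (f y r) \Po (cexp x *: 'X))) hM.
  rewrite big_enum /= in h.
  under [RHS]eq_bigr do rewrite -labelev_lst -(labelevE us hb _ _ (cexp_neq0 x)).
  rewrite -horner_prod (horner_coef_wide _ hp); apply: eq_bigr => m _.
  rewrite (_ : -1 + m%:Z = m%:Z - 1); last by rewrite addrC.
  rewrite h subrK mulrC; congr (_ * _).
  by rewrite cexpN exprVn -pmulrn -cexpMn.
rewrite /v'; elim: (ys) => [|y t [M1 h1]].
  exists 0%N => M N S _; rewrite !big_nil big1 // => m _.
  by rewrite diag0 // mulr0.
have [M2 h2] := one y; exists (maxn M1 M2) => M N S; rewrite geq_max => /andP[hM1 hM2].
rewrite !big_cons -(h1 _ _ _ hM1) -(h2 _ _ _ hM2) mulr_sumr -big_split /=.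
apply: eq_bigr => m _; rewrite diagD // diagZ //; ring.
Qed.

(** The trace of a weight space as a sum over Fock states, for all truncations N >= k. *)
Lemma gtrace_termE N (k : int) : k <= N%:Z ->
  gtrace_term (ZJ_op psi v z tau x) k = prefac R z tau *
    \sum_(S : label R N | wtP k S) \sum_(y <- ys) c y *
      \prod_r ((\prod_(m in S r) dmode z tau (m.1, val m.2)) * lev (f y r) (S r)).
Proof.
move=> kN; have [M1 h1] := ZJ_op_support ff z tau homog_v' Delta_v.
have [M2 h2] := diag_eval; set M := maxn M1 M2.
pose X := ZJ_op psi v z tau x.
have Xlin n : islin (X n) := ZJ_op_lin ff z tau Delta_v n.
pose T w := \sum_(n \in [set: int]) eigcomp L0 (X n w) (k%:~R / 2%:R : C).
(* on a weight space only the modes n with -1 <= n < M - 1 contribute *)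
have TE w : espace L0 (k%:~R / 2%:R : C) w ->
    T w = \sum_(m < M) eigcomp L0 (X (-1 + m%:Z) w) (k%:~R / 2%:R).
  move=> hw; apply: fsum_int => n hn; apply: h1 => //; move: hn; apply: contra => /andP[-> h] /=.
  by apply: lt_le_trans h _; rewrite lerD2l lez_nat leq_maxl.
have Pw (c' : label R N -> C) : espace L0 (k%:~R / 2%:R : C) (\sum_(S | wtP k S) c' S *: mono (lst S)).
  by apply/(espace_L0P _ kN); exists c'.
have Pm (S : label R N) : wtP k S -> espace L0 (k%:~R / 2%:R : C) (mono (lst S)).
  by move=> /eqP <-; rewrite /espace /= (L0_mono ff) -pmulrn.
rewrite /gtrace_term -/X -/(T).
rewrite (@ftrace_dual K V (label R N) (wtP k) (fun S => mono (lst S)) (fun S => dual (lst S))).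
- rewrite mulr_sumr; apply: eq_bigr => S hS; rewrite -/(T _) (TE _ (Pm _ hS)).
  rewrite (islinf_sum (dual_linf ff _)).
  transitivity (\sum_(m < M) dual (lst S) (X (-1 + m%:Z) (mono (lst S)))).
    apply: eq_bigr => m _.
    rewrite (left_eigen_comp _ L0_lin (dual_linf ff _) (dual_L0 ff _) (hasdec_L0 _)) ifT //.
    by move/eqP: hS => <-; rewrite -pmulrn.
  under eq_bigr do rewrite (dual_ZJ_op ff z tau Delta_v).
  rewrite -mulr_sumr h2 ?leq_maxr // -mulrA; congr (_ * _).
  rewrite prod_lst mulr_sumr; apply: eq_bigr => y _.
  by rewrite mulrCA -big_split.
- by move=> S; exact: dual_linf.
- by move=> S S' _ _; exact: dual_mono_lst.
- by move=> w; exact: espace_L0P.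
- move=> c'; change (T (\sum_(S | wtP k S) c' S *: mono (lst S)) =
    \sum_(S | wtP k S) c' S *: T (mono (lst S))).
  transitivity (\sum_(S | wtP k S) c' S *:
      \sum_(m < M) eigcomp L0 (X (-1 + m%:Z) (mono (lst S))) (k%:~R / 2%:R)).
    rewrite TE //.
    under [RHS]eq_bigr do rewrite scaler_sumr.
    rewrite [RHS]exchange_big /=; apply: eq_bigr => m _.
    rewrite (islin_sum (Xlin _)).
    rewrite -[LHS]/(eigcomp L0 (\sum_(S | wtP k S) X (-1 + m%:Z) (c' S *: mono (lst S))) _).
    rewrite (eq_bigr (fun S => c' S *: X (-1 + m%:Z) (mono (lst S)))); last first.
      by move=> S _; rewrite (islinZ (Xlin _)).
    by rewrite -big_filter eigcomp_sum big_filter.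
  by apply: eq_bigr => S hS; rewrite TE //; exact: Pm.
move=> S hS; rewrite -/(T _) (TE _ (Pm _ hS)) /espace /= (islin_sum L0_lin) scaler_sumr.
by apply: eq_bigr => m _; exact: eigcomp_espace (hasdec_L0 _).
Qed.

End TraceOfVector.
End TraceTerms.

(** * Sums over fermion configurations *)

Section SubsetSums.
Variables (F : fieldType) (T : finType).
Implicit Types (d e : T -> F) (c : F).

Lemma sum_subsets_prod d : \sum_(s : {set T}) \prod_(m in s) d m = \prod_m (1 + d m).
Proof.
under [RHS]eq_bigr do rewrite addrC.
by rewrite bigA_distr; apply: eq_bigr => s _; rewrite big_mkcond.
Qed.

(** Differentiate sum_s prod_(m in s) d_m = prod_m (1 + d_m) in each d_m. *)
Lemma sum_subsets_affine d e c : (forall m, 1 + d m != 0) ->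
  \sum_(s : {set T}) \prod_(m in s) d m * (c + \sum_(m in s) e m)
  = \prod_m (1 + d m) * (c + \sum_m e m * (d m / (1 + d m))).
Proof.
move=> d0; rewrite (eq_bigr (fun s : {set T} => \prod_(m in s) d m * c + \prod_(m in s) d m * \sum_(m in s) e m));
  last by move=> s _; rewrite -mulrDr.
rewrite big_split /= -mulr_suml sum_subsets_prod mulrDr; congr (_ + _).
transitivity (\sum_(s : {set T}) \sum_m e m * ((m \in s)%:R * \prod_(m in s) d m)).
  apply: eq_bigr => s _; rewrite mulr_sumr big_mkcond /=; apply: eq_bigr => m _.
  by case: (m \in s); rewrite ?mul1r ?mul0r ?mulr0 // mulrC.
rewrite exchange_big mulr_sumr; apply: eq_bigr => m _; rewrite -mulr_sumr mulrCA; congr (_ * _).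
have -> : \prod_m (1 + d m) * (d m / (1 + d m)) = \prod_i (d i + (i != m)%:R).
  rewrite (bigD1 m) //= [RHS](bigD1 m) //= eqxx addr0.
  rewrite [LHS]mulrAC mulrCA mulfV // mulr1; congr (_ * _).
  by apply: eq_bigr => i ->; rewrite addrC.
rewrite bigA_distr; apply: eq_bigr => s _.
have [ms|ms] := boolP (m \in s); last by rewrite mul0r [RHS](bigD1 m) //= (negPf ms) eqxx mul0r.
rewrite mul1r big_mkcond; apply: eq_bigr => i _; case: ifPn => // ns.
by rewrite (_ : i != m) //; apply: contraNneq ns => ->.
Qed.

End SubsetSums.

Lemma sum_modes (A : zmodType) N (F : bool -> nat -> A) :
  \sum_(m : bool * 'I_N) F m.1 m.2 = \sum_(j < N) (F true j + F false j).
Proof.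
rewrite -(pair_bigA _ (fun e (j : 'I_N) => F e j)) /= big_bool /=.
by rewrite big_split.
Qed.
Lemma prod_modes (A : comNzRingType) N (F : bool -> nat -> A) :
  \prod_(m : bool * 'I_N) F m.1 m.2 = \prod_(j < N) (F true j * F false j).
Proof.
rewrite -(pair_bigA _ (fun e (j : 'I_N) => F e j)) /= big_bool /=.
by rewrite big_split.
Qed.

Section RealBounds.
Context {K : realType}.

(** n^k <= k! e^(a n) / a^k, with a so small that r e^a < 1. *)
Lemma geom_pow_bound (r : K) k : 0 <= r < 1 ->
  exists B, forall n, \sum_(i < n) i.+1%:R ^+ k * r ^+ i <= B.
Proof.
move=> /andP[r0 r1]; pose a := (1 - r) / 2%:R.
have a0 : 0 < a by rewrite /a; lra.
have ra : r * expR a < 1.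
  have h := expR_ge1Dx (- a); rewrite expRN in h.
  have h2 : r < (expR a)^-1 by apply: lt_le_trans h; rewrite /a; lra.
  by rewrite -ltr_pdivlMr ?expR_gt0 // mul1r.
have ra0 : 0 <= r * expR a by rewrite mulr_ge0 ?expR_ge0.
clearbody a.
exists (k`!%:R / a ^+ k * expR a * (1 - r * expR a)^-1) => n.
apply: le_trans (ler_wpM2l _ (geometric_bound _ n)); last by rewrite ra0 ra.
  rewrite mulr_sumr; apply: ler_sum => i _.
  have pw : i.+1%:R ^+ k <= k`!%:R / a ^+ k * expR a ^+ i.+1 :> K.
    have h : (a * i.+1%:R) ^+ k / k`!%:R <= expR a ^+ i.+1.
      rewrite -expRM_natr.
      apply: (@le_trans _ _ (\sum_(j < k.+1) (a * i.+1%:R) ^+ j / j`!%:R)).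
        rewrite big_ord_recr /= lerDr sumr_ge0 // => j _.
        by rewrite mulr_ge0 ?invr_ge0 ?ler0n // exprn_ge0 // mulr_ge0 // ltW.
      by apply: real_exp_bound; rewrite mulr_ge0 // ltW.
    rewrite ler_pdivrMr in h; last by rewrite ltr0n fact_gt0.
    rewrite mulrAC ler_pdivlMr ?exprn_gt0 // mulrC -exprMn [k`!%:R * _]mulrC //.
  rewrite exprS in pw.
  have -> : k`!%:R / a ^+ k * expR a * (r * expR a) ^+ i
    = (k`!%:R / a ^+ k * (expR a * expR a ^+ i)) * r ^+ i by rewrite exprMn; ring.
  by apply: ler_wpM2r => //; exact: exprn_ge0.
by rewrite !mulr_ge0 ?expR_ge0 ?invr_ge0 ?exprn_ge0 ?ler0n // ltW.
Qed.

(** There is room between a and 1. *)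
Lemma rho_exists (a : K) : 0 <= a < 1 -> exists2 rho, 1 < rho & rho ^+ 2 * a < 1.
Proof.
move=> /andP[a0 a1]; exists (1 + (1 - a) / 4%:R); first lra.
rewrite expr2; set u := (1 - a) / 4%:R; have -> : a = 1 - 4%:R * u by rewrite /u; field.
have u0 : 0 < u by rewrite /u; lra.
nra.
Qed.

Lemma invrX_cvg0 (rho C0 : K) : 1 < rho -> (fun n => C0 * rho^-1 ^+ n) @ \oo --> (0 : K).
Proof.
move=> r1; rewrite -(mulr0 C0); apply: cvgMr; apply: cvg_expr.
have r0 : 0 < rho by lra.
by rewrite ger0_norm ?invr_ge0 ?ltW // invf_lt1.
Qed.

End RealBounds.

Section LabelSums.
Context {K : realType}.
Local Notation C := K[i].
Variables (z tau : C).
Hypothesis tau_gt0 : 0 < complex.Im tau.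
Hypothesis z_generic : forall a b : int, z <> a%:~R + b%:~R * tau.
Local Notation q := (e2pii tau).
Local Notation zeta := (e2pii z).
Local Notation dm := (dmode z tau).

Lemma dm_neq e j : 1 + dm (e, j) != 0.
Proof.
rewrite /dmode; case: e => /=; first exact: pfactor_neq0.
exact: nfactor_neq0.
Qed.

Definition onesum N k : C :=
  \sum_(s : {set bool * 'I_N}) (\prod_(m in s) dm (m.1, val m.2)) * lev k s.

Lemma onesumE N k : onesum N k = \prod_(j < N) ((1 - zeta * q ^+ j.+1) * (1 - zeta^-1 * q ^+ j)) *
  (if k is k'.+1 then bern k - \sum_(j < N) ((j.+1)%:R ^+ k' / k'`!%:R * pcoef z tau j.+1
      - (- j%:R) ^+ k' / k'`!%:R * ncoef z tau j) else 1).
Proof.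
have P : \prod_(m : bool * 'I_N) (1 + dm (m.1, val m.2))
   = \prod_(j < N) ((1 - zeta * q ^+ j.+1) * (1 - zeta^-1 * q ^+ j)).
  exact: (@prod_modes _ N (fun e j => 1 + dm (e, j))).
rewrite -P; case: k => [|k]; rewrite /onesum /lev.
  rewrite mulr1 -sum_subsets_prod; apply: eq_bigr => s _; exact: mulr1.
rewrite (sum_subsets_affine (fun m : bool * 'I_N => lterm k m.1 m.2)); last by move=> m; exact: dm_neq.
congr (_ * (_ + _)).
rewrite (@sum_modes _ N (fun e j => lterm k e j * (dm (e, j) / (1 + dm (e, j))))) -sumrN.
apply: eq_bigr => j _; rewrite /lterm /expterm /dmode /pcoef /ncoef.
by rewrite [(true, _).1]/= [(true, _).2]/= [(false, _).1]/= [(false, _).2]/= !mulNr !mulrN opprD opprK.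
Qed.

(** The product tends to theta_1/eta by the triple product, and the sum to - G_k.  The term j = 0 of the
sum over the sign - gives the constant (1 - zeta)^(-1) of G_1, and the summands there are
shifted by one against those of [gterm]. *)
Lemma onesum_cvg k : cvgto (fun N => 'i%C * e2pii (z / 2%:R) * e2pii (tau / 12%:R) * onesum N k)
  (theta1 z tau / eta tau * - Gtilde z tau k).
Proof.
have h1 := theta_eta_cvg z tau_gt0.
case: k => [|k].
  rewrite (Gtilde0 tau_gt0 z_generic) opprK mulr1; apply: eq_cvgto h1 => N.
  by rewrite onesumE mulr1.
rewrite (GtildeE tau_gt0 z_generic) /gcoef.
pose s n : C := bern k.+1 - \sum_(j < n) ((j.+1)%:R ^+ k / k`!%:R * pcoef z tau j.+1
      - (- j%:R) ^+ k / k`!%:R * ncoef z tau j).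
suff h2 : cvgto s (- (- bern k.+1 + (if k == 0%N then (1 - zeta)^-1 else 0) + csum (gterm z tau k))).
  by apply: eq_cvgto (cvgtoM h1 h2) => N; rewrite onesumE [RHS]mulrA.
have hg := absum_csums (absum_gterm tau_gt0 z_generic k).
pose b j : C := (- j%:R) ^+ k / k`!%:R * ncoef z tau j.
have b0 : b 0%N = - (if k == 0%N then (1 - zeta)^-1 else 0).
  rewrite /b /ncoef; case: (k) => [|k']; last by rewrite mulr0n oppr0 exprS !mul0r.
  have := pfactor_neq0 z_generic 0; rewrite !expr0 mulr1 divr1 mul1r => h.
  have hz := e2pii_neq0 z; move: h hz; set w := e2pii z => h hz.
  have h' : 1 - w^-1 != 0 by have := nfactor_neq0 z_generic 0; rewrite expr0 mulr1.
  rewrite /= mulr1; apply: (mulfI h'); rewrite mulrCA mulfV // mulr1.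
  by field; rewrite hz h.
have bcvg : cvgto b 0.
  have [B B0 hB] := coef_bound tau_gt0 z_generic.
  have [D hD] := @geom_pow_bound _ (cn q) k (introT andP (conj (cn_ge0 _) (cn_q_lt1 tau_gt0))).
  apply: absum_cvg0; apply: (@absum_le _ _ (fun j => B * (j.+1%:R ^+ k * cn q ^+ j))); last first.
    by exists (B * D) => n; rewrite -mulr_sumr ler_wpM2l // ltW.
  move=> j; have [_ h2] := hB j; rewrite /b.
  have -> : cn ((- j%:R) ^+ k / k`!%:R * ncoef z tau j) = j%:R ^+ k / k`!%:R * cn (ncoef z tau j).
    by set w := ncoef _ _ _; rewrite cnM cnM cnX cnN cnV !cn_nat.
  have -> : B * (j.+1%:R ^+ k * cn q ^+ j) = j.+1%:R ^+ k * (B * cn q ^+ j) by ring.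
  have p0 : 0 <= j%:R ^+ k / k`!%:R :> K by rewrite mulr_ge0 ?exprn_ge0 ?invr_ge0 ?ler0n.
  apply: (ler_pM p0 (cn_ge0 _) _ h2).
  rewrite -[leRHS]mulr1; apply: ler_pM; rewrite ?exprn_ge0 ?invr_ge0 ?ler0n //.
    by rewrite lerXn2r ?nnegrE ?ler0n // ler_nat.
  by rewrite invf_le1 ?ltr0n ?fact_gt0 // ler1n fact_gt0.
(* summation with the index shifted by one, leaving the boundary terms b 0 and b n *)
have sE n : s n = bern k.+1 - (\sum_(j < n) gterm z tau k j - b 0%N + b n).
  rewrite /s; congr (_ - _); elim: n => [|n IH]; first by rewrite !big_ord0 add0r addNr.
  rewrite !big_ord_recr /= IH -/(b n) /gterm -/(b n.+1); ring.
have hl := cvgtoB (cvgto_cst (bern k.+1)) (cvgtoD (cvgtoB (csums_toE.1 hg) (cvgto_cst (b 0%N))) bcvg).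
move: hl; rewrite b0 => hl.
rewrite (_ : - _ = bern k.+1 - (csum (gterm z tau k) - - (if k == 0%N then (1 - zeta)^-1 else 0) + 0)); last by ring.
by apply: eq_cvgto hl => n; rewrite sE b0.
Qed.

End LabelSums.

Section TailBound.
Context {K : realType}.
Local Notation C := K[i].
Variables (z tau : C).
Hypothesis tau_gt0 : 0 < complex.Im tau.
Hypothesis z_generic : forall a b : int, z <> a%:~R + b%:~R * tau.
Local Notation q := (e2pii tau).
Local Notation zeta := (e2pii z).
Local Notation dm := (dmode z tau).

Lemma prod_exp_bound_fin (T : finType) (x : T -> K) : (forall m, 0 <= x m) ->
  \prod_m (1 + x m) <= expR (\sum_m x m).
Proof.
move=> x0; suff /andP[] : 0 <= \prod_m (1 + x m) <= expR (\sum_m x m) by [].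
elim/big_rec2 : _ => [|m s p _ /andP[p0 h]]; first by rewrite expR0 ler01 lexx.
have x1 : 0 <= 1 + x m by rewrite addr_ge0.
by rewrite mulr_ge0 //= expRD ler_pM // expR_ge1Dx.
Qed.

(** A majorant of the absolute value of [lev] with the same additive structure, to which
[sum_subsets_affine] applies again. *)
Definition levb N k (s : {set bool * 'I_N}) : K :=
  if k is k'.+1 then cn (bern k : C) + \sum_(m in s) (val m.2).+1%:R ^+ k' else 1.

Lemma lev_le N k (s : {set bool * 'I_N}) : cn (lev k s : C) <= levb k s.
Proof.
case: k => [|k]; first by rewrite /lev cn1.
rewrite /lev /levb; apply: le_trans (cnD _ _) _; rewrite lerD2l.
apply: le_trans (cn_sum _ _ _) _; apply: ler_sum => -[e j] _ /=.
have fk (a : K) : 0 <= a -> a / k`!%:R <= a.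
  move=> a0; rewrite -[leRHS]mulr1; apply: ler_wpM2l => //.
  by rewrite invf_le1 ?ltr0n ?fact_gt0 // ler1n fact_gt0.
rewrite /lterm; case: e; rewrite ?cnN cn_expterm ?cnN cn_nat.
  by apply: fk; rewrite exprn_ge0 ?ler0n.
apply: (le_trans (fk _ _)); first by rewrite exprn_ge0 ?ler0n.
by rewrite lerXn2r ?nnegrE ?ler0n // ler_nat.
Qed.

Section Weight.
Variable rho : K.
Hypotheses (rho1 : 1 < rho) (rhoq : rho ^+ 2 * cn q < 1).

(** The power of rho penalizes weight, so that a cut-off by weight gains a power of rho. *)
Definition wdm (m : bool * nat) : K := rho ^+ m.2.*2.+1 * cn (dm m).

Let rho_ge0 : 0 <= rho. Proof. exact: le_trans ler01 (ltW rho1). Qed.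

Lemma wdm_ge0 m : 0 <= wdm m.
Proof. by rewrite mulr_ge0 ?exprn_ge0 ?cn_ge0. Qed.

Let D := rho * (cn zeta * cn q + cn (zeta^-1)).
Lemma wdm_sum j : wdm (true, j) + wdm (false, j) = D * (rho ^+ 2 * cn q) ^+ j.
Proof.
rewrite /wdm /dmode /D [(true, j).1]/= [(true, j).2]/= [(false, j).1]/= [(false, j).2]/= !cnN.
have -> : cn (zeta * q ^+ j.+1) = cn zeta * cn q ^+ j.+1 by move: zeta q => a b; rewrite cnM cnX.
have -> : cn (zeta^-1 * q ^+ j) = cn zeta^-1 * cn q ^+ j by move: zeta^-1 q => a b; rewrite cnM cnX.
move: (cn zeta) (cn zeta^-1) (cn q) => a b c; clear.
have -> : rho ^+ j.*2.+1 = rho * (rho ^+ 2) ^+ j by rewrite exprS -exprM mul2n.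
rewrite [(_ * c) ^+ _]exprMn [c ^+ _]exprS; move: ((rho ^+ 2) ^+ j) (c ^+ j) => u w; ring.
Qed.

Lemma D_ge0 : 0 <= D.
Proof. by rewrite mulr_ge0 // addr_ge0 ?cn_ge0 // mulr_ge0 ?cn_ge0. Qed.

(** Since rho^2 |q| < 1, the weighted modes are still summable, also with polynomial factors. *)
Lemma weight_bound k : exists B, forall N,
  \sum_(s : {set bool * 'I_N}) (\prod_(m in s) wdm (m.1, val m.2)) * levb k s <= B.
Proof.
have r01 : 0 <= rho ^+ 2 * cn q < 1 by rewrite rhoq mulr_ge0 ?exprn_ge0 ?cn_ge0.
have [E1 hE1] : exists E, forall N, \sum_(m : bool * 'I_N) wdm (m.1, val m.2) <= E.
  exists (D * (1 - rho ^+ 2 * cn q)^-1) => N.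
  rewrite (@sum_modes _ N (fun e j => wdm (e, j))).
  under eq_bigr do rewrite wdm_sum.
  rewrite -mulr_sumr; apply: ler_wpM2l; [exact: D_ge0 | exact: geometric_bound].
have hprod N : \prod_(m : bool * 'I_N) (1 + wdm (m.1, val m.2)) <= expR E1.
  apply: (le_trans (prod_exp_bound_fin _)) => [m|]; first exact: wdm_ge0.
  by rewrite ler_expR.
case: k => [|k].
  exists (expR E1) => N; under eq_bigr do rewrite mulr1.
  by rewrite sum_subsets_prod; exact: hprod.
have [E2 hE2] := geom_pow_bound k r01.
exists (expR E1 * (cn (bern k.+1 : C) + D * E2)) => N.
rewrite /levb (sum_subsets_affine (fun m : bool * 'I_N => (val m.2).+1%:R ^+ k)); last first.
  by move=> m; rewrite gt_eqF // ltr_pwDl // wdm_ge0.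
have b0 : 0 <= cn (bern k.+1 : C) by exact: cn_ge0.
have t0 (j : nat) e : 0 <= j.+1%:R ^+ k * (wdm (e, j) / (1 + wdm (e, j))).
  have w0 := wdm_ge0 (e, j).
  by rewrite mulr_ge0 ?exprn_ge0 ?ler0n // divr_ge0 // addr_ge0.
apply: ler_pM => //.
- by apply: prodr_ge0 => m _; rewrite addr_ge0 // wdm_ge0.
- by rewrite addr_ge0 // sumr_ge0 // => m _; exact: t0.
rewrite lerD2l (@sum_modes _ N (fun e j => j.+1%:R ^+ k * (wdm (e, j) / (1 + wdm (e, j))))).
apply: le_trans (ler_wpM2l D_ge0 (hE2 N)); rewrite mulr_sumr; apply: ler_sum => j _.
have wl e : wdm (e, val j) / (1 + wdm (e, val j)) <= wdm (e, val j).
  have w0 := wdm_ge0 (e, val j); rewrite ler_pdivrMr; last by rewrite ltr_pwDl.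
  by rewrite mulrDr mulr1 lerDl mulr_ge0.
rewrite -mulrDr mulrCA ler_wpM2l ?exprn_ge0 ?ler0n //.
by rewrite -wdm_sum; apply: lerD; exact: wl.
Qed.

End Weight.
End TailBound.

(** * The twisted one-point function *)

Section LabelLimit.
Context {K : realType}.
Local Notation C := K[i].
Variable R : nat.
Variables (z tau : C).
Hypothesis tau_gt0 : 0 < complex.Im tau.
Hypothesis z_generic : forall a b : int, z <> a%:~R + b%:~R * tau.
Local Notation q := (e2pii tau).
Local Notation dm := (dmode z tau).

Definition labelterm (f : 'I_R -> nat) N (S : label R N) : C :=
  \prod_r ((\prod_(m in S r) dm (m.1, val m.2)) * lev (f r) (S r)).

Lemma sum_labels (A : comNzRingType) N (F : 'I_R -> {set bool * 'I_N} -> A) :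
  \sum_(S : label R N) \prod_r F r (S r) = \prod_r \sum_s F r s.
Proof. by rewrite bigA_distr_bigA. Qed.

Lemma pow_wt2 (rho : K) (l : seq (mode R)) : rho ^+ wt2 l = \prod_(m <- l) rho ^+ w2 m.
Proof.
elim: l => [|m l IH]; first by rewrite big_nil expr0.
by rewrite big_cons -IH -exprD.
Qed.

(** A state of doubled weight at least N satisfies 1 <= rho^(-N) rho^weight, and the sum of all states
weighted by rho^weight is bounded by a product over r. *)
Lemma label_tail (f : 'I_R -> nat) : exists B, exists2 rho : K, 1 < rho & forall N,
  cn (\sum_(S : label R N | ~~ (wt2 (lst S) < N)%N) labelterm f S) <= B * rho^-1 ^+ N.
Proof.
have [rho r1 rq] := @rho_exists _ (cn q) (introT andP (conj (cn_ge0 _) (cn_q_lt1 tau_gt0))).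
have r0 : 0 < rho by exact: lt_trans ltr01 r1.
have [B hB] := choice (fun r => weight_bound z r1 rq (f r)).
exists (\prod_r B r), rho => // N.
pose wt (S : label R N) : K := \prod_r ((\prod_(m in S r) wdm z tau rho (m.1, val m.2)) * levb (f r) (S r)).
have s0 (s : {set bool * 'I_N}) k : 0 <= (\prod_(m in s) wdm z tau rho (m.1, val m.2)) * levb k s.
  apply: mulr_ge0; first by apply: prodr_ge0 => m _; exact: wdm_ge0.
  by apply: le_trans (cn_ge0 _) (lev_le _ _).
have wt0 S : 0 <= wt S by apply: prodr_ge0 => r _; exact: s0.
have hw (S : label R N) : ~~ (wt2 (lst S) < N)%N -> cn (labelterm f S) <= rho^-1 ^+ N * wt S.
  rewrite -leqNgt => hS.
  rewrite mulrC exprVn ler_pdivlMr ?exprn_gt0 //.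
  apply: (@le_trans _ _ (cn (labelterm f S) * rho ^+ wt2 (lst S))).
    by apply: ler_wpM2l; [exact: cn_ge0 | rewrite ler_weXn2l // ltW].
  rewrite pow_wt2 prod_lst /labelterm cn_prod -big_split /= /wt.
  apply: ler_prod => r _; rewrite mulr_ge0 ?cn_ge0 //=; last first.
    by apply: prodr_ge0 => m _; rewrite exprn_ge0 // ltW.
  set p := \prod_(m in S r) dm _; set w := \prod_(m in S r) rho ^+ _.
  rewrite cnM mulrAC.
  have -> : \prod_(m in S r) wdm z tau rho (m.1, val m.2) = cn p * w.
    by rewrite /p /w cn_prod -big_split; apply: eq_bigr => m _; rewrite /wdm mulrC.
  apply: ler_wpM2l; last exact: lev_le.
  by rewrite mulr_ge0 ?cn_ge0 //; apply: prodr_ge0 => m _; rewrite exprn_ge0 // ltW.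
apply: le_trans (cn_sum _ _ _) _.
apply: (@le_trans _ _ (\sum_(S : label R N) rho^-1 ^+ N * wt S)).
  rewrite big_mkcond; apply: ler_sum => S _; case: ifP => [/hw //|_].
  by rewrite mulr_ge0 // exprn_ge0 // invr_ge0 ltW.
rewrite -mulr_sumr mulrC; apply: ler_wpM2r; first by rewrite exprn_ge0 // invr_ge0 ltW.
rewrite (sum_labels (fun r s => (\prod_(m in s) wdm z tau rho (m.1, val m.2)) * levb (f r) s)).
by apply: ler_prod => r _; rewrite hB andbT sumr_ge0 // => s _; exact: s0.
Qed.

Lemma prefacE : 'i%C ^+ R * prefac R z tau =
  \prod_(r < R) ('i%C * e2pii (z / 2%:R) * e2pii (tau / 12%:R)) :> C.
Proof.
rewrite prodr_const card_ord /prefac.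
have -> : z * (R%:R / 2%:R) = z / 2%:R * R%:R by ring.
have -> : tau * (R%:R / 12%:R) = tau / 12%:R * R%:R by ring.
rewrite !e2piiMn mulrA.
by move: (e2pii (z / 2%:R)) (e2pii (tau / 12%:R)) => a b; rewrite !exprMn.
Qed.

(** The sum over all states with modes j < N is a product over r; the states of too large weight
in it are negligible by [label_tail]. *)
Lemma labels_cvg (f : 'I_R -> nat) :
  cvgto (fun N => 'i%C ^+ R * prefac R z tau *
           \sum_(S : label R N | (wt2 (lst S) < N)%N) labelterm f S)
    (\prod_r (theta1 z tau / eta tau * - Gtilde z tau (f r))).
Proof.
have [B [rho r1 hB]] := label_tail f.
have h1 : cvgto (fun N => \sum_(S : label R N | ~~ (wt2 (lst S) < N)%N) labelterm f S) 0.
  apply: (@cvgto_squeeze _ _ _ (fun N => B * rho^-1 ^+ N)) => [N|]; last exact: invrX_cvg0.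
  by rewrite subr0.
have h2 : cvgto (fun N => \prod_r ('i%C * e2pii (z / 2%:R) * e2pii (tau / 12%:R) * onesum z tau N (f r)))
     (\prod_r (theta1 z tau / eta tau * - Gtilde z tau (f r))).
  by apply: cvgto_prod => r _; exact: onesum_cvg.
have h3 := cvgtoB h2 (cvgtoZ ('i%C ^+ R * prefac R z tau) h1).
rewrite mulr0 subr0 in h3; apply: eq_cvgto h3 => N.
rewrite big_split /= -prefacE -mulrBr; congr (_ * _).
rewrite -(sum_labels (fun r s => (\prod_(m in s) dm (m.1, val m.2)) * lev (f r) s)).
by rewrite (bigID (fun S : label R N => (wt2 (lst S) < N)%N)) /= addrK.
Qed.

End LabelLimit.

Section CharacterValue.
Context {K : realType} {V : vosa K}.
Local Notation C := K[i].
Variable R : nat.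
Variable psi : bool -> 'I_R -> V.
Hypothesis ff : free_fermions psi.
Variables (z tau x : C).
Hypothesis tau_gt0 : 0 < complex.Im tau.
Hypothesis z_generic : forall a b : int, z <> a%:~R + b%:~R * tau.
Variables (Y : Type) (ys : seq Y) (c : Y -> C) (f : Y -> 'I_R -> nat).
Let v := \sum_(y <- ys) c y *: bprod psi (f y).
Let value : C := (theta1 z tau / eta tau) ^+ R * \sum_(y <- ys) c y * \prod_r (- Gtilde z tau (f y r)).

(** There are no states of negative weight. *)
Lemma gtrace_term_neg n : gtrace_term (ZJ_op psi v z tau x) (- n.+1%:Z) = 0.
Proof.
rewrite (@gtrace_termE _ _ _ _ ff z tau x _ ys c f 0) ?oppr_le0 //.
by rewrite big_pred0 ?mulr0 // => S; apply/negbTE/negP => /eqP; lia.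
Qed.

(** The partial sums of the trace are the sums over the states of bounded weight. *)
Lemma ZJ_sums : csums_to (fun n => 'i%C ^+ R * gtrace_term (ZJ_op psi v z tau x) n%:Z) value.
Proof.
apply/csums_toE.
have h : cvgto (fun N => \sum_(y <- ys) c y * ('i%C ^+ R * prefac R z tau *
           \sum_(S : label R N | (wt2 (lst S) < N)%N) labelterm z tau (f y) S)) value.
  rewrite /value mulr_sumr; apply: cvgto_sum => y _.
  have := cvgtoZ (c y) (labels_cvg tau_gt0 z_generic (f y)).
  have -> : \prod_r (theta1 z tau / eta tau * - Gtilde z tau (f y r)) =
    (theta1 z tau / eta tau) ^+ R * \prod_r - Gtilde z tau (f y r).
    by rewrite big_split prodr_const card_ord.
  by rewrite [X in cvgto _ X -> _]mulrCA; apply.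
apply: eq_cvgto h => N; rewrite -mulr_sumr.
transitivity ('i%C ^+ R * (prefac R z tau * \sum_(S : label R N | (wt2 (lst S) < N)%N)
    \sum_(y <- ys) c y * labelterm z tau (f y) S)).
  rewrite exchange_big mulrA mulr_sumr; apply: eq_bigr => y _.
  by rewrite -mulr_sumr mulrCA.
congr (_ * _).
have -> : \sum_(i < N) gtrace_term (ZJ_op psi v z tau x) (i : nat)%:Z =
   prefac R z tau * \sum_(i < N) \sum_(S : label R N | wtP (i : nat)%:Z S)
      \sum_(y <- ys) c y * labelterm z tau (f y) S.
  rewrite mulr_sumr; apply: eq_bigr => i _; apply: (gtrace_termE ff).
  by rewrite lez_nat ltnW.
congr (_ * _).
rewrite (eq_bigr (fun i : 'I_N => \sum_(S : label R N) if wt2 (lst S) == i then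
   \sum_(y <- ys) c y * labelterm z tau (f y) S else 0)); last first.
  by move=> i _; rewrite big_mkcond.
rewrite [RHS]exchange_big [LHS]big_mkcond; apply: eq_bigr => S _ /=.
case: ltnP => h.
  rewrite (bigD1 (Ordinal h)) //= eqxx [X in _ = _ + X]big1 ?addr0 // => i /negP hi.
  by rewrite ifF //; apply/negbTE/negP => /eqP e; apply: hi; apply/eqP/val_inj.
by rewrite big1 // => i _; rewrite ifF // gtn_eqF // (leq_trans (ltn_ord i)).
Qed.

Lemma i_neq0 : 'i%C != 0 :> C.
Proof. by rewrite -cn_eq0 cn_i oner_eq0. Qed.

(** Both one-sided series of the trace converge: the one over the negative weights is zero, and the
other one is known up to the invertible factor i^R. *)
Lemma ZJ_value : ZJ_cvg psi v z tau x /\ ZJ psi v z tau x = value.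
Proof.
have iR : 'i%C ^+ R != 0 :> C by rewrite expf_neq0 // i_neq0.
have h1 : csums_to (fun n => gtrace_term (ZJ_op psi v z tau x) n%:Z) (('i%C ^+ R)^-1 * value).
  have := csumsZ ('i%C ^+ R)^-1 ZJ_sums; apply: eq_csums => n.
  by rewrite mulrA mulVf // mul1r.
have h2 : csums_to (fun n => gtrace_term (ZJ_op psi v z tau x) (- n.+1%:Z)) 0.
  apply: (@eq_csums _ (fun=> 0)) => [n|]; first by rewrite gtrace_term_neg.
  apply/csums_toE; apply: eq_cvgto (cvgto_cst 0) => N; by rewrite big1.
split; first by split; [exact: csums_to_summable h1 | exact: csums_to_summable h2].
by rewrite /ZJ /gtrace /zsum (csums_to_csum h1) (csums_to_csum h2) addr0 mulrA mulfV // mul1r.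
Qed.

End CharacterValue.

(** * Hook labels *)

Section HookLabels.
Variable R : nat.
Implicit Types (r : 'I_R) (A : {set 'I_R}).

(** The label of the partition 1^(R-k) k^1 with k at r, 1 on A and 0 elsewhere. *)
Definition hook r k A : 'I_R -> nat := fun s => if s == r then k else s \in A : nat.

Definition hooks n : {set 'I_R * {set 'I_R}} :=
  [set p : 'I_R * {set 'I_R} | (p.1 \notin p.2) && (#|p.2| == n)]%SET.

(** Choose r, then A in its complement. *)
Lemma card_hooks n : #|hooks n| = (R * 'C(R.-1, n))%N.
Proof.
rewrite -sum1_card (eq_bigl (fun p : 'I_R * {set 'I_R} => true && ((p.1 \notin p.2) && (#|p.2| == n)))); last first.
  by move=> p; rewrite inE.
rewrite -(pair_big_dep predT (fun r A => (r \notin A) && (#|A| == n)) (fun _ _ => 1%N)) /=.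
rewrite (eq_bigr (fun=> 'C(R.-1, n))) ?sum_nat_const ?card_ord // => r _.
rewrite sum1dep_card -[R in RHS]card_ord -(cardsC1 r) -cards_draws.
apply: eq_card => A; rewrite !inE; congr (_ && _).
by rewrite -finset.setCS finset.setCK finset.sub1set inE.
Qed.

Variables (U : nmodType).

Lemma sum_hooks n (F : 'I_R -> {set 'I_R} -> U) :
  \sum_(p in hooks n) F p.1 p.2 = \sum_r \sum_(A : {set 'I_R} | (r \notin A) && (#|A| == n)) F r A.
Proof.
rewrite pair_big_dep /=; apply: eq_bigl => p; by rewrite inE.
Qed.

Lemma has_type_ones (f : {ffun 'I_R -> 'I_(sumn (nseq R 1%N)).+1}) : (0 < R)%N ->
  has_type f = [forall r, f r == 1%N :> nat].
Proof.
move=> R0; apply/forallP/forallP => h.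
  have R1 : (1 < (sumn (nseq R 1%N)).+1)%N by rewrite sumn_nseq mul1n ltnS.
  have := h (Ordinal R1); rewrite [(Ordinal R1 : nat) == 0%N]/= count_nseq /= mul1n => /eqP h1.
  move=> r; have : [set r | f r == Ordinal R1]%SET = [set: 'I_R]%SET.
    by apply/eqP; rewrite eqEcard finset.subsetT cardsT card_ord cardsE h1 /=.
  by move/finset.setP/(_ r); rewrite !inE => /eqP ->.
move=> j; rewrite size_nseq subnn count_nseq.
have [j1|j1] := eqVneq (j : nat) 1%N.
  rewrite j1 /= mul1n; apply/eqP; rewrite -[RHS]card_ord; apply: eq_card => r.
  by rewrite !inE -val_eqE /= (eqP (h r)) j1.
rewrite (_ : (if _ then _ else _) = 0%N); last first.
  by case: ifP => // _; rewrite /= eq_sym (negPf j1).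
rewrite (@eq_card0 _ _) // => r; rewrite !inE -val_eqE /= (eqP (h r)) eq_sym; exact/negbTE.
Qed.

Lemma sum_type_ones (F : ('I_R -> nat) -> U) : (0 < R)%N ->
  \sum_(f : {ffun 'I_R -> 'I_(sumn (nseq R 1%N)).+1} | has_type f) F (fun r => f r) = F (fun=> 1%N).
Proof.
move=> R0; have R1 : (1 < (sumn (nseq R 1%N)).+1)%N by rewrite sumn_nseq mul1n ltnS.
rewrite (big_pred1 [ffun=> Ordinal R1]) => [|f].
  by congr F; apply/funext => r; rewrite ffunE.
rewrite has_type_ones //; apply/forallP/eqP => [h|-> r]; last by rewrite ffunE.
by apply/ffunP => r; apply/val_inj; rewrite ffunE; exact/eqP/h.
Qed.

(** For k > 1 the position of k and the set of ones can be recovered from the label. *)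
Lemma sum_type_hook k (F : ('I_R -> nat) -> U) : (1 < k <= R)%N ->
  \sum_(f : {ffun 'I_R -> 'I_(sumn (k :: nseq (R - k)%N 1%N)).+1} | has_type f) F (fun r => f r)
  = \sum_(p in hooks (R - k)%N) F (hook p.1 k p.2).
Proof.
move=> /andP[k1 kR]; set n := sumn _.
have kn : (k < n.+1)%N by rewrite ltnS leq_addr.
pose h (p : 'I_R * {set 'I_R}) : {ffun 'I_R -> 'I_n.+1} := [ffun r => inord (hook p.1 k p.2 r)].
have hE p r : h p r = hook p.1 k p.2 r :> nat.
  rewrite ffunE inordK // /hook; case: ifP => // _; case: (_ \in _) => //; lia.
have hinj : {in hooks (R - k)%N &, injective h}.
  move=> [r A] [r' A']; rewrite !inE /= => /andP[rA _] /andP[rA' _] /ffunP E.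
  have e s : hook r k A s = hook r' k A' s by rewrite -(hE (r, A)) -(hE (r', A')) E.
  have rr : r = r'.
    have := e r; rewrite /hook eqxx; case: eqP => // _.
    by case: (_ \in _) => /= ek; move: k1; rewrite ek.
  rewrite -rr in rA' e *; congr (_, _); apply/finset.setP => s.
  have [->|sr] := eqVneq s r; first by rewrite (negPf rA) (negPf rA').
  have := e s; rewrite /hook (negPf sr); by case: (s \in A); case: (s \in A').
transitivity (\sum_(f in [set h p | p in hooks (R - k)%N]%SET) F (fun r => f r)).
  apply: eq_bigl => f; apply/idP/imsetP => [ft|[p pD ->]].
    have tyE (j : nat) (jn : (j < n.+1)%N) : #|[set r | f r == j :> nat]%SET| =
        if j == 0%N then (R - (R - k).+1)%N else ((k == j) + (1%N == j) * (R - k))%N.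
      have := forallP ft (Ordinal jn); rewrite /= size_nseq count_nseq => /eqP <-.
      by rewrite cardsE; apply: eq_card => r; rewrite !inE.
    have := tyE k kn; rewrite (gtn_eqF (ltnW k1)) eqxx (ltn_eqF k1) mul0n addn0.
    move/eqP/cards1P => [r0 hr0].
    exists (r0, [set r | f r == 1%N :> nat]%SET).
      rewrite inE /=; apply/andP; split.
        rewrite inE; have : r0 \in [set r0]%SET by rewrite inE.
        by rewrite -hr0 inE => /eqP ->; rewrite gtn_eqF.
      have n1 : (1 < n.+1)%N by rewrite /n /=; lia.
      by rewrite (tyE 1%N n1) /= (gtn_eqF k1) mul1n.
    apply/ffunP => r; apply/val_inj; rewrite /= hE /hook /=.
    have := hr0 => /finset.setP /(_ r); rewrite !inE; case: eqP => fk <- //.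
    have [//|f1] := eqVneq (f r : nat) 1%N; rewrite ?f1 //.
    apply/eqP; rewrite -[_ == _]negbK -lt0n; apply/negP => f0.
    have := tyE (f r) (ltn_ord _); rewrite (gtn_eqF f0) eq_sym (introF eqP fk) eq_sym (negPf f1).
    move/eqP; rewrite cards_eq0 => /eqP /finset.setP /(_ r); rewrite !inE eqxx //.
  move: pD; case: p => r A; rewrite inE /= => /andP[rA /eqP cA].
  apply/forallP => j; rewrite /= size_nseq count_nseq; apply/eqP.
  have -> : #|[pred r0 | h (r, A) r0 == j]| = #|[set s | hook r k A s == j]%SET|.
    by rewrite cardsE; apply: eq_card => s; rewrite !inE -val_eqE /= hE.
  have [j0|j0] := eqVneq (j : nat) 0%N.
    have -> : [set s | hook r k A s == j]%SET = ~: (r |: A).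
      apply/finset.setP => s; rewrite !inE /hook j0; case: (s =P r) => _ /=; first by case: (k) k1.
      by case: (s \in A).
    by rewrite cardsCs finset.setCK cardsU1 rA cA card_ord add1n.
  have [jk|jk] := eqVneq (j : nat) k.
    have -> : [set s | hook r k A s == j]%SET = [set r]%SET.
      apply/finset.setP => s; rewrite !inE /hook jk; case: (s =P r) => _ /=; first by rewrite eqxx.
      by case: (s \in A); [rewrite ltn_eqF | rewrite ltn_eqF // ltnW].
    by rewrite cards1 /= jk (ltn_eqF k1).
  have [j1|j1] := eqVneq (j : nat) 1%N.
    have -> : [set s | hook r k A s == j]%SET = A.
      apply/finset.setP => s; rewrite !inE /hook j1; case: (s =P r) => [->|_] /=; last by case: (s \in A).
      by rewrite (gtn_eqF k1) (negPf rA).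
    by rewrite cA /= j1 mul1n.
  have -> : [set s | hook r k A s == j]%SET = finset.set0.
    apply/finset.setP => s; rewrite !inE /hook; case: (s =P r) => _; first by rewrite eq_sym (negPf jk).
    by case: (s \in A); rewrite eq_sym ?(negPf j1) ?(negPf j0).
  by rewrite cards0 /= eq_sym (negPf j1).
rewrite big_imset //=; apply: eq_bigr => p _; congr F; apply/funext => r; exact: hE.
Qed.

(** The pair (A, s) with s in A corresponds to the pair (A minus s, s); given the smaller set there are
R - n - 1 choices of s, as r is excluded too. *)
Lemma sum_hooks_remove n (F : 'I_R -> {set 'I_R} -> U) :
  \sum_(p in hooks n.+1) \sum_(s in p.2) F p.1 (p.2 :\ s)%SET
  = \sum_(p in hooks n) F p.1 p.2 *+ (R - n.+1)%N.
Proof.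
rewrite (sum_hooks n.+1 (fun r A => \sum_(s in A) F r (A :\ s)%SET)).
rewrite (sum_hooks n (fun r A => F r A *+ (R - n.+1)%N)); apply: eq_bigr => r _.
rewrite (exchange_big_dep predT) //=.
transitivity (\sum_s \sum_(B : {set 'I_R} | [&& s \notin r |: B, r \notin B & #|B| == n]) F r B).
  apply: eq_bigr => s _.
  rewrite (reindex_onto (fun B => s |: B) (fun A => A :\ s)%SET) /=; last first.
    by move=> A /andP[_ sA]; rewrite finset.setD1K.
  apply: eq_big => [B|B]; last by move=> /andP[_ /eqP ->].
  rewrite !inE eqxx /= andbT.
  have [sB|sB] := boolP (s \in B).
    rewrite orbT /=; apply/negbTE/negP => /andP[_ /eqP /finset.setP /(_ s)].
    by rewrite !inE eqxx sB.
  rewrite finset.setU1K // eqxx andbT cardsU1 sB add1n eqSS orbF negb_or [r == s]eq_sym.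
  by rewrite andbA.
rewrite (exchange_big_dep (fun B : {set 'I_R} => (r \notin B) && (#|B| == n))) /=; last first.
  by move=> s B _ /and3P[_ -> ->].
apply: eq_bigr => B /andP[rB /eqP cB].
rewrite (eq_bigl (fun s => s \in ~: (r |: B))); last by move=> s; rewrite !inE rB cB eqxx !andbT.
rewrite sumr_const; congr (_ *+ _).
by rewrite cardsCs finset.setCK cardsU1 rB cB card_ord add1n.
Qed.

End HookLabels.

(** * The vector Psi *)

Section PsiVector.
Context {K : realType} {V : vosa K}.
Local Notation C := K[i].
Variable R : nat.
Variable psi : bool -> 'I_R -> V.
Hypothesis ff : free_fermions psi.
Hypothesis hR : (2 <= R)%N.
Local Notation J1 := (sqmode (Defs.J psi) 1).

Lemma J1_lin : islin J1.
Proof. by move=> a u v; rewrite !(sqmode_J ff) (Jser_lin psi). Qed.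

Definition ones : V := bprod psi (fun=> 1%N).

(** The Fock vector of the partition 1^(R-k) k^1, extended to k = 1. *)
Definition hooksum k : V := \sum_(p in hooks R (R - k)%N) bprod psi (hook p.1 k p.2).

(** The hooks with one unit label fewer than in [hooksum k]; at k = R there is none to omit, whence 0. *)
Definition gam k : V :=
  if (k < R)%N then \sum_(p in hooks R (R - k.+1)%N) bprod psi (hook p.1 k p.2) else 0.

Lemma beta_ones : beta psi (nseq R 1%N) = ones.
Proof. by rewrite /beta (sum_type_ones (fun f => bprod psi f)) // ltnW. Qed.

Lemma beta_hook k : (1 < k <= R)%N -> beta psi (k :: nseq (R - k)%N 1%N) = hooksum k.
Proof. by move=> hk; rewrite /beta (sum_type_hook (fun f => bprod psi f)). Qed.

Lemma J1_hook (r : 'I_R) k (A : {set 'I_R}) : (0 < k)%N -> r \notin A -> J1 (bprod psi (hook r k A)) =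
  bprod psi (hook r k.-1 A) + \sum_(s in A) bprod psi (hook r k (A :\ s)%SET).
Proof.
move=> k0 rA; rewrite (sqJ_bprod ff) (bigD1 r) /=; last by rewrite /hook eqxx -lt0n.
congr (bprod psi _ + _).
  by apply/funext => s; rewrite /hook eqxx; case: (s =P r).
apply: eq_big => [s|s /andP[_ sr]].
  rewrite /hook; case: (s =P r) => [->|_]; first by rewrite andbF (negPf rA).
  by rewrite andbT; case: (s \in A).
congr (bprod psi _); apply/funext => t; rewrite /hook (negPf sr) !inE.
have [->|ts] := eqVneq t s; first by rewrite (negPf sr); case: (s \in A).
by case: (t =P r).
Qed.

(** J[1] lowers either k, or one of the unit labels; in the second case each shorter hook arises k times. *)
Lemma J1_hooksum k : (0 < k <= R)%N -> J1 (hooksum k) = gam k.-1 + gam k *+ k.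
Proof.
move=> /andP[k0 kR]; rewrite /hooksum (islin_sum J1_lin).
rewrite (eq_bigr (fun p : 'I_R * {set 'I_R} => bprod psi (hook p.1 k.-1 p.2) +
    \sum_(s in p.2) bprod psi (hook p.1 k (p.2 :\ s)%SET))); last first.
  by move=> [r A]; rewrite inE /= => /andP[rA _]; exact: J1_hook.
rewrite big_split /= /gam prednK // kR; congr (_ + _).
(* for k = R there are no unit labels left to lower *)
case: ltnP => hk; last first.
  rewrite mul0rn big1 // => -[r A]; rewrite inE /= => /andP[_].
  have -> : (R - k = 0)%N by lia.
  by rewrite cards_eq0 => /eqP ->; rewrite big_pred0 // => s; rewrite inE.
have -> : (R - k = (R - k.+1).+1)%N by lia.
rewrite (sum_hooks_remove (R - k.+1)%N (fun r A => bprod psi (hook r k A))).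
rewrite -sumrMnl; apply: eq_bigr => p _; congr (_ *+ _); lia.
Qed.

(** At k = 1 all R hooks are the constant label 1. *)
Lemma hooksum1 : hooksum 1 = ones *+ R.
Proof.
rewrite /hooksum (eq_bigr (fun=> ones)); last first.
  move=> [r A]; rewrite inE /= => /andP[rA /eqP cA]; congr (bprod psi _); apply/funext => s.
  rewrite /hook; case: (s =P r) => // /eqP sr.
  have /finset.setP /(_ s) : A = [set~ r]%SET.
    by apply/eqP; rewrite eqEcard cardsC1 card_ord cA subn1 leqnn andbT -finset.setCS finset.setCK finset.sub1set inE.
  by rewrite !inE sr => ->.
by rewrite sumr_const card_hooks subn1 binn muln1.
Qed.

Lemma gam0 : gam 0 = J1 ones.
Proof.
rewrite /ones (sqJ_bprod ff) /gam (ltnW hR) (sum_hooks (R - 1)%N (fun r A => bprod psi (hook r 0 A))).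
apply: eq_big => // r _; rewrite (big_pred1 [set~ r]%SET).
  by congr (bprod psi _); apply/funext => s; rewrite /hook !inE; case: (s =P r).
move=> A; apply/andP/eqP => [[rA /eqP cA]|->]; last by rewrite !inE eqxx cardsC1 card_ord subn1.
by apply/eqP; rewrite eqEcard cardsC1 card_ord cA subn1 leqnn andbT -finset.setCS finset.setCK finset.sub1set inE.
Qed.

Definition pref : C := (-1) ^+ R / (R`!)%:R.
Definition hcoef k : C := (-1) ^+ k.+1 * (k.-1)`!%:R.

Lemma PsiE : Psi psi = pref *: ((R%:R - 1) *: ones + \sum_(2 <= k < R.+1) hcoef k *: hooksum k).
Proof.
rewrite /Psi beta_ones; congr (_ *: (_ + _)).
by apply: eq_big_nat => k hk; rewrite beta_hook.
Qed.

(** With w_k = (-1)^k k! gamma_k the image of the k-th term of Psi is w_(k-1) - w_k, and w_R = 0.  By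
[hooksum1] and [J1_hooksum] at k = 1, w_1 cancels the image of beta_(1^R). *)
Lemma J1_Psi : J1 (Psi psi) = 0.
Proof.
rewrite PsiE (islinZ J1_lin) (islinD J1_lin) (islinZ J1_lin) (islin_sum J1_lin).
pose w k : V := ((-1) ^+ k * k`!%:R) *: gam k.
rewrite (eq_big_nat _ _ (F2 := fun k => w k.-1 - w k)); last first.
  move=> [//|k] hk; have hk' : (0 < k.+1 <= R)%N by case/andP: hk.
  rewrite (islinZ J1_lin) (J1_hooksum hk') /=.
  rewrite /hcoef /w scalerDr -scalerMnr scalerMnl -scaleNr.
  congr (_ *: _ + _ *: _); first by rewrite /= !exprS; ring.
  by rewrite factS natrM -mulr_natr /= !exprS; ring.
rewrite big_add1 /= -[X in _ + X]opprK -sumrN.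
rewrite (eq_bigr (fun k => w k.+1 - w k)) => [|k _]; last by rewrite opprB.
rewrite telescope_sumr ?(ltnW hR) //.
have -> : w R = 0 by rewrite /w /gam ltnn scaler0.
rewrite sub0r opprK.
have h : J1 ones *+ R = J1 ones + gam 1.
  have := @J1_hooksum 1; rewrite hooksum1 gam0 mulr1n (ltnW hR) => <- //.
  by rewrite -scaler_nat -(islinZ J1_lin) scaler_nat.
rewrite scalerBl scale1r scaler_nat h /w expr1 mulr1 scaleN1r.
by rewrite addrAC addrK subrr scaler0.
Qed.

(** Psi as one list of Fock vectors with coefficients, and the value of any function extended linearly
to such lists. *)
Lemma Psi_terms (U : lmodType C) (G : ('I_R -> nat) -> U) : exists t : seq (C * ('I_R -> nat)),
  Psi psi = \sum_(y <- t) y.1 *: bprod psi y.2 /\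
  \sum_(y <- t) y.1 *: G y.2 = pref *: ((R%:R - 1) *: G (fun=> 1%N) +
    \sum_(2 <= k < R.+1) hcoef k *: \sum_(p in hooks R (R - k)%N) G (hook p.1 k p.2)).
Proof.
pose t : seq (C * ('I_R -> nat)) := (pref * (R%:R - 1), fun=> 1%N) ::
  [seq (pref * hcoef k, hook p.1 k p.2) | k <- index_iota 2 R.+1, p <- enum (hooks R (R - k)%N)].
have tE (W : lmodType C) (H : ('I_R -> nat) -> W) : \sum_(y <- t) y.1 *: H y.2 =
   pref *: ((R%:R - 1) *: H (fun=> 1%N) +
    \sum_(2 <= k < R.+1) hcoef k *: \sum_(p in hooks R (R - k)%N) H (hook p.1 k p.2)).
  rewrite /t big_cons big_allpairs_dep /= scalerDr scalerA scaler_sumr; congr (_ + _).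
  by apply: eq_bigr => k _; rewrite big_enum /= !scaler_sumr; apply: eq_bigr => p _; rewrite !scalerA.
by exists t; rewrite PsiE !tE.
Qed.

Lemma prod_hook (g : nat -> C) (r : 'I_R) k (A : {set 'I_R}) : r \notin A -> (k <= R)%N -> #|A| = (R - k)%N ->
  g 0%N = 1 -> \prod_s g (hook r k A s) = g k * g 1%N ^+ (R - k).
Proof.
move=> rA kR cA g0; rewrite (bigD1 r) //= /hook eqxx; congr (_ * _).
rewrite -cA -prodr_const (bigID (mem A)) /= [X in _ * X]big1 ?mulr1 => [|s /andP[sr /negPf sA]]; last first.
  by rewrite (negPf sr) sA.
apply: eq_big => [s|s /andP[sr sA]]; last by rewrite (negPf sr) sA.
by case: (s =P r) => // ->; rewrite (negPf rA).
Qed.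

(** The term of index k collects R binom(R-1, R-k) equal contributions; the constant label and the
coefficient G_0 = -1 account for the terms m = R - 1 and m = R. *)
Lemma Psi_value (G : nat -> C) : G 0%N = -1 ->
  pref * ((R%:R - 1) * \prod_(r < R) (- G 1%N) + \sum_(2 <= k < R.+1) hcoef k *
     \sum_(p in hooks R (R - k)%N) \prod_r (- G (hook p.1 k p.2 r)))
  = \sum_(m < R.+1) (m`!%:R)^-1 * G (R - m)%N * G 1%N ^+ m.
Proof.
move=> G0; have fR : R`!%:R != 0 :> C by rewrite pnatr_eq0 -lt0n fact_gt0.
have s2 n : (-1) ^+ n * (-1) ^+ n = 1 :> C by rewrite -expr2 sqrr_sign.
have F1 m : m`!%:R != 0 :> C by rewrite pnatr_eq0 -lt0n fact_gt0.
have term k : (1 < k <= R)%N -> pref * (hcoef k * \sum_(p in hooks R (R - k)%N)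
    \prod_r (- G (hook p.1 k p.2 r))) = ((R - k)`!%:R)^-1 * G k * G 1%N ^+ (R - k).
  move=> /andP[k1 kR].
  rewrite (eq_bigr (fun=> - G k * (- G 1%N) ^+ (R - k))); last first.
    move=> [r A]; rewrite inE /= => /andP[rA /eqP cA].
    by apply: (@prod_hook (fun j => - G j)) => //; rewrite G0 opprK.
  rewrite sumr_const card_hooks -[_ *+ (R * _)%N]mulr_natr natrM /pref /hcoef.
  have bf : 'C(R.-1, R - k)%:R * ((R - k)`!%:R * (k.-1)`!%:R) = (R.-1)`!%:R :> C.
    rewrite -!natrM; congr (_%:R).
    rewrite -(@bin_fact R.-1 (R - k)); last by lia.
    by congr (_ * (_ * _`!))%N; lia.
  have Rf : R`!%:R = R%:R * (R.-1)`!%:R :> C.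
    by rewrite -natrM; congr (_%:R); case: (R) hR => // n _; rewrite factS.
  have R0 : R%:R != 0 :> C by rewrite pnatr_eq0; lia.
  rewrite [(- G 1%N) ^+ _]exprNn Rf -bf.
  (* signs of Psi, of its k-th coefficient and of the R - k factors - G_1 *)
  have sg : (-1) ^+ R * (-1) ^+ k.+1 * (-1) ^+ (R - k) = -1 :> C.
    by rewrite -!exprD -signr_odd !oddD /= oddB //; case: (odd R); case: (odd k); rewrite ?expr0 ?expr1.
  have C0 : 'C(R.-1, R - k)%:R != 0 :> C by rewrite pnatr_eq0 -lt0n bin_gt0; lia.
  move: sg (F1 (R - k)%N) (F1 k.-1) R0 C0.
  move: ((-1) ^+ R) ((-1) ^+ k.+1) ((-1) ^+ (R - k)) (G 1%N ^+ (R - k)) => a b c d sg h1 h2 R0 C0.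
  transitivity (- (a * b * c) * (((R - k)`!%:R)^-1 * G k * d)); last by rewrite sg opprK mul1r.
  by field; rewrite h1 h2 R0 C0.
rewrite mulrDr mulr_sumr.
rewrite [X in _ + X](eq_big_nat _ _ (F2 := fun k => ((R - k)`!%:R)^-1 * G k * G 1%N ^+ (R - k)));
  last by move=> k; exact: term.
rewrite [RHS](reindex_inj rev_ord_inj) /=.
rewrite (eq_bigr (fun k : 'I_R.+1 => ((R - k)`!%:R)^-1 * G k * G 1%N ^+ (R - k))); last first.
  by move=> k _; rewrite subSS subKn // -ltnS.
rewrite -(big_mkord predT (fun k => ((R - k)`!%:R)^-1 * G k * G 1%N ^+ (R - k))) /=.
rewrite [RHS]big_ltn // [X in _ = _ + X]big_ltn ?ltnS ?(ltnW hR) // [RHS]addrA; congr (_ + _).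
rewrite prodr_const card_ord subn0 subn1 G0 [(- G 1%N) ^+ _]exprNn /pref.
have Rf : R`!%:R = R%:R * (R.-1)`!%:R :> C.
  by rewrite -natrM; congr (_%:R); case: (R) hR => // n _; rewrite factS.
have R0 : R%:R != 0 :> C by rewrite pnatr_eq0; lia.
have -> : G 1%N ^+ R = G 1%N * G 1%N ^+ R.-1 by rewrite -exprS prednK // ltnW.
rewrite Rf; move: (s2 R) (F1 R.-1); move: ((-1) ^+ R) (G 1%N ^+ R.-1) => a d e h.
transitivity (a * a * ((R%:R - 1) * (R%:R * (R.-1)`!%:R)^-1 * (G 1%N * d))); first by ring.
by rewrite e; field; rewrite h R0.
Qed.

End PsiVector.

Theorem proposition6p7 (K : realType) (R : nat) (hR : (2 <= R)%N)
    (V : vosa K) (psi : bool -> 'I_R -> V) (hV : free_fermions psi) :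
  sqmode (J psi) 1 (Psi psi) = 0 /\
  forall (tau z x : K[i]), 0 < complex.Im tau ->
    (forall a b : int, z <> a%:~R + b%:~R * tau) ->
    ZJ_cvg psi (Psi psi) z tau x /\
    ZJ psi (Psi psi) z tau x = KR R z tau * (theta1 z tau / eta tau) ^+ R.
Proof.
split=> [|tau z x tau_gt0 z_generic]; first exact: J1_Psi.
have [t [tPsi tval]] := Psi_terms psi hR (U := K[i]^o)
  (fun f => \prod_r (- Gtilde z tau (f r))).
have h := ZJ_value hV x tau_gt0 z_generic t (fun y => y.1) (fun y => y.2).
cbv zeta in h; rewrite tPsi; split; first exact: h.1.
rewrite (h.2) mulrC; congr (_ * _).
rewrite /KR -(@Psi_value _ _ hR _ (Gtilde0 tau_gt0 z_generic)).
exact: tval.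
Qed.
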